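(* The zero locus in $OG(2,10)$ of a general global section of $\mathcal{S}_+\oplus\mathcal{S}_+$ is isomorphic to $G_2/P_2$.
   Context: Over $\mathbb{C}$. $OG(2,10)$ is the orthogonal Grassmannian of isotropic planes $U$ in $V=\mathbb{C}^{10}$ with a non-degenerate quadratic form. Write $V=E\oplus F$ with $E,F$ maximal isotropic, $F\simeq E^\vee$. The half-spin representations of $Spin_{10}$ are $\Delta_+=\wedge^{even}E$, $\Delta_-=\wedge^{odd}E$, with Clifford action $V\otimes\Delta_\pm\to\Delta_\mp$ ($E$ acts by wedge product, $F$ by contraction). The spinor bundle $\mathcal{S}_\pm$ on $OG(2,10)$ is the homogeneous bundle of rank $4$ whose fiber at $[U]$ is the cokernel of $U\otimes\Delta_\mp\to\Delta_\pm$; $H^0(\mathcal{S}_\pm)=\Delta_\pm$. $P_2\subset G_2$ is the maximal parabolic subgroup associated to the long simple root, so that $G_2/P_2$ is the adjoint variety of $G_2$, i.e. the closed orbit in $\mathbb{P}(\mathfrak{g}_2)$. *)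

(* Defs.v *)
From HB Require Import structures.
From mathcomp Require Import all_boot all_order all_algebra.
From mathcomp Require Import boolp classical_sets functions.
From mathcomp Require Import mpoly.

Set Implicit Arguments.
Unset Strict Implicit.
Unset Printing Implicit Defensive.

Import GRing.Theory.

Local Open Scope classical_set_scope.
Local Open Scope ring_scope.

(** * Schemes over a field

  A scheme over [K] is handled through its functor of points on commutative
  [K]-algebras (which determines it, as does every natural isomorphism of such
  functors, by the Yoneda lemma).  All the schemes below are closed subschemes
  of Grassmannians: an [A]-point is a submodule of [A^n]. *)

Section Grassmannian.

Variable A : comNzRingType.

(* All the minors of size r + 1 of M vanish and those of size r generate the
   unit ideal.  Over a field this says that M has rank r.  Over a ring it
   says that the row space of M is a direct summand, projective of constant
   rank r, and all such submodules arise in this way. *)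
Definition constant_rank (r m n : nat) (M : 'M[A]_(m, n)) : Prop :=
  (forall (f : 'I_r.+1 -> 'I_m) (g : 'I_r.+1 -> 'I_n),
      \det (mxsub f g M) = 0) /\
  (exists c : {ffun 'I_r -> 'I_m} -> {ffun 'I_r -> 'I_n} -> A,
      \sum_f \sum_g c f g * \det (mxsub f g M) = 1).

Definition row_space (m n : nat) (M : 'M[A]_(m, n)) : set 'rV[A]_n :=
  range (fun v : 'rV[A]_m => v *m M).

Definition grassmannian (r n : nat) : set (set 'rV[A]_n) :=
  [set U | exists (m : nat) (M : 'M[A]_(m, n)),
             constant_rank r M /\ U = row_space M].

End Grassmannian.

(* The image of [U (x)_A B] in [B^n]. *)
Definition base_change (A B : comNzRingType) (f : A -> B) (n : nat)
    (U : set 'rV[A]_n) : set 'rV[B]_n :=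
  [set w | exists (k : nat) (c : 'I_k -> B) (u : 'I_k -> 'rV[A]_n),
             (forall i, U (u i)) /\ w = \sum_i c i *: map_mx f (u i)].

Section Schemes.

Variable K : fieldType.

Definition points (n : nat) : Type :=
  forall A : comAlgType K, set (set 'rV[A]_n).

(* A family of bijections between A-points, natural in A. *)
Definition isomorphic (m n : nat) (X : points m) (Y : points n) : Prop :=
  exists phi : forall A : comAlgType K, set 'rV[A]_m -> set 'rV[A]_n,
    (forall A, set_bij (X A) (Y A) (phi A)) /\
    (forall (A B : comAlgType K) (f : {lrmorphism A -> B}) (U : set 'rV[A]_m),
        X A U -> phi B (base_change f U) = base_change f (phi A U)).

Definition vanishing_ideal (n : nat) (C : set 'rV[K]_n) : set {mpoly K[n]} :=
  [set p | forall x : 'rV[K]_n, C x -> p.@[x 0] = 0].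

Definition zariski_closed (n : nat) (C : set 'rV[K]_n) : Prop :=
  forall x : 'rV[K]_n,
    (forall p, vanishing_ideal C p -> p.@[x 0] = 0) -> C x.

(* The reduced closed subscheme P(C) of P(K^n), for C an affine cone: its
   A-points are the line subbundles of A^n on which the ideal of C vanishes. *)
Definition projectivization (n : nat) (C : set 'rV[K]_n) : points n :=
  fun A => [set L | grassmannian 1 L /\
    forall p l, vanishing_ideal C p -> L l ->
      mmap (in_alg A) (l 0) p = 0].

End Schemes.

(** * The half-spin representations and the orthogonal Grassmannian *)

Section Spin.

Variable A : comNzRingType.

(* V = E (+) F, in coordinates: E has basis e_0, ..., e_4 and F the dual
   basis. *)
Definition quad_form (v : 'rV[A]_(5 + 5)) : A :=
  \sum_i lsubmx v 0 i * rsubmx v 0 i.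

(* The exterior algebra of E: d S is the coordinate of d on the wedge e_S of
   the e_i, i \in S, taken in increasing order. *)
Definition spinor : Type := {ffun {set 'I_5} -> A}.

(* Delta_+ for b = false, Delta_- for b = true. *)
Definition half_spin (b : bool) : set spinor :=
  [set d | forall S : {set 'I_5}, odd #|S| != b -> d S = 0].

(* The sign in  e_i /\ e_S = +- e_(i |: S)  for i \notin S, and in the
   contraction  e_i^* _| e_S = +- e_(S :\ i)  for i \in S. *)
Definition wedge_sign (i : 'I_5) (S : {set 'I_5}) : A :=
  (-1) ^+ #|[set j in S | (j < i)%N]|.

Definition clifford (v : 'rV[A]_(5 + 5)) (d : spinor) : spinor :=
  [ffun S : {set 'I_5} =>
     \sum_(i in S) wedge_sign i S * lsubmx v 0 i * d (S :\ i)
   + \sum_(i in ~: S) wedge_sign i S * rsubmx v 0 i * d (i |: S)].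

(* The image of U (x) Delta_(-b) -> Delta_b, whose cokernel is the fibre at U
   of the spinor bundle S_b. *)
Definition clifford_image (U : set 'rV[A]_(5 + 5)) (b : bool) : set spinor :=
  [set d | exists (k : nat) (u : 'I_k -> 'rV[A]_(5 + 5)) (e : 'I_k -> spinor),
     [/\ forall i, U (u i), forall i, half_spin (~~ b) (e i)
       & d = \sum_i clifford (u i) (e i)]].

Definition orthogonal_grassmannian : set (set 'rV[A]_(5 + 5)) :=
  [set U | grassmannian 2 U /\ forall u, U u -> quad_form u = 0].

End Spin.

Section ZeroLocus.

Variable K : fieldType.

(* H^0(S_+ (+) S_+) = Delta_+ (+) Delta_+ *)
Definition global_section (psi : 'I_2 -> spinor K) : Prop :=
  forall k, half_spin false (psi k).

(* The value at U of the section defined by psi_k is the class of psi_k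
   modulo the image of U (x) Delta_-. *)
Definition zero_locus (psi : 'I_2 -> spinor K) : points K (5 + 5) :=
  fun A => [set U | orthogonal_grassmannian U /\
    forall k, clifford_image U false [ffun S => (psi k S)%:A : A]].

Definition section_coord (psi : 'I_2 -> spinor K)
    (i : 'I_#|{: 'I_2 * {set 'I_5}}|) : K :=
  psi (enum_val i).1 (enum_val i).2.

(* P holds on a nonempty Zariski open subset of the space of sections. *)
Definition general_section (P : ('I_2 -> spinor K) -> Prop) : Prop :=
  exists p : {mpoly K[#|{: 'I_2 * {set 'I_5}}|]},
    (exists psi, global_section psi /\ p.@[section_coord psi] != 0) /\
    (forall psi, global_section psi -> p.@[section_coord psi] != 0 -> P psi).

End ZeroLocus.

(** * G_2 and its adjoint variety

  G_2 is the automorphism group of the (split) octonions, here in the form of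
  Zorn's vector matrices  [a u ; v b]  with  a, b  scalars and  u, v  in K^3,
  with product

    [a u ; v b] [a' u' ; v' b'] =
      [a a' + u.v'                  a u' + b' u - v x v' ;
       a' v + b v' + u x u'         b b' + v.u'        ].  *)

Section Octonions.

Variable K : fieldType.

(* Indices in 'I_3 are added modulo 3. *)
Definition crossmx (u v : 'rV[K]_3) : 'rV[K]_3 :=
  \row_i (u 0 (i + 1) * v 0 (i + 2) - u 0 (i + 2) * v 0 (i + 1)).

Definition zorn (a : 'M[K]_1) (u v : 'rV[K]_3) (b : 'M[K]_1) : 'rV[K]_8 :=
  row_mx (row_mx a u : 'rV_4) (row_mx v b : 'rV_4).

Definition octmul (x x' : 'rV[K]_8) : 'rV[K]_8 :=
  let ul (y : 'rV[K]_(4 + 4)) : 'rV[K]_(1 + 3) := lsubmx y in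
  let dr (y : 'rV[K]_(4 + 4)) : 'rV[K]_(3 + 1) := rsubmx y in
  let a := lsubmx (ul x) in let a' := lsubmx (ul x') in
  let u := rsubmx (ul x) in let u' := rsubmx (ul x') in
  let v := lsubmx (dr x) in let v' := lsubmx (dr x') in
  let b := rsubmx (dr x) in let b' := rsubmx (dr x') in
  zorn (a *m a' + u *m v'^T)
       (a *m u' + b' *m u - crossmx v v')
       (a' *m v + b *m v' + crossmx u u')
       (b *m b' + v *m u'^T).

(* Matrices act on row vectors, on the right. *)
Definition G2 : set 'M[K]_8 :=
  [set g | g \in unitmx /\
     forall x y, octmul (x *m g) (y *m g) = octmul x y *m g].

Definition g2 : set 'M[K]_8 :=
  [set D | forall x y,
     octmul x y *m D = octmul (x *m D) y + octmul x (y *m D)].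

(* The affine cone over the G2-orbit of [D] in P(g2). *)
Definition orbit_cone (D : 'M[K]_8) : set 'rV[K]_(8 * 8) :=
  [set w | exists c g, G2 g /\ w = mxvec (c *: (invmx g *m D *m g))].

(* The closed orbit in P(g2), i.e., the set of the [D] whose orbit is closed.
   There is a single closed orbit, as g2 is an irreducible representation: the
   orbit of the highest root line.  The highest root of G2 is the fundamental
   weight of the long simple root, so the stabilizer of this line is P2. *)
Definition G2_mod_P2 : points K (8 * 8) :=
  projectivization [set w | exists D : 'M[K]_8,
    [/\ w = mxvec D, g2 D, D != 0 & zariski_closed (orbit_cone D)]].

End Octonions.

Arguments G2_mod_P2 K : clear implicits.

(* Main.v *)
(* A general pair of even spinors is brought, by elements 1 + n m of the Clifford
   group (n an isotropic vector), by a torus and by rescaling, to the pair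
   1 + e_0123, e_04 + e_1234.  All the coefficients of the elements used are
   rational functions regular at this pair, which gives the nonempty open set.

   A spinor d vanishes at an isotropic plane U iff u u' d = 0 for u, u' in U (the
   spinor Koszul complex is exact).  Pairing the two normal forms with the u d
   puts U inside a 7-dimensional subspace of V, identified with the traceless
   octonions, and there u u' d = 0 becomes u u' = 0 in the octonions: the zero
   locus is the variety of null planes of the traceless octonions.

   The plane spanned by x and y goes to the line spanned by the derivation
   attached to x /\ y.  The nonzero derivations of this form are a single G2-orbit
   of nilpotents, whose cone is closed and lies in the closure of every nonzero
   orbit.  Everything is done for points over arbitrary algebras: a polynomial
   vanishing on the cone vanishes at all null planes, since these are covered by
   the translates of a big cell which is parametrized by polynomials, and the
   cone satisfies enough linear and quadratic equations to recover the plane. *)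

Require Import Defs.
From HB Require Import structures.
From mathcomp Require Import all_boot all_order all_algebra.
From mathcomp Require Import boolp classical_sets functions.
From mathcomp Require Import mpoly.
From mathcomp Require Import reals.
From mathcomp Require Import complex.
From mathcomp Require Import ring.

Set Implicit Arguments.
Unset Strict Implicit.
Unset Printing Implicit Defensive.

Import GRing.Theory.

Local Open Scope classical_set_scope.
Local Open Scope ring_scope.

(** * Constant rank and unit ideals *)

Section UnitIdeals.

Variable A : comNzRingType.

(** An [A]-point is a projective submodule without a preferred basis, and nothing is localized. A
    claim about it is multiplied by a minor, after which two rows (or one) generate; the multipliers
    for which it holds form an ideal, which contains 1 as soon as it contains a power of each minor.
    The exponents chosen in the proofs count the minors spent.

    The adjoint variety is cut out by the polynomials that vanish on [K]-points, so a membership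
    over [A] must come from a parametrization free of denominators: an identity that holds at the
    [K]-points, [K] being infinite, holds over [A]. The translates of the cell by [K]-points of [G2]
    suffice because the translates of one long root coordinate span all the coordinates of [g2];
    this is where 2 and 3 must be invertible.

    The standard pair is at once the normal form and the point where the open conditions are tested.
    Every change of coordinates is chosen trivial there, with denominator 1, so that all the
    successive open sets contain it and their intersection is not empty. *)

Definition is_ideal (J : set A) : Prop :=
  J 0 /\ forall a x y, J x -> J y -> J (a * x + y).

Section Ideal.

Variables (J : set A) (idJ : is_ideal J).

Lemma ideal0 : J 0. Proof. by case: idJ. Qed.

Lemma idealMl a x : J x -> J (a * x).
Proof. by move=> Jx; rewrite -[_ * _]addr0; apply: idJ.2 => //; exact: ideal0. Qed.

Lemma idealD x y : J x -> J y -> J (x + y).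
Proof. by move=> Jx Jy; rewrite -[x]mul1r; apply: idJ.2. Qed.

Lemma ideal_sum (I : Type) (r : seq I) (P : pred I) (F : I -> A) :
  (forall i, P i -> J (F i)) -> J (\sum_(i <- r | P i) F i).
Proof. by move=> JF; apply: big_ind => //; [exact: ideal0 | exact: idealD]. Qed.

Definition radical : set A := [set x | exists N, J (x ^+ N)].

Lemma radical_ideal : is_ideal radical.
Proof.
split=> [|a x y [m Jx] [n Jy]]; first by exists 1%N; rewrite expr1; exact: ideal0.
exists (m + n)%N; rewrite exprDn; apply: ideal_sum => i _.
rewrite -mulr_natl; apply: idealMl; have [lt_in | le_ni] := ltnP i n.
  have le_m : (m <= m + n - i)%N by rewrite -addnBA ?leq_addr // ltnW.
  rewrite -(subnK le_m) exprMn [x ^+ _]exprD mulrA mulrAC.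
  exact: idealMl.
by rewrite -(subnK le_ni) exprD mulrA; apply: idealMl.
Qed.

Lemma radical1 : radical 1 -> J 1.
Proof. by case=> N; rewrite expr1n. Qed.

End Ideal.

End UnitIdeals.

Section ConstantRank.

Variable A : comNzRingType.

(** The combinations of the minors are the smallest ideal containing them, so the explicit
    coefficients can be traded for a statement about all ideals. This is the form that replaces
    localization at the minors. *)
Lemma constant_rankP r m n (M : 'M[A]_(m, n)) :
  constant_rank r M <->
  (forall (f : 'I_r.+1 -> 'I_m) (g : 'I_r.+1 -> 'I_n), \det (mxsub f g M) = 0)
  /\ (forall J : set A, is_ideal J ->
       (forall (f : 'I_r -> 'I_m) (g : 'I_r -> 'I_n), J (\det (mxsub f g M))) ->
       J 1).
Proof.
split=> -[minor0 unitM]; split=> //; first move=> J idJ JM.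
  case: unitM => c <-; apply: (ideal_sum idJ) => f _.
  by apply: (ideal_sum idJ) => g _; apply: (idealMl idJ).
pose J : set A := fun x => exists c : {ffun 'I_r -> 'I_m} ->
  {ffun 'I_r -> 'I_n} -> A, \sum_f \sum_g c f g * \det (mxsub f g M) = x.
apply: (unitM J _ _) => [|f g].
  split=> [|a x y [cx <-] [cy <-]].
    by exists (fun _ _ => 0); rewrite big1 // => f _; rewrite big1 // => g _;
      rewrite mul0r.
  exists (fun f g => a * cx f g + cy f g).
  rewrite mulr_sumr -big_split; apply: eq_bigr => f _ /=.
  rewrite mulr_sumr -big_split; apply: eq_bigr => g _ /=.
  by rewrite mulrDl mulrA.
exists (fun f' g' => ((f' == finfun f) && (g' == finfun g))%:R).
rewrite (bigD1 (finfun f)) //= (bigD1 (finfun g)) //= !eqxx mul1r.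
rewrite big1 ?addr0 => [|g' /negPf->]; last by rewrite andbF mul0r.
rewrite big1 ?addr0 => [|f' /negPf->]; last first.
  by rewrite big1 // => g' _; rewrite mul0r.
by congr (\det _); apply/matrixP => i j; rewrite !mxE !ffunE.
Qed.

Lemma det_mx22 (M : 'M[A]_2) :
  \det M = M 0 0 * M 1 1 - M 0 1 * M 1 0.
Proof.
rewrite (expand_det_row M 0) !big_ord_recl big_ord0 /cofactor !det_mx11 !mxE /=.
rewrite (_ : lift _ _ = 1); last exact: val_inj.
rewrite (_ : lift _ _ = 0); last exact: val_inj.
by rewrite expr0 mul1r expr1 mulN1r mulrN addr0.
Qed.

Lemma det_mx33 (M : 'M[A]_3) :
  \det M = M 0 0 * (M 1 1 * M 2 2 - M 1 2 * M 2 1)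
         - M 0 1 * (M 1 0 * M 2 2 - M 1 2 * M 2 0)
         + M 0 2 * (M 1 0 * M 2 1 - M 1 1 * M 2 0).
Proof.
rewrite (expand_det_row M 0) !big_ord_recl big_ord0 /cofactor !det_mx22 !mxE.
pose F i j := M (inord i) (inord j).
have ME i j : M i j = F i j by rewrite /F !inord_val.
by rewrite !ME /= /bump /=; ring.
Qed.

(* One half of the Cauchy-Binet formula, before grouping the terms. *)
Lemma det_mulmx_rowsub r n (B : 'M[A]_(r, n)) (C : 'M[A]_(n, r)) :
  \det (B *m C) =
  \sum_(h : {ffun 'I_r -> 'I_n}) (\prod_i B i (h i)) * \det (rowsub h C).
Proof.
rewrite /determinant.
under [RHS]eq_bigr do rewrite mulr_sumr.
rewrite exchange_big; apply: eq_bigr => s _ /=.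
under eq_bigr do rewrite mxE.
rewrite bigA_distr_bigA mulr_sumr; apply: eq_bigr => h _.
rewrite big_split mulrCA; congr (_ * (_ * _)).
by apply: eq_bigr => i _; rewrite !mxE.
Qed.

Lemma det_mulmx_colsub r n (B : 'M[A]_(r, n)) (C : 'M[A]_(n, r)) :
  \det (B *m C) =
  \sum_(h : {ffun 'I_r -> 'I_n}) (\prod_i C (h i) i) * \det (colsub h B).
Proof.
rewrite -det_tr trmx_mul det_mulmx_rowsub; apply: eq_bigr => h _.
congr (_ * _); first by apply: eq_bigr => i _; rewrite mxE.
by rewrite -det_tr; congr (\det _); apply/matrixP => i j; rewrite !mxE.
Qed.

Lemma mxsub_mulmx r m n p (f : 'I_r -> 'I_m) (g : 'I_r -> 'I_p)
    (M : 'M[A]_(m, n)) (P : 'M_(n, p)) :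
  mxsub f g (M *m P) = rowsub f M *m colsub g P.
Proof.
apply/matrixP => i j; rewrite !mxE; apply: eq_bigr => k _; by rewrite !mxE.
Qed.

(** By Cauchy-Binet the minors of [M *m P] are combinations of those of [M], and conversely because
    [Q] undoes [P] on the rows of [M]. Only injectivity on these rows matters; [P] need not be
    square. *)
Lemma constant_rank_mulmx r m n p (M : 'M[A]_(m, n)) (P : 'M_(n, p))
    (Q : 'M_(p, n)) :
  M *m P *m Q = M -> constant_rank r M -> constant_rank r (M *m P).
Proof.
move=> MPQ /constant_rankP[minor0 unitM]; apply/constant_rankP; split=> [f g|J idJ JMP].
  rewrite mxsub_mulmx det_mulmx_colsub big1 // => h _.
  rewrite [X in \det X](_ : _ = mxsub f h M) ?minor0 ?mulr0 //.
  by apply/matrixP => i j; rewrite !mxE.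
apply: (unitM J idJ) => f g; rewrite -MPQ mxsub_mulmx det_mulmx_colsub.
apply: (ideal_sum idJ) => h _; apply: (idealMl idJ).
rewrite [X in \det X](_ : _ = mxsub f h (M *m P)) //.
by apply/matrixP => i j; rewrite !mxE.
Qed.

Definition minor2 m n (M : 'M[A]_(m, n)) (i j : 'I_m) (a b : 'I_n) : A :=
  M i a * M j b - M i b * M j a.

(** Powers are allowed because an ideal contains 1 as soon as its radical does; each use may thus
    multiply by a minor as often as it needs. *)
Lemma rank2_unit m n (M : 'M[A]_(m, n)) (J : set A) :
  constant_rank 2 M -> is_ideal J ->
  (forall i j a b, exists N, J (minor2 M i j a b ^+ N)) -> J 1.
Proof.
move=> /constant_rankP[_ unitM] idJ JM; apply: (radical1).
apply: (unitM _ (radical_ideal idJ)) => f g; rewrite det_mx22 !mxE.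
by have [N JN] := JM (f 0) (f 1) (g 0) (g 1); exists N.
Qed.

(** Cramer's rule: the expansion of the vanishing minor on the rows [i], [j], [k] and the columns
    [a], [b], [c], for each [c]. *)
Lemma rank2_row m n (M : 'M[A]_(m, n)) i j a b k :
  constant_rank 2 M ->
  minor2 M i j a b *: row k M
  = minor2 M k j a b *: row i M + minor2 M i k a b *: row j M.
Proof.
move=> [minor0 _]; apply/rowP => c; rewrite !mxE /minor2.
pose f (x : 'I_3) := tnth [tuple i; j; k] x.
pose g (x : 'I_3) := tnth [tuple a; b; c] x.
have := minor0 f g; rewrite det_mx33 !mxE /f /g !(tnth_nth i) !(tnth_nth a) /=.
move/eqP; rewrite -subr_eq0 => /eqP E; apply/eqP; rewrite -subr_eq0 -E; apply/eqP.
by ring.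
Qed.

Lemma constant_rank2P m n (M : 'M[A]_(m, n)) :
  (forall i j k a b c, M i a * (M j b * M k c - M j c * M k b)
         - M i b * (M j a * M k c - M j c * M k a)
         + M i c * (M j a * M k b - M j b * M k a) = 0) ->
  (forall J : set A, is_ideal J -> (forall i j a b, J (minor2 M i j a b)) -> J 1) ->
  constant_rank 2 M.
Proof.
move=> minor0 unitM; apply/constant_rankP; split=> [f g|J idJ JM].
  by rewrite det_mx33 !mxE minor0.
apply: unitM => // i j a b.
pose f (x : 'I_2) := tnth [tuple i; j] x.
pose g (x : 'I_2) := tnth [tuple a; b] x.
have := JM f g; rewrite det_mx22 !mxE /f /g !(tnth_nth i) !(tnth_nth a) /=.
by [].
Qed.

Lemma rank1_unit m n (M : 'M[A]_(m, n)) (J : set A) :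
  constant_rank 1 M -> is_ideal J ->
  (forall i a, exists N, J (M i a ^+ N)) -> J 1.
Proof.
move=> /constant_rankP[_ unitM] idJ JM; apply: (radical1).
apply: (unitM _ (radical_ideal idJ)) => f g; rewrite det_mx11 !mxE.
by have [N JN] := JM (f 0) (g 0); exists N.
Qed.

Lemma rank1_row m n (M : 'M[A]_(m, n)) i a k :
  constant_rank 1 M -> M i a *: row k M = M k a *: row i M.
Proof.
move=> [minor0 _]; apply/rowP => c; rewrite !mxE.
pose f (x : 'I_2) := tnth [tuple i; k] x.
pose g (x : 'I_2) := tnth [tuple a; c] x.
have := minor0 f g; rewrite det_mx22 !mxE /f /g !(tnth_nth i) !(tnth_nth a) /=.
by move/subr0_eq => ->; rewrite mulrC.
Qed.

Lemma constant_rank1P m n (M : 'M[A]_(m, n)) :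
  (forall i j a b, minor2 M i j a b = 0) ->
  (forall J : set A, is_ideal J -> (forall i a, J (M i a)) -> J 1) ->
  constant_rank 1 M.
Proof.
move=> minor0 unitM; apply/constant_rankP; split=> [f g|J idJ JM].
  by rewrite det_mx22 !mxE; apply: minor0.
apply: unitM => // i a.
by have := JM (fun=> i) (fun=> a); rewrite det_mx11 !mxE.
Qed.

Lemma row_space_row m n (M : 'M[A]_(m, n)) i : row_space M (row i M).
Proof. by exists (delta_mx 0 i) => //; rewrite rowE. Qed.

Lemma row_spaceP m n (M : 'M[A]_(m, n)) u :
  row_space M u <-> exists c : 'I_m -> A, u = \sum_i c i *: row i M.
Proof.
split=> [[v _ <-]|[c ->]]; first by exists (v 0); rewrite mulmx_sum_row.
exists (\row_i c i) => //; rewrite mulmx_sum_row; apply: eq_bigr => i _.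
by rewrite mxE.
Qed.

End ConstantRank.

Section Submodules.

Variables (A : comNzRingType).

Definition is_submodule (V : lmodType A) (U : set V) : Prop :=
  U 0 /\ forall a u v, U u -> U v -> U (a *: u + v).

Section Closure.

Variables (V : lmodType A) (U : set V) (sU : is_submodule U).

Lemma submod0 : U 0. Proof. by case: sU. Qed.

Lemma submodZ a u : U u -> U (a *: u).
Proof. by move=> Uu; rewrite -[_ *: _]addr0; apply: sU.2 => //; exact: submod0. Qed.

Lemma submodD u v : U u -> U v -> U (u + v).
Proof. by move=> Uu Uv; rewrite -[u]scale1r; apply: sU.2. Qed.

Lemma submodN u : U u -> U (- u).
Proof. by move=> Uu; rewrite -scaleN1r; apply: submodZ. Qed.

Lemma submodB u v : U u -> U v -> U (u - v).
Proof. by move=> Uu Uv; apply: submodD => //; apply: submodN. Qed.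

Lemma submod_sum (I : Type) (r : seq I) (P : pred I) (F : I -> V) :
  (forall i, P i -> U (F i)) -> U (\sum_(i <- r | P i) F i).
Proof. by move=> UF; apply: big_ind => //; [exact: submod0 | exact: submodD]. Qed.

Lemma conductor_ideal z : is_ideal [set a | U (a *: z)].
Proof.
split=> [|a x y /= Ux Uy]; first by rewrite /= scale0r; exact: submod0.
by rewrite scalerDl -scalerA; apply: sU.2.
Qed.

End Closure.

Lemma zero_submodule (V : lmodType A) : is_submodule [set (0 : V)].
Proof. by split=> // a u v -> ->; rewrite scaler0 add0r. Qed.

Lemma row_space_submodule m n (M : 'M[A]_(m, n)) : is_submodule (row_space M).
Proof.
split=> [|a _ _ [v _ <-] [w _ <-]]; first by exists 0 => //; rewrite mul0mx.
by exists (a *: v + w) => //; rewrite mulmxDl scalemxAl.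
Qed.

Definition lspan (V : lmodType A) (X : set V) : set V :=
  [set w | exists (k : nat) (c : 'I_k -> A) (u : 'I_k -> V),
             (forall i, X (u i)) /\ w = \sum_i c i *: u i].

Lemma span_submodule (V : lmodType A) (X : set V) : is_submodule (lspan X).
Proof.
split=> [|a _ _ [k [c [u [Xu ->]]]] [l [d [v [Xv ->]]]]].
  by exists 0%N, (fun=> 0), (fun=> 0); split=> [[]|] //; rewrite big_ord0.
exists (k + l)%N, (fun i => match fintype.split i with inl i => a * c i | inr i => d i end),
  (fun i => match fintype.split i with inl i => u i | inr i => v i end); split=> [i|].
  by case: (fintype.split i).
rewrite big_split_ord scaler_sumr /=; congr (_ + _); apply: eq_bigr => i _.
  by rewrite (unsplitK (inl i)) scalerA.
by rewrite (unsplitK (inr i)).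
Qed.

Lemma mem_span (V : lmodType A) (X : set V) x : X x -> lspan X x.
Proof.
move=> Xx; exists 1%N, (fun=> 1), (fun=> x).
by split=> //; rewrite big_ord1 scale1r.
Qed.

Lemma span_min (V : lmodType A) (X U : set V) :
  is_submodule U -> X `<=` U -> lspan X `<=` U.
Proof.
move=> sU XU _ [k [c [u [Xu ->]]]]; apply: (submod_sum sU) => i _.
by apply: (submodZ sU); apply: XU.
Qed.

Lemma row_space_span m n (M : 'M[A]_(m, n)) (X : set 'rV[A]_n) :
  (forall i, X (row i M)) -> X `<=` row_space M -> lspan X = row_space M.
Proof.
move=> XM MX; apply/seteqP; split; first exact: span_min (row_space_submodule M) MX.
by move=> _ /row_spaceP[c ->]; exists m, c, (fun i => row i M).
Qed.

End Submodules.

Lemma base_changeE (A B : comNzRingType) (f : A -> B) n (U : set 'rV[A]_n) :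
  base_change f U = lspan [set map_mx f u | u in U].
Proof.
apply/seteqP; split=> w [k [c [u [Uu ->]]]].
  by exists k, c, (fun i => map_mx f (u i)); split=> // i; exists (u i).
have /choice[v vP] i : exists v, U v /\ map_mx f v = u i.
  by have [v Uv <-] := Uu i; exists v.
exists k, c, v; split=> [i|]; first by case: (vP i).
by apply: eq_bigr => i _; case: (vP i) => _ ->.
Qed.

(** * Functors of points *)

Section Isomorphisms.

Variable K : fieldType.

Lemma isomorphic_trans m n p (X : points K m) (Y : points K n) (Z : points K p) :
  isomorphic X Y -> isomorphic Y Z -> isomorphic X Z.
Proof.
move=> [phi [phi_bij phi_nat]] [psi [psi_bij psi_nat]].
exists (fun A => psi A \o phi A); split=> [A|A B f U XU /=].
  exact: set_bij_comp (phi_bij A) (psi_bij A).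
rewrite phi_nat // psi_nat //; have [+ _ _] := phi_bij A; apply=> //.
Qed.

Definition extend (A : comAlgType K) m n (P : 'M[K]_(m, n)) : 'M[A]_(m, n) :=
  map_mx (in_alg A) P.

Lemma map_extend (A B : comAlgType K) (f : {lrmorphism A -> B}) m n
    (P : 'M[K]_(m, n)) : map_mx f (extend A P) = extend B P.
Proof. by apply/matrixP => i j; rewrite !mxE rmorph_alg. Qed.

Lemma extendM (A : comAlgType K) m n p (P : 'M[K]_(m, n)) (Q : 'M[K]_(n, p)) :
  extend A (P *m Q) = extend A P *m extend A Q.
Proof. exact: map_mxM. Qed.

Definition push (A : comNzRingType) m n (P : 'M[A]_(m, n)) (U : set 'rV[A]_m) :
  set 'rV[A]_n := [set u *m P | u in U].

Lemma push_row_space (A : comNzRingType) k m n (M : 'M[A]_(k, m))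
    (P : 'M[A]_(m, n)) : push P (row_space M) = row_space (M *m P).
Proof.
apply/seteqP; split=> [_ [_ [v _ <-] <-]|_ [v _ <-]].
  by exists v => //; rewrite mulmxA.
by exists (v *m M); [exists v | rewrite mulmxA].
Qed.

Lemma pushK (A : comNzRingType) m n (P : 'M[A]_(m, n)) (Q : 'M[A]_(n, m))
    (U : set 'rV[A]_m) :
  (forall u, U u -> u *m P *m Q = u) -> push Q (push P U) = U.
Proof.
move=> PQ; apply/seteqP; split=> [_ [_ [u Uu <-] <-]|u Uu]; first by rewrite PQ.
by exists (u *m P); [exists u | exact: PQ].
Qed.

Lemma grassmannian_push (A : comNzRingType) r m n (P : 'M[A]_(m, n))
    (Q : 'M[A]_(n, m)) (U : set 'rV[A]_m) :
  (forall u, U u -> u *m P *m Q = u) ->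
  grassmannian r U -> grassmannian r (push P U).
Proof.
move=> PQ [k [M [rM defU]]]; rewrite defU push_row_space.
exists k, (M *m P); split=> //; apply: (constant_rank_mulmx (Q := Q)) => //.
apply/row_matrixP => i; rewrite !row_mul PQ // defU; exact: row_space_row.
Qed.

Lemma base_change_push (A B : comAlgType K) (f : {lrmorphism A -> B}) m n
    (P : 'M[K]_(m, n)) (U : set 'rV[A]_m) :
  push (extend B P) (base_change f U) = base_change f (push (extend A P) U).
Proof.
apply/seteqP; split=> [_ [_ [k [c [u [Uu ->]]]] <-]|_ [k [c [u [PUu ->]]]]].
  exists k, c, (fun i => u i *m extend A P); split=> [i|]; first by exists (u i).
  rewrite mulmx_suml; apply: eq_bigr => i _.
  by rewrite map_mxM map_extend scalemxAl.
have /choice[v vP] i : exists v, U v /\ v *m extend A P = u i.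
  by have [v Uv <-] := PUu i; exists v.
exists (\sum_i c i *: map_mx f (v i)).
  by exists k, c, v; split=> // i; case: (vP i).
rewrite mulmx_suml; apply: eq_bigr => i _; case: (vP i) => _ <-.
by rewrite map_mxM map_extend scalemxAl.
Qed.

(** The matrices have entries in [K], so the maps on points commute with base change. They only have
    to be inverse to each other on the submodules concerned, which permits ambient spaces of
    different dimensions. *)
Lemma linear_isomorphic m n (X : points K m) (Y : points K n)
    (P : 'M[K]_(m, n)) (Q : 'M[K]_(n, m)) :
  (forall (A : comAlgType K) U, X A U -> Y A (push (extend A P) U) /\
     forall u, U u -> u *m extend A P *m extend A Q = u) ->
  (forall (A : comAlgType K) W, Y A W -> X A (push (extend A Q) W) /\
     forall w, W w -> w *m extend A Q *m extend A P = w) ->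
  isomorphic X Y.
Proof.
move=> XY YX; exists (fun A => push (extend A P)); split=> [A|A B f U _]; last first.
  exact: base_change_push.
split=> [U XU|U V|W YW]; first by case: (XY A U XU).
  rewrite !inE => XU XV eqUV.
  by rewrite -(pushK (XY A U XU).2) eqUV (pushK (XY A V XV).2).
exists (push (extend A Q) W); first by case: (YX A W YW).
exact: pushK (YX A W YW).2.
Qed.

End Isomorphisms.

(** * Polynomial identities tested on an infinite field *)

Section PolynomialIdentities.

Variable K : fieldType.
Hypothesis K_infinite : forall s : seq K, exists x, x \notin s.

(** [A] may have zero divisors, but the difference of two distinct elements of [K] is invertible in
    it, so roots in [K] can be divided out one at a time. The list [s] records the points excluded
    from the start or already used. *)
Lemma horner_eq0 (A : comAlgType K) (P : {poly A}) (s : seq K) :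
  (forall k, k \notin s -> P.[k%:A] = 0) -> P = 0.
Proof.
have [n le_P_n] := ubnP (size P); elim: n => // n IHn in P s le_P_n *.
move=> P0; have [k s'k] := K_infinite s.
have /factor_theorem[Q defP] : root P k%:A by apply/rootP/P0.
have [Q0 | nzQ] := eqVneq Q 0; first by rewrite defP Q0 mul0r.
rewrite defP (IHn Q (k :: s)) ?mul0r // => [|l].
  by rewrite defP size_Mmonic ?monicXsubC // size_XsubC addn2 /= in le_P_n.
rewrite inE negb_or => /andP[l'k s'l].
have := P0 l s'l; rewrite defP hornerM !hornerE -scalerBl.
move/(congr1 (fun x => ((l - k)^-1) *: x)).
by rewrite scaler0 -scalerAr mulr1 scalerA mulVf ?subr_eq0 // scale1r.
Qed.

Lemma mmap_mmap (A : comAlgType K) n k (lq : n.-tuple {mpoly K[k]})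
    (p : {mpoly K[n]}) (v : 'I_k -> A) :
  mmap (in_alg A) v (p \mPo lq)
  = mmap (in_alg A) (fun i => mmap (in_alg A) v (tnth lq i)) p.
Proof.
rewrite comp_mpolyEX [RHS]/mmap !raddf_sum /=; apply: eq_bigr => m _.
rewrite mmapZ comp_mpolyX; congr (_ * _).
by rewrite rmorph_prod; apply: eq_bigr => i _; rewrite rmorphXn.
Qed.

Lemma mmap_in_alg (A : comAlgType K) n (v : 'I_n -> K) (p : {mpoly K[n]}) :
  mmap (in_alg A) (fun i => (v i)%:A) p = p.@[v]%:A.
Proof.
rewrite mevalE /mmap -[RHS]/(in_alg A _) rmorph_sum; apply: eq_bigr => m _ /=.
rewrite -[RHS]/(in_alg A _) rmorphM rmorph_prod; congr (_ * _).
by apply: eq_bigr => i _; rewrite rmorphXn.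
Qed.

Definition update (T : Type) n (v : 'I_n -> T) (i : 'I_n) (x : T) : 'I_n -> T :=
  fun j => if j == i then x else v j.

Lemma mmap_update (A : comAlgType K) n (v : 'I_n -> A) i (p : {mpoly K[n]}) :
  exists P : {poly A}, forall x, mmap (in_alg A) (update v i x) p = P.[x].
Proof.
exists (mmap (polyC \o in_alg A) (update (polyC \o v) i 'X) p) => x.
rewrite /mmap -[RHS]/(horner_eval x _) rmorph_sum; apply: eq_bigr => m _ /=.
rewrite rmorphM rmorph_prod /= /horner_eval hornerC; congr (_ * _).
apply: eq_bigr => j _; rewrite horner_exp /update /=.
by case: ifP; rewrite ?hornerX ?hornerC.
Qed.

(** The coordinates are specialized from [A] to [K] one at a time; [l] lists those still in [A]. The
    excluded hyperplane [w i0 = 0] makes room for parametrizations that are understood only where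
    one parameter is invertible. *)
Lemma mmap_eq0 (A : comAlgType K) n (p : {mpoly K[n]}) (i0 : 'I_n) (v : 'I_n -> A) :
  (forall w : 'I_n -> K, w i0 != 0 -> p.@[w] = 0) -> mmap (in_alg A) v p = 0.
Proof.
move=> p0.
suff gen (l : seq 'I_n) (u : 'I_n -> A) :
    (forall i, i \notin l -> exists2 k : K, u i = k%:A & i = i0 -> k != 0) ->
    mmap (in_alg A) u p = 0.
  by apply: (gen (enum 'I_n)) => i; rewrite mem_enum.
elim: l u => [|i l IHl] u uK.
  have /choice[w wP] i : exists k : K, u i = k%:A /\ (i = i0 -> k != 0).
    by have [//|k uk k0] := uK i; exists k.
  have -> : u = fun i => (w i)%:A by apply: funext => i; case: (wP i).
  by rewrite mmap_in_alg p0 ?scale0r //; case: (wP i0) => _; apply.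
have [P defP] := mmap_update u i p.
have -> : u = update u i (u i).
  by apply: funext => j; rewrite /update; case: eqP => // ->.
rewrite defP (horner_eq0 (P := P) (s := [:: 0])) ?horner0 // => k; rewrite inE => k0.
rewrite -defP; apply: IHl => j l'j; rewrite /update; case: eqP => [_|/eqP nij].
  by exists k.
by apply: uK; rewrite inE negb_or nij.
Qed.

End PolynomialIdentities.

(** * Polynomial functions given over all algebras at once *)

Section PolynomialFunctions.

Variable K : fieldType.

(** One polynomial over [K] computes [F] over every algebra. Formulas in matrices and octonions can
    then be checked over [K] and used over [A] without being written out in [{mpoly K[n]}]. *)
Definition polyfun n (F : forall A : comAlgType K, ('I_n -> A) -> A) : Prop :=
  exists p : {mpoly K[n]}, forall (A : comAlgType K) v, F A v = mmap (in_alg A) v p.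

Section Closure.

Variable n : nat.
Implicit Types F G : forall A : comAlgType K, ('I_n -> A) -> A.

Lemma polyfun_const c : @polyfun n (fun A v => in_alg A c).
Proof. by exists c%:MP => A v; rewrite mmapC. Qed.

Lemma polyfun_coord i : @polyfun n (fun A v => v i).
Proof. by exists 'X_i => A v; rewrite mmapX mmap1U. Qed.

Lemma polyfunD F G : polyfun F -> polyfun G -> polyfun (fun A v => F A v + G A v).
Proof. by move=> [p Fp] [q Gq]; exists (p + q) => A v; rewrite mmapD Fp Gq. Qed.

Lemma polyfunN F : polyfun F -> polyfun (fun A v => - F A v).
Proof. by move=> [p Fp]; exists (- p) => A v; rewrite mmapN Fp. Qed.

Lemma polyfunB F G : polyfun F -> polyfun G -> polyfun (fun A v => F A v - G A v).
Proof. by move=> pF pG; apply: polyfunD => //; apply: polyfunN. Qed.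

Lemma polyfunM F G : polyfun F -> polyfun G -> polyfun (fun A v => F A v * G A v).
Proof. by move=> [p Fp] [q Gq]; exists (p * q) => A v; rewrite rmorphM Fp Gq. Qed.

Lemma polyfun0 : @polyfun n (fun A v => 0).
Proof. by exists 0 => A v; rewrite mmap0. Qed.

Lemma polyfunX F k : polyfun F -> polyfun (fun A v => F A v ^+ k).
Proof. by move=> [p Fp]; exists (p ^+ k) => A v; rewrite rmorphXn Fp. Qed.

Lemma polyfun_sum (I : Type) (r : seq I) (F : I -> forall A : comAlgType K, ('I_n -> A) -> A) :
  (forall i, polyfun (F i)) -> polyfun (fun A v => \sum_(i <- r) F i A v).
Proof.
move=> pF; elim: r => [|i r [p IHp]].
  by exists 0 => A v; rewrite big_nil mmap0.
by have [q Fq] := pF i; exists (q + p) => A v; rewrite big_cons mmapD Fq IHp.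
Qed.

Lemma polyfun_comp m (p : {mpoly K[m]})
    (F : 'I_m -> forall A : comAlgType K, ('I_n -> A) -> A) :
  (forall i, polyfun (F i)) ->
  polyfun (fun A v => mmap (in_alg A) (fun i => F i A v) p).
Proof.
move=> /choice[q Fq]; exists (p \mPo [tuple q i | i < m]) => A v.
rewrite mmap_mmap; congr (mmap _ _ p); apply: funext => i.
by rewrite tnth_mktuple Fq.
Qed.

Lemma mmap_regular (v : 'I_n -> K) (p : {mpoly K[n]}) :
  mmap (in_alg K^o) v p = p.@[v].
Proof.
have := mmap_in_alg K^o v p; rewrite /GRing.scale /= mulr1 => <-.
by congr (mmap _ _ p); apply: funext => i; rewrite mulr1.
Qed.

Definition polymx k l (M : forall A : comAlgType K, ('I_n -> A) -> 'M[A]_(k, l)) : Prop :=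
  forall i j, polyfun (fun A v => M A v i j).

Lemma polymx_const k l (M : 'M[K]_(k, l)) : polymx (fun A _ => extend A M).
Proof.
move=> i j; have [p Fp] := polyfun_const (M i j); exists p => A v.
by rewrite mxE; apply: Fp.
Qed.

Lemma polymxM k l m (M : forall A : comAlgType K, ('I_n -> A) -> 'M[A]_(k, l))
    (N : forall A : comAlgType K, ('I_n -> A) -> 'M[A]_(l, m)) :
  polymx M -> polymx N -> polymx (fun A v => M A v *m N A v).
Proof.
move=> pM pN i j.
have [p Fp] : polyfun (fun A v => \sum_h M A v i h * N A v h j).
  by apply: polyfun_sum => h; apply: polyfunM.
by exists p => A v; rewrite mxE Fp.
Qed.

Lemma polymxB k l (M N : forall A : comAlgType K, ('I_n -> A) -> 'M[A]_(k, l)) :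
  polymx M -> polymx N -> polymx (fun A v => M A v - N A v).
Proof.
by move=> pM pN i j; have [p Fp] := polyfunB (pM i j) (pN i j); exists p => A v; rewrite !mxE Fp.
Qed.

Lemma polymx_tr k l (M : forall A : comAlgType K, ('I_n -> A) -> 'M[A]_(k, l)) :
  polymx M -> polymx (fun A v => (M A v)^T).
Proof. by move=> pM i j; have [p Fp] := pM j i; exists p => A v; rewrite mxE. Qed.

Lemma polymx_mxvec k l (M : forall A : comAlgType K, ('I_n -> A) -> 'M[A]_(k, l)) :
  polymx M -> polymx (fun A v => mxvec (M A v)).
Proof.
move=> pM i j; case/mxvec_indexP: j => h m; have [p Fp] := pM h m.
by exists p => A v; rewrite ord1 mxvecE.
Qed.

Lemma polymx_vec_mx k l (M : forall A : comAlgType K, ('I_n -> A) -> 'rV[A]_(k * l)) :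
  polymx M -> polymx (fun A v => vec_mx (M A v)).
Proof.
by move=> pM i j; have [p Fp] := pM 0 (mxvec_index i j); exists p => A v; rewrite mxE.
Qed.

Lemma polymx_rowval : polymx (fun A (v : 'I_n -> A) => \row_i v i).
Proof. by move=> i j; have [p Fp] := polyfun_coord j; exists p => A v; rewrite mxE. Qed.

End Closure.

Lemma vanishing_polyfun n (C : set 'rV[K]_n)
    (F : forall A : comAlgType K, ('I_n -> A) -> A) :
  polyfun F -> (forall w, C w -> F K^o (w 0) = 0) ->
  exists2 p, vanishing_ideal C p & forall A v, F A v = mmap (in_alg A) v p.
Proof.
move=> [p Fp] C0; exists p => // w Cw.
by rewrite -mmap_regular -Fp C0.
Qed.

Hypothesis K_infinite : forall s : seq K, exists x, x \notin s.

Lemma polyfun_eq0 n (F : forall A : comAlgType K, ('I_n -> A) -> A) (i0 : 'I_n) :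
  polyfun F -> (forall v : 'I_n -> K, v i0 != 0 -> F K^o v = 0) ->
  forall (A : comAlgType K) (v : 'I_n -> A), F A v = 0.
Proof.
move=> [p Fp] F0 A v; rewrite Fp; apply: (mmap_eq0 K_infinite (i0 := i0)) => w w0.
by rewrite -mmap_regular -Fp F0.
Qed.

Lemma mmap_scale (A : comAlgType K) n (v : 'I_n -> A) (p : {mpoly K[n]}) :
  exists P : {poly A}, forall t, mmap (in_alg A) (fun i => t * v i) p = P.[t].
Proof.
exists (mmap (polyC \o in_alg A) (fun i => 'X * (v i)%:P) p) => t.
rewrite /mmap -[RHS]/(horner_eval t _) rmorph_sum; apply: eq_bigr => m _ /=.
rewrite rmorphM rmorph_prod /= /horner_eval hornerC; congr (_ * _).
by apply: eq_bigr => j _; rewrite horner_exp hornerM hornerX hornerC.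
Qed.

End PolynomialFunctions.

(** * Octonions and their automorphisms *)

Section Coordinates.

Variable A : comNzRingType.

(** Indexing by natural numbers makes equal entries syntactically equal terms, which [ring]
    recognizes as one atom; ordinals would carry different proofs of their bounds. *)
Definition co n (x : 'rV[A]_n.+1) (k : nat) : A := x 0 (inord k).

Definition mc m n (M : 'M[A]_(m.+1, n.+1)) (i j : nat) : A := M (inord i) (inord j).

Definition row_of n (l : seq A) : 'rV[A]_n := \row_i nth 0 l i.

Definition mx_of m n (l : seq (seq A)) : 'M[A]_(m, n) :=
  \matrix_(i, j) nth 0 (nth [::] l i) j.

Lemma co_row_of n l k : (k < n.+1)%N -> co (row_of n.+1 l) k = nth 0 l k.
Proof. by move=> ltkn; rewrite /co mxE inordK. Qed.

Lemma mc_mx_of m n l i j : (i < m.+1)%N -> (j < n.+1)%N ->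
  mc (mx_of m.+1 n.+1 l) i j = nth 0 (nth [::] l i) j.
Proof. by move=> ltim ltjn; rewrite /mc mxE !inordK. Qed.

Lemma coE n (x : 'rV[A]_n.+1) i : x 0 i = co x i.
Proof. by rewrite /co inord_val. Qed.

Lemma mcE m n (M : 'M[A]_(m.+1, n.+1)) i j : M i j = mc M i j.
Proof. by rewrite /mc !inord_val. Qed.

Lemma co_ext n (x y : 'rV[A]_n.+1) :
  (forall k, (k < n.+1)%N -> co x k = co y k) -> x = y.
Proof. by move=> exy; apply/rowP => i; rewrite !coE exy. Qed.

Lemma mc_ext m n (M N : 'M[A]_(m.+1, n.+1)) :
  (forall i, (i < m.+1)%N -> forall j, (j < n.+1)%N -> mc M i j = mc N i j) -> M = N.
Proof. by move=> eMN; apply/matrixP => i j; rewrite !mcE eMN. Qed.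

Lemma coD n (x y : 'rV[A]_n.+1) k : co (x + y) k = co x k + co y k.
Proof. by rewrite /co mxE. Qed.

Lemma coN n (x : 'rV[A]_n.+1) k : co (- x) k = - co x k.
Proof. by rewrite /co mxE. Qed.

Lemma coZ n a (x : 'rV[A]_n.+1) k : co (a *: x) k = a * co x k.
Proof. by rewrite /co mxE. Qed.

Lemma co0 n k : co (0 : 'rV[A]_n.+1) k = 0.
Proof. by rewrite /co mxE. Qed.

Lemma co_row m n (M : 'M[A]_(m.+1, n.+1)) i k : co (row (inord i) M) k = mc M i k.
Proof. by rewrite /co mxE. Qed.

Lemma co_mul m n (x : 'rV[A]_m.+1) (M : 'M[A]_(m.+1, n.+1)) k :
  co (x *m M) k = \sum_(i < m.+1) co x i * mc M i k.
Proof.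
rewrite /co mxE; apply: eq_bigr => i _.
by rewrite /mc !inord_val.
Qed.

Lemma mc_mul m n p (M : 'M[A]_(m.+1, n.+1)) (N : 'M[A]_(n.+1, p.+1)) i k :
  mc (M *m N) i k = \sum_(j < n.+1) mc M i j * mc N j k.
Proof.
by rewrite /mc mxE; apply: eq_bigr => j _; rewrite inord_val.
Qed.

Lemma mc_tr m n (M : 'M[A]_(m.+1, n.+1)) i j : mc M^T i j = mc M j i.
Proof. by rewrite /mc mxE. Qed.

Lemma mcD m n (M N : 'M[A]_(m.+1, n.+1)) i j : mc (M + N) i j = mc M i j + mc N i j.
Proof. by rewrite /mc mxE. Qed.

Lemma mcN m n (M : 'M[A]_(m.+1, n.+1)) i j : mc (- M) i j = - mc M i j.
Proof. by rewrite /mc mxE. Qed.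

Lemma mcZ m n a (M : 'M[A]_(m.+1, n.+1)) i j : mc (a *: M) i j = a * mc M i j.
Proof. by rewrite /mc mxE. Qed.

Lemma sum8 (F : nat -> A) : \sum_(i < 8) F i =
  F 0%N + (F 1%N + (F 2%N + (F 3%N + (F 4%N + (F 5%N + (F 6%N + F 7%N)))))).
Proof. by rewrite !big_ord_recl big_ord0 addr0. Qed.

Lemma sum10 (F : nat -> A) : \sum_(i < 10) F i = F 0%N + (F 1%N + (F 2%N +
  (F 3%N + (F 4%N + (F 5%N + (F 6%N + (F 7%N + (F 8%N + F 9%N)))))))).
Proof. by rewrite !big_ord_recl big_ord0 addr0. Qed.

Lemma co_mul8 n (x : 'rV[A]_8) (M : 'M[A]_(8, n.+1)) k : co (x *m M) k =
  co x 0 * mc M 0 k + (co x 1 * mc M 1 k + (co x 2 * mc M 2 k +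
  (co x 3 * mc M 3 k + (co x 4 * mc M 4 k + (co x 5 * mc M 5 k +
  (co x 6 * mc M 6 k + co x 7 * mc M 7 k)))))).
Proof. by rewrite co_mul (sum8 (fun i => co x i * mc M i k)). Qed.

Lemma co_mul10 n (x : 'rV[A]_10) (M : 'M[A]_(10, n.+1)) k : co (x *m M) k =
  co x 0 * mc M 0 k + (co x 1 * mc M 1 k + (co x 2 * mc M 2 k +
  (co x 3 * mc M 3 k + (co x 4 * mc M 4 k + (co x 5 * mc M 5 k +
  (co x 6 * mc M 6 k + (co x 7 * mc M 7 k + (co x 8 * mc M 8 k +
   co x 9 * mc M 9 k)))))))).
Proof. by rewrite co_mul (sum10 (fun i => co x i * mc M i k)). Qed.

Lemma mc_mul8 m n (M : 'M[A]_(m.+1, 8)) (N : 'M[A]_(8, n.+1)) i k :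
  mc (M *m N) i k =
  mc M i 0 * mc N 0 k + (mc M i 1 * mc N 1 k + (mc M i 2 * mc N 2 k +
  (mc M i 3 * mc N 3 k + (mc M i 4 * mc N 4 k + (mc M i 5 * mc N 5 k +
  (mc M i 6 * mc N 6 k + mc M i 7 * mc N 7 k)))))).
Proof. by rewrite mc_mul (sum8 (fun j => mc M i j * mc N j k)). Qed.

Lemma forall_lt8 (P : nat -> Prop) :
  P 0%N -> P 1%N -> P 2%N -> P 3%N -> P 4%N -> P 5%N -> P 6%N -> P 7%N ->
  forall k, (k < 8)%N -> P k.
Proof. by do 8![move=> ?]; do 8![case=> //]. Qed.

Lemma row8_ind (P : 'rV[A]_8 -> Prop) :
  (forall x0 x1 x2 x3 x4 x5 x6 x7, P (row_of 8 [:: x0; x1; x2; x3; x4; x5; x6; x7])) ->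
  forall x, P x.
Proof.
move=> Prow x; suff -> : x = row_of 8 [:: co x 0; co x 1; co x 2; co x 3;
  co x 4; co x 5; co x 6; co x 7] by exact: Prow.
by apply: co_ext; apply: forall_lt8; rewrite co_row_of.
Qed.

Lemma row8D x0 x1 x2 x3 x4 x5 x6 x7 y0 y1 y2 y3 y4 y5 y6 y7 : row_of 8 [:: x0; x1; x2; x3; x4; x5; x6; x7] + row_of 8 [:: y0; y1; y2; y3; y4; y5; y6; y7] =
  row_of 8 [:: x0 + y0; x1 + y1; x2 + y2; x3 + y3; x4 + y4; x5 + y5; x6 + y6; x7 + y7].
Proof. by apply: co_ext; apply: forall_lt8; rewrite coD !co_row_of. Qed.

Lemma row8N x0 x1 x2 x3 x4 x5 x6 x7 : - row_of 8 [:: x0; x1; x2; x3; x4; x5; x6; x7] = row_of 8 [:: - x0; - x1; - x2; - x3; - x4; - x5; - x6; - x7].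
Proof. by apply: co_ext; apply: forall_lt8; rewrite coN !co_row_of. Qed.

Lemma row8Z a x0 x1 x2 x3 x4 x5 x6 x7 : a *: row_of 8 [:: x0; x1; x2; x3; x4; x5; x6; x7] = row_of 8 [:: a * x0; a * x1; a * x2; a * x3; a * x4; a * x5; a * x6; a * x7].
Proof. by apply: co_ext; apply: forall_lt8; rewrite coZ !co_row_of. Qed.

Lemma mul_row8 x0 x1 x2 x3 x4 x5 x6 x7 (l : seq (seq A)) : row_of 8 [:: x0; x1; x2; x3; x4; x5; x6; x7] *m mx_of 8 8 l =
  let M i j := nth 0 (nth [::] l i) j in
  row_of 8 (mkseq (fun k => x0 * M 0%N k + (x1 * M 1%N k + (x2 * M 2%N k + (x3 * M 3%N k + (x4 * M 4%N k + (x5 * M 5%N k + (x6 * M 6%N k + (x7 * M 7%N k)))))))) 8).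
Proof.
by apply: co_ext; apply: forall_lt8; rewrite co_mul8 !mc_mx_of // !co_row_of.
Qed.

(* The product of Zorn's vector matrices, in the coordinates
   (a, u_1, u_2, u_3, v_1, v_2, v_3, b). *)
Definition omul_coords (x y : nat -> A) : seq A :=
    [:: x 0%N * y 0%N + (x 1%N * y 4%N + x 2%N * y 5%N + x 3%N * y 6%N);
        x 0%N * y 1%N + y 7%N * x 1%N - (x 5%N * y 6%N - x 6%N * y 5%N);
        x 0%N * y 2%N + y 7%N * x 2%N - (x 6%N * y 4%N - x 4%N * y 6%N);
        x 0%N * y 3%N + y 7%N * x 3%N - (x 4%N * y 5%N - x 5%N * y 4%N);
        y 0%N * x 4%N + x 7%N * y 4%N + (x 2%N * y 3%N - x 3%N * y 2%N);
        y 0%N * x 5%N + x 7%N * y 5%N + (x 3%N * y 1%N - x 1%N * y 3%N);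
        y 0%N * x 6%N + x 7%N * y 6%N + (x 1%N * y 2%N - x 2%N * y 1%N);
        x 7%N * y 7%N + (x 4%N * y 1%N + x 5%N * y 2%N + x 6%N * y 3%N)].

Definition omul (x y : 'rV[A]_8) : 'rV[A]_8 := row_of 8 (omul_coords (co x) (co y)).

Lemma omul_row8 x0 x1 x2 x3 x4 x5 x6 x7 y0 y1 y2 y3 y4 y5 y6 y7 : omul (row_of 8 [:: x0; x1; x2; x3; x4; x5; x6; x7]) (row_of 8 [:: y0; y1; y2; y3; y4; y5; y6; y7]) =
  row_of 8 (omul_coords (nth 0 [:: x0; x1; x2; x3; x4; x5; x6; x7]) (nth 0 [:: y0; y1; y2; y3; y4; y5; y6; y7])).
Proof. by rewrite /omul /omul_coords !co_row_of. Qed.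

Definition otrace (x : 'rV[A]_8) : A := co x 0 + co x 7.

(* The Gram matrix of the polarization of the norm a b - u . v; it is its own
   inverse. *)
Definition gram : 'M[A]_8 := mx_of 8 8
  [:: [:: 0; 0; 0; 0; 0; 0; 0; 1];
      [:: 0; 0; 0; 0; -1; 0; 0; 0];
      [:: 0; 0; 0; 0; 0; -1; 0; 0];
      [:: 0; 0; 0; 0; 0; 0; -1; 0];
      [:: 0; -1; 0; 0; 0; 0; 0; 0];
      [:: 0; 0; -1; 0; 0; 0; 0; 0];
      [:: 0; 0; 0; -1; 0; 0; 0; 0];
      [:: 1; 0; 0; 0; 0; 0; 0; 0]].

Lemma mulmx_id n (M : 'M[A]_n) : (forall x : 'rV_n, x *m M = x) -> M = 1%:M.
Proof. by move=> idM; apply/row_matrixP => i; rewrite rowE idM row1. Qed.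

Lemma mul_gram x0 x1 x2 x3 x4 x5 x6 x7 : row_of 8 [:: x0; x1; x2; x3; x4; x5; x6; x7] *m gram =
  row_of 8 [:: x7; - x4; - x5; - x6; - x1; - x2; - x3; x0].
Proof. by rewrite mul_row8 /mkseq /=; congr (row_of 8 [:: _; _; _; _; _; _; _; _]); ring. Qed.

Lemma gramK : gram *m gram = 1%:M.
Proof.
by apply: mulmx_id; elim/row8_ind => *; rewrite mulmxA !mul_gram !opprK.
Qed.

End Coordinates.

Lemma co_val (A : comNzRingType) n (x : 'rV[A]_n.+1) (i : 'I_n.+1) k :
  val i = k -> x 0 i = co x k.
Proof. by move=> <-; rewrite coE. Qed.

Lemma zornE (K : fieldType) (a : 'M[K]_1) (u v : 'rV[K]_3) (b : 'M[K]_1) :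
  zorn a u v b = row_of 8 [:: co a 0; co u 0; co u 1; co u 2;
                              co v 0; co v 1; co v 2; co b 0].
Proof.
apply/rowP => i; rewrite [RHS]mxE /zorn.
have [j ->|j ->] := split_ordP (i : 'I_(4 + 4)).
  apply: (etrans (row_mxEl _ _ _ _)); have [k ->|k ->] := split_ordP (j : 'I_(1 + 3)).
    by apply: (etrans (row_mxEl _ _ _ _)); rewrite ord1 coE.
  by apply: (etrans (row_mxEr _ _ _ _)); rewrite coE; case: k => -[|[|[|]]].
apply: (etrans (row_mxEr _ _ _ _)); have [k ->|k ->] := split_ordP (j : 'I_(3 + 1)).
  by apply: (etrans (row_mxEl _ _ _ _)); rewrite coE; case: k => -[|[|[|]]].
by apply: (etrans (row_mxEr _ _ _ _)); rewrite ord1 coE.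
Qed.

Lemma sum3 (A : comNzRingType) (F : nat -> A) :
  \sum_(i < 3) F i = F 0%N + (F 1%N + F 2%N).
Proof. by rewrite !big_ord_recl big_ord0 addr0. Qed.

Lemma octmulE (K : fieldType) (x y : 'rV[K]_8) : octmul x y = omul x y.
Proof.
rewrite /octmul zornE /omul /omul_coords; congr (row_of 8 _).
pose lu (x : 'rV[K]_(4 + 4)) : 'rV[K]_(1 + 3) := lsubmx x.
pose rd (x : 'rV[K]_(4 + 4)) : 'rV[K]_(3 + 1) := rsubmx x.
have Ea (z : 'rV[K]_8) : co (lsubmx (lu z)) 0 = co z 0.
  by rewrite /co !mxE; apply: co_val; rewrite /= inordK.
have Eb (z : 'rV[K]_8) : co (rsubmx (rd z)) 0 = co z 7.
  by rewrite /co !mxE; apply: co_val; rewrite /= inordK.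
have Eu (z : 'rV[K]_8) k : (k < 3)%N -> co (rsubmx (lu z)) k = co z k.+1.
  by move=> ltk; rewrite /co !mxE; apply: co_val; rewrite /= inordK.
have Ev (z : 'rV[K]_8) k : (k < 3)%N -> co (lsubmx (rd z)) k = co z (4 + k).
  by move=> ltk; rewrite /co !mxE; apply: co_val; rewrite /= inordK.
have Em (c : 'M[K]_1) (z : 'rV[K]_3) k : co (c *m z) k = co c 0 * co z k.
  by rewrite /co mxE big_ord1 [inord 0]ord1.
have Ed (z z' : 'rV[K]_3) : co (z *m z'^T) 0 =
    co z 0 * co z' 0 + (co z 1 * co z' 1 + co z 2 * co z' 2).
  rewrite -(sum3 (fun i => co z i * co z' i)) {1}/co mxE.
  by apply: eq_bigr => i _; rewrite mxE [inord 0]ord1 !coE.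
have E1 (c c' : 'M[K]_1) : co (c *m c') 0 = co c 0 * co c' 0.
  by rewrite /co mxE big_ord1 [inord 0]ord1.
have Ec (z z' : 'rV[K]_3) : [/\ co (crossmx z z') 0 = co z 1 * co z' 2 - co z 2 * co z' 1,
    co (crossmx z z') 1 = co z 2 * co z' 0 - co z 0 * co z' 2 &
    co (crossmx z z') 2 = co z 0 * co z' 1 - co z 1 * co z' 0].
  by split; rewrite {1}/co !mxE !coE /= !inordK.
rewrite -!/(lu _) -!/(rd _).
rewrite !(coD, coN) !E1 !Ed !Em.
have [-> -> ->] := Ec (lsubmx (rd x)) (lsubmx (rd y)).
have [-> -> ->] := Ec (rsubmx (lu x)) (rsubmx (lu y)).
by rewrite !Ea !Eb !Eu ?Ev //= -!addrA.
Qed.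

Ltac row8 x := elim/row8_ind: x => ? ? ? ? ? ? ? ?.

Ltac row8_ring := congr (row_of 8 [:: _; _; _; _; _; _; _; _]); ring.

Section OctonionAlgebra.

Variable A : comNzRingType.
Implicit Types x y z : 'rV[A]_8.

Ltac coords := rewrite ?(row8D, row8N, row8Z, omul_row8) /omul_coords /=
  ?(row8D, row8N, row8Z, omul_row8) /omul_coords /=; row8_ring.

Lemma omulDl x y z : omul (x + y) z = omul x z + omul y z. Proof. row8 x; row8 y; row8 z; coords. Qed.

Lemma omulZl a x y : omul (a *: x) y = a *: omul x y. Proof. row8 x; row8 y; coords. Qed.

Lemma omulDr x y z : omul z (x + y) = omul z x + omul z y. Proof. row8 x; row8 y; row8 z; coords. Qed.

Lemma omulZr a x y : omul x (a *: y) = a *: omul x y. Proof. row8 x; row8 y; coords. Qed.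

Lemma omul0l y : omul 0 y = 0.
Proof. by have := omulZl 0 0 y; rewrite !scale0r. Qed.

Lemma omul0r y : omul y 0 = 0.
Proof. by have := omulZr 0 y 0; rewrite !scale0r. Qed.

Lemma omul_suml (I : Type) (r : seq I) (F : I -> 'rV[A]_8) y :
  omul (\sum_(i <- r) F i) y = \sum_(i <- r) omul (F i) y.
Proof.
by apply: (big_morph (fun x => omul x y)) => [x z|]; rewrite ?omulDl ?omul0l.
Qed.

Lemma omul_sumr (I : Type) (r : seq I) (F : I -> 'rV[A]_8) y :
  omul y (\sum_(i <- r) F i) = \sum_(i <- r) omul y (F i).
Proof.
by apply: (big_morph (fun x => omul y x)) => [x z|]; rewrite ?omulDr ?omul0r.
Qed.

Definition one : 'rV[A]_8 := row_of 8 [:: 1; 0; 0; 0; 0; 0; 0; 1].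

Definition onorm x : A := co x 0 * co x 7 -
  (co x 1 * co x 4 + co x 2 * co x 5 + co x 3 * co x 6).

Lemma omul1l x : omul one x = x. Proof. row8 x; rewrite /one; coords. Qed.

Lemma omul1r x : omul x one = x. Proof. row8 x; rewrite /one; coords. Qed.

Lemma omul_square x : omul x x = otrace x *: x - onorm x *: one.
Proof. by row8 x; rewrite /otrace /onorm /one !co_row_of //=; coords. Qed.

End OctonionAlgebra.

Lemma map_omul (A B : comNzRingType) (f : {rmorphism A -> B}) (x y : 'rV[A]_8) :
  map_mx f (omul x y) = omul (map_mx f x) (map_mx f y).
Proof.
have comap z k : co (map_mx f z) k = f (co z k) by rewrite /co mxE.
apply: co_ext; apply: forall_lt8;
  by rewrite comap !co_row_of //= !comap !(rmorphD, rmorphN, rmorphM).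
Qed.

Section Automorphisms.

Variable K : fieldType.

Lemma G2P (g : 'M[K]_8) : G2 g <->
  g \in unitmx /\ forall x y, omul (x *m g) (y *m g) = omul x y *m g.
Proof. by split=> -[ug mg]; split=> // x y; have := mg x y; rewrite !octmulE. Qed.

Lemma G2_intro (g g' : 'M[K]_8) : g *m g' = 1%:M ->
  (forall x y, omul (x *m g) (y *m g) = omul x y *m g) -> G2 g.
Proof. by move=> gg' mg; apply/G2P; split=> //; case: (mulmx1_unit gg'). Qed.

Lemma G2_unit (g : 'M[K]_8) : G2 g -> g \in unitmx. Proof. by case. Qed.

Lemma G2_omul (g : 'M[K]_8) x y : G2 g -> omul (x *m g) (y *m g) = omul x y *m g.
Proof. by case/G2P=> _; apply. Qed.

Lemma G2_mul (g h : 'M[K]_8) : G2 g -> G2 h -> G2 (g *m h).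
Proof.
move=> Gg Gh; apply/G2P; split; first by rewrite unitmx_mul !G2_unit.
by move=> x y; rewrite !mulmxA !G2_omul.
Qed.

Lemma G2_inv (g : 'M[K]_8) : G2 g -> G2 (invmx g).
Proof.
move=> Gg; apply/G2P; split=> [|x y]; first by rewrite unitmx_inv G2_unit.
apply: (can_inj (mulmxK (G2_unit Gg))).
by rewrite -(G2_omul _ _ Gg) !mulmxKV ?G2_unit.
Qed.

Lemma G2_1 : G2 (1%:M : 'M[K]_8).
Proof. by apply/G2P; split=> [|x y]; rewrite ?unitmx1 ?mulmx1. Qed.

Lemma G2_one (g : 'M[K]_8) : G2 g -> one K *m g = one K.
Proof.
move=> Gg; rewrite -[LHS]omul1r -{2}[one K](mulmxKV (G2_unit Gg)).
by rewrite G2_omul // omul1l mulmxKV // G2_unit.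
Qed.

(** Trace and norm are read off the quadratic equation of [x]. Comparing the equation of [x *m g]
    with the image of that of [x] makes a multiple of [x *m g] scalar. If the traces differed,
    [x *m g] would be a multiple of [one], hence fixed by [g], so equal to [x], with the same
    trace. *)
Lemma G2_norm (g : 'M[K]_8) x : G2 g ->
  otrace (x *m g) = otrace x /\ onorm (x *m g) = onorm x.
Proof.
move=> Gg; have := G2_omul x x Gg.
rewrite !omul_square mulmxBl -!scalemxAl G2_one // => E.
have one_neq0 : one K != 0.
  by apply/eqP => /(congr1 (fun z => co z 0)); rewrite co_row_of //= co0 => /eqP; rewrite oner_eq0.
have {}E : (otrace (x *m g) - otrace x) *: (x *m g) = (onorm (x *m g) - onorm x) *: one K.
  rewrite [LHS]scalerBl [RHS]scalerBl; apply/eqP; rewrite subr_eq; apply/eqP.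
  by rewrite -[LHS](subrK (onorm (x *m g) *: one K)) E -addrA addrC [- _ + _]addrC.
have tr : otrace (x *m g) = otrace x.
  apply/eqP/negPn/negP; rewrite -subr_eq0 => nz.
  have {}E : x *m g = ((otrace (x *m g) - otrace x)^-1 * (onorm (x *m g) - onorm x)) *: one K.
    by rewrite -scalerA -E scalerA mulVf // scale1r.
  have Ex : x = x *m g.
    by apply: (can_inj (mulmxK (G2_unit Gg))); rewrite {2}E -scalemxAl G2_one.
  by rewrite -Ex subrr eqxx in nz.
split=> //; apply/eqP; rewrite -subr_eq0; move/eqP: E; rewrite tr subrr scale0r eq_sym.
by rewrite scaler_eq0 (negPf one_neq0) orbF.
Qed.

Lemma gram_onorm (x y : 'rV[K]_8) :
  x *m gram K *m y^T = (onorm (x + y) - onorm x - onorm y)%:M.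
Proof.
apply/matrixP => i j; rewrite !ord1 [RHS]mxE /= mulr1n mxE.
under eq_bigr => k _ do rewrite coE mxE coE.
rewrite (sum8 (fun k => co (x *m gram K) k * co y k)).
elim/row8_ind: x => *; elim/row8_ind: y => *.
by rewrite mul_gram /onorm row8D !co_row_of //=; ring.
Qed.

Lemma G2_gram (g : 'M[K]_8) : G2 g -> g *m gram K *m g^T = gram K.
Proof.
move=> Gg; have eqB (x y : 'rV[K]_8) :
    x *m (g *m gram K *m g^T) *m y^T = x *m gram K *m y^T.
  rewrite gram_onorm -mulmxA -[(_ *m y^T)]mulmxA -trmx_mul !mulmxA.
  rewrite -[_ *m (y *m g)^T]/((x *m g) *m gram K *m (y *m g)^T) gram_onorm.
  by rewrite -mulmxDl !(G2_norm _ Gg).2.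
apply/matrixP => i j.
have := eqB (delta_mx 0 i) (delta_mx 0 j).
by rewrite !trmx_delta -!rowE -!colE => /matrixP/(_ 0 0); rewrite !mxE.
Qed.

End Automorphisms.

Section ExtendedAutomorphisms.

Variables (K : fieldType) (A : comAlgType K) (g : 'M[K]_8).
Hypothesis Gg : G2 g.

Lemma extend_delta (i : 'I_8) :
  (delta_mx 0 i : 'rV[A]_8) *m extend A g = map_mx (in_alg A) (delta_mx 0 i *m g).
Proof. by rewrite map_mxM map_delta_mx. Qed.

Lemma extend_omul (x y : 'rV[A]_8) :
  omul (x *m extend A g) (y *m extend A g) = omul x y *m extend A g.
Proof.
rewrite [x]row_sum_delta [y]row_sum_delta !mulmx_suml !omul_suml mulmx_suml.
apply: eq_bigr => i _; rewrite !omul_sumr mulmx_suml; apply: eq_bigr => j _.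
rewrite -!scalemxAl !omulZl !omulZr -!scalemxAl; congr (_ *: (_ *: _)).
rewrite !extend_delta -map_omul (G2_omul _ _ Gg).
by rewrite -!(map_delta_mx (in_alg A)) -map_omul -map_mxM.
Qed.

Lemma extend_otrace (x : 'rV[A]_8) : otrace (x *m extend A g) = otrace x.
Proof.
have traceD (y z : 'rV[A]_8) : otrace (y + z) = otrace y + otrace z.
  by rewrite /otrace !coD; ring.
have trace0 : otrace (0 : 'rV[A]_8) = 0 by rewrite /otrace !co0 addr0.
rewrite [x]row_sum_delta mulmx_suml !(big_morph _ traceD trace0).
apply: eq_bigr => i _; rewrite -scalemxAl /otrace !coZ -!mulrDr; congr (_ * _).
rewrite extend_delta -(map_delta_mx (in_alg A)).
have map_otrace (y : 'rV[K]_8) :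
    otrace (map_mx (in_alg A) y) = in_alg A (otrace y).
  by rewrite /otrace /co !mxE rmorphD.
by rewrite -!/(otrace _) !map_otrace (G2_norm _ Gg).1.
Qed.

End ExtendedAutomorphisms.

(** * Explicit automorphisms of the octonions *)

Section Generators.

Variable A : comNzRingType.

(** The exponential [1 + D + D^2 / 2] of the nilpotent derivation [D] that sends (a, u, v, b) to
    (c.v, - (a - b) c, - c x u, - c.v). It lies in the sum of three short root spaces; [D^2 / 2] is
    u -> - (c.v) c, so no denominator is left. *)
Definition g2_short (c1 c2 c3 : A) : 'M[A]_8 := mx_of 8 8
  [:: [:: 1; - c1; - c2; - c3; 0; 0; 0; 0];
      [:: 0; 1; 0; 0; 0; - c3; c2; 0];
      [:: 0; 0; 1; 0; c3; 0; - c1; 0];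
      [:: 0; 0; 0; 1; - c2; c1; 0; 0];
      [:: c1; - (c1 * c1); - (c1 * c2); - (c1 * c3); 1; 0; 0; - c1];
      [:: c2; - (c2 * c1); - (c2 * c2); - (c2 * c3); 0; 1; 0; - c2];
      [:: c3; - (c3 * c1); - (c3 * c2); - (c3 * c3); 0; 0; 1; - c3];
      [:: 0; c1; c2; c3; 0; 0; 0; 1]].

Definition g2_swap : 'M[A]_8 := mx_of 8 8
  [:: [:: 0; 0; 0; 0; 0; 0; 0; 1];
      [:: 0; 0; 0; 0; -1; 0; 0; 0];
      [:: 0; 0; 0; 0; 0; -1; 0; 0];
      [:: 0; 0; 0; 0; 0; 0; -1; 0];
      [:: 0; -1; 0; 0; 0; 0; 0; 0];
      [:: 0; 0; -1; 0; 0; 0; 0; 0];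
      [:: 0; 0; 0; -1; 0; 0; 0; 0];
      [:: 1; 0; 0; 0; 0; 0; 0; 0]].

(* The remaining generators come from SL3, acting on u by h and on v by the
   inverse transpose of h. *)
Definition g2_unipotent (p q r : A) : 'M[A]_8 := mx_of 8 8
  [:: [:: 1; 0; 0; 0; 0; 0; 0; 0];
      [:: 0; 1; p; q; 0; 0; 0; 0];
      [:: 0; 0; 1; 0; 0; 0; 0; 0];
      [:: 0; 0; r; 1; 0; 0; 0; 0];
      [:: 0; 0; 0; 0; 1; 0; 0; 0];
      [:: 0; 0; 0; 0; q * r - p; 1; - r; 0];
      [:: 0; 0; 0; 0; - q; 0; 1; 0];
      [:: 0; 0; 0; 0; 0; 0; 0; 1]].

Definition g2_cycle : 'M[A]_8 := mx_of 8 8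
  [:: [:: 1; 0; 0; 0; 0; 0; 0; 0];
      [:: 0; 0; 1; 0; 0; 0; 0; 0];
      [:: 0; 0; 0; 1; 0; 0; 0; 0];
      [:: 0; 1; 0; 0; 0; 0; 0; 0];
      [:: 0; 0; 0; 0; 0; 1; 0; 0];
      [:: 0; 0; 0; 0; 0; 0; 1; 0];
      [:: 0; 0; 0; 0; 1; 0; 0; 0];
      [:: 0; 0; 0; 0; 0; 0; 0; 1]].

Definition g2_flip : 'M[A]_8 := mx_of 8 8
  [:: [:: 1; 0; 0; 0; 0; 0; 0; 0];
      [:: 0; 0; -1; 0; 0; 0; 0; 0];
      [:: 0; -1; 0; 0; 0; 0; 0; 0];
      [:: 0; 0; 0; -1; 0; 0; 0; 0];
      [:: 0; 0; 0; 0; 0; -1; 0; 0];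
      [:: 0; 0; 0; 0; -1; 0; 0; 0];
      [:: 0; 0; 0; 0; 0; 0; -1; 0];
      [:: 0; 0; 0; 0; 0; 0; 0; 1]].

Definition g2_torus (t s : A) : 'M[A]_8 := mx_of 8 8
  [:: [:: 1; 0; 0; 0; 0; 0; 0; 0];
      [:: 0; s; 0; 0; 0; 0; 0; 0];
      [:: 0; 0; t; 0; 0; 0; 0; 0];
      [:: 0; 0; 0; 1; 0; 0; 0; 0];
      [:: 0; 0; 0; 0; t; 0; 0; 0];
      [:: 0; 0; 0; 0; 0; s; 0; 0];
      [:: 0; 0; 0; 0; 0; 0; 1; 0];
      [:: 0; 0; 0; 0; 0; 0; 0; 1]].

Lemma mul_short c1 c2 c3 x0 x1 x2 x3 x4 x5 x6 x7 : row_of 8 [:: x0; x1; x2; x3; x4; x5; x6; x7] *m g2_short c1 c2 c3 =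
  row_of 8 [:: x0 + (c1 * x4 + c2 * x5 + c3 * x6); x1 - (x0 - x7 + (c1 * x4 + c2 * x5 + c3 * x6)) * c1; x2 - (x0 - x7 + (c1 * x4 + c2 * x5 + c3 * x6)) * c2; x3 - (x0 - x7 + (c1 * x4 + c2 * x5 + c3 * x6)) * c3; x4 - (c2 * x3 - c3 * x2); x5 - (c3 * x1 - c1 * x3); x6 - (c1 * x2 - c2 * x1); x7 - (c1 * x4 + c2 * x5 + c3 * x6)].
Proof. by rewrite mul_row8 /mkseq /=; row8_ring. Qed.

Lemma mul_swap x0 x1 x2 x3 x4 x5 x6 x7 : row_of 8 [:: x0; x1; x2; x3; x4; x5; x6; x7] *m g2_swap =
  row_of 8 [:: x7; - x4; - x5; - x6; - x1; - x2; - x3; x0].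
Proof. by rewrite mul_row8 /mkseq /=; row8_ring. Qed.

Lemma mul_unipotent p q r x0 x1 x2 x3 x4 x5 x6 x7 : row_of 8 [:: x0; x1; x2; x3; x4; x5; x6; x7] *m g2_unipotent p q r =
  row_of 8 [:: x0; x1; p * x1 + x2 + r * x3; q * x1 + x3; x4 + (q * r - p) * x5 - q * x6; x5; x6 - r * x5; x7].
Proof. by rewrite mul_row8 /mkseq /=; row8_ring. Qed.

Lemma mul_cycle x0 x1 x2 x3 x4 x5 x6 x7 : row_of 8 [:: x0; x1; x2; x3; x4; x5; x6; x7] *m g2_cycle =
  row_of 8 [:: x0; x3; x1; x2; x6; x4; x5; x7].
Proof. by rewrite mul_row8 /mkseq /=; row8_ring. Qed.

Lemma mul_flip x0 x1 x2 x3 x4 x5 x6 x7 : row_of 8 [:: x0; x1; x2; x3; x4; x5; x6; x7] *m g2_flip =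
  row_of 8 [:: x0; - x2; - x1; - x3; - x5; - x4; - x6; x7].
Proof. by rewrite mul_row8 /mkseq /=; row8_ring. Qed.

Lemma mul_torus t s x0 x1 x2 x3 x4 x5 x6 x7 : row_of 8 [:: x0; x1; x2; x3; x4; x5; x6; x7] *m g2_torus t s =
  row_of 8 [:: x0; s * x1; t * x2; x3; t * x4; s * x5; x6; x7].
Proof. by rewrite mul_row8 /mkseq /=; row8_ring. Qed.

End Generators.

Lemma map_mx_of (A B : comNzRingType) (f : {rmorphism A -> B}) m n l :
  map_mx f (mx_of m n l) = mx_of m n [seq [seq f x | x <- r] | r <- l].
Proof.
apply/matrixP => i j; rewrite !mxE.
have [lti|lei] := ltnP i (size l); last first.
  by rewrite !(nth_default [::]) ?size_map // !nth_nil rmorph0.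
rewrite (nth_map [::]) //; set r := nth [::] l i.
have [ltj|lej] := ltnP j (size r); first by rewrite (nth_map 0).
by rewrite !nth_default ?size_map // rmorph0.
Qed.

Section GeneratorsG2.

Variable K : fieldType.

Lemma G2_short (c1 c2 c3 : K) : G2 (g2_short c1 c2 c3).
Proof.
apply: (G2_intro (g' := g2_short (- c1) (- c2) (- c3))).
  by apply: mulmx_id; elim/row8_ind => *; rewrite !mulmxA !mul_short; row8_ring.
by move=> x y; elim/row8_ind: x => *; elim/row8_ind: y => *; rewrite !(mul_short, omul_row8) /omul_coords /= ?mul_short /=; row8_ring.
Qed.

Lemma G2_swap : G2 (g2_swap K).
Proof.
apply: (G2_intro (g' := g2_swap K)).
  by apply: mulmx_id; elim/row8_ind => *; rewrite !mulmxA !mul_swap; row8_ring.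
by move=> x y; elim/row8_ind: x => *; elim/row8_ind: y => *; rewrite !(mul_swap, omul_row8) /omul_coords /= ?mul_swap /=; row8_ring.
Qed.

Lemma G2_unipotent (p q r : K) : G2 (g2_unipotent p q r).
Proof.
apply: (G2_intro (g' := g2_unipotent (q * r - p) (- q) (- r))).
  by apply: mulmx_id; elim/row8_ind => *; rewrite !mulmxA !mul_unipotent; row8_ring.
by move=> x y; elim/row8_ind: x => *; elim/row8_ind: y => *; rewrite !(mul_unipotent, omul_row8) /omul_coords /= ?mul_unipotent /=; row8_ring.
Qed.

Lemma G2_cycle : G2 (g2_cycle K).
Proof.
apply: (G2_intro (g' := g2_cycle K *m g2_cycle K)).
  by apply: mulmx_id; elim/row8_ind => *; rewrite !mulmxA !mul_cycle; row8_ring.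
by move=> x y; elim/row8_ind: x => *; elim/row8_ind: y => *; rewrite !(mul_cycle, omul_row8) /omul_coords /= ?mul_cycle /=; row8_ring.
Qed.

Lemma G2_flip : G2 (g2_flip K).
Proof.
apply: (G2_intro (g' := g2_flip K)).
  by apply: mulmx_id; elim/row8_ind => *; rewrite !mulmxA !mul_flip; row8_ring.
by move=> x y; elim/row8_ind: x => *; elim/row8_ind: y => *; rewrite !(mul_flip, omul_row8) /omul_coords /= ?mul_flip /=; row8_ring.
Qed.

Lemma G2_torus (t s : K) : t * s = 1 -> G2 (g2_torus t s).
Proof.
move=> ts1; apply: (G2_intro (g' := g2_torus s t)).
  by apply: mulmx_id; elim/row8_ind => *; rewrite !mulmxA !mul_torus; congr (row_of 8 [:: _; _; _; _; _; _; _; _]); ring: ts1.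
by move=> x y; elim/row8_ind: x => *; elim/row8_ind: y => *; rewrite !(mul_torus, omul_row8) /omul_coords /= ?mul_torus /=; congr (row_of 8 [:: _; _; _; _; _; _; _; _]); ring: ts1.
Qed.

End GeneratorsG2.

(** * Bivectors and derivations *)

Section Bivectors.

Variable A : comNzRingType.
Implicit Types (x y : 'rV[A]_8) (X : 'M[A]_8).

Definition wedge x y : 'M[A]_8 := x^T *m y - y^T *m x.

Lemma mc_wedge x y i j : mc (wedge x y) i j = co x i * co y j - co y i * co x j.
Proof. by rewrite mcD mcN /mc !mxE !big_ord1 !mxE. Qed.

Lemma wedgeE x y i j : wedge x y i j = x 0 i * y 0 j - y 0 i * x 0 j.
Proof. by rewrite !mxE !big_ord1 !mxE. Qed.

Definition special x y : Prop :=
  [/\ otrace x = 0, otrace y = 0, omul x x = 0, omul y y = 0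
    & omul x y = 0 /\ omul y x = 0].

(* The linear equations of gram *m g2 among the 8 x 8 matrices. *)
Definition g2_form X : Prop :=
  [/\ forall i j, X i j + X j i = 0,
      forall i, X i i = 0,
      forall j, X (inord 0) j + X (inord 7) j = 0,
      [/\ mc X 0 1 - mc X 5 6 = 0, mc X 0 2 - mc X 6 4 = 0 & mc X 0 3 - mc X 4 5 = 0]
    & [/\ mc X 0 4 - mc X 2 3 = 0, mc X 0 5 - mc X 3 1 = 0, mc X 0 6 - mc X 1 2 = 0
        & mc X 1 4 + mc X 2 5 + mc X 3 6 = 0]].

Lemma omul_eq0 x y : omul x y = 0 ->
  forall k, (k < 8)%N -> nth 0 (omul_coords (co x) (co y)) k = 0.
Proof. by move=> xy0 k ltk; rewrite -(co_row_of _ ltk) -/(omul x y) xy0 co0. Qed.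

Lemma otrace_eq0 x : otrace x = 0 -> co x 7 = - co x 0.
Proof. by rewrite /otrace addrC => /eqP; rewrite addr_eq0 => /eqP. Qed.

(** The second exterior power of the traceless octonions is [g2] plus a copy of the traceless
    octonions, and the projection to the latter is the traceless part of the product. The last seven
    equations of [g2_form] are thus the components of [omul x y = 0]. *)
Lemma special_form x y : special x y -> g2_form (wedge x y).
Proof.
case=> /otrace_eq0 x7 /otrace_eq0 y7 _ _ [/omul_eq0 xy _].
have := (xy 0%N isT, xy 1%N isT, xy 2%N isT, xy 3%N isT, xy 4%N isT, xy 5%N isT,
  xy 6%N isT, xy 7%N isT).
rewrite /= x7 y7 => -[[[[[[[E0 E1] E2] E3] E4] E5] E6] E7].
split=> [i j|i|j||]; [by rewrite !wedgeE; ring| by rewrite !wedgeE; ring| |split|split].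
- by rewrite !wedgeE -!/(co _ _) x7 y7; ring.
all: rewrite !mc_wedge.
- by rewrite -[RHS]E1; ring.
- by rewrite -[RHS]E2; ring.
- by rewrite -[RHS]E3; ring.
- by rewrite -[RHS](oppr0) -[in RHS]E4; ring.
- by rewrite -[RHS](oppr0) -[in RHS]E5; ring.
- by rewrite -[RHS](oppr0) -[in RHS]E6; ring.
- by rewrite -[RHS](subr0 0) -{1}E0 -E7; ring.
Qed.

End Bivectors.

(** * The linear equations satisfied by derivations *)

Section Derivations.

Variable K : fieldType.

Lemma g2P (D : 'M[K]_8) : g2 D ->
  forall x y, omul x y *m D = omul (x *m D) y + omul x (y *m D).
Proof. by move=> gD x y; have := gD x y; rewrite !octmulE. Qed.

Definition leibniz (D : nat -> nat -> K) (i j k : nat) : K :=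
  let e i := nth 0 (nseq i 0 ++ 1 :: nseq (7 - i) 0) in
  let ee := nth 0 (omul_coords (e i) (e j)) in
  ee 0%N * D 0%N k + (ee 1%N * D 1%N k + (ee 2%N * D 2%N k + (ee 3%N * D 3%N k +
  (ee 4%N * D 4%N k + (ee 5%N * D 5%N k + (ee 6%N * D 6%N k + ee 7%N * D 7%N k))))))
  - nth 0 (omul_coords (D i) (e j)) k - nth 0 (omul_coords (e i) (D j)) k.

Definition gram_coords (D : nat -> nat -> K) (i j : nat) : K :=
  nth 0 [:: D 7%N j; - D 4%N j; - D 5%N j; - D 6%N j;
            - D 1%N j; - D 2%N j; - D 3%N j; D 0%N j] i.

Ltac lin L0 c := transitivity c; [by rewrite /gram_coords /leibniz /=; ring
  | by rewrite !L0 // ?oppr0 !addr0].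

(** Each equation is an explicit combination, with coefficients 1 and -1, of Leibniz relations
    between basis vectors; the triples given to [leibniz] are the solution of this linear algebra
    problem. *)
Lemma derivation_form (D : 'M[K]_8) : g2 D -> g2_form (gram K *m D).
Proof.
move=> /g2P gD; pose e i : 'rV[K]_8 := row_of 8 (nseq i 0 ++ 1 :: nseq (7 - i) 0).
have eD i : (i < 8)%N -> e i *m D = row (inord i) D.
  move=> lti; rewrite rowE; congr (_ *m _); apply/rowP => j; rewrite !mxE eqxx /=.
  rewrite -(inj_eq val_inj) /= inordK //; move: i lti; apply: forall_lt8;
  by case: j => -[|[|[|[|[|[|[|[|]]]]]]]].
have L0 i j k : (i < 8)%N -> (j < 8)%N -> (k < 8)%N -> leibniz (mc D) i j k = 0.
  move=> lti ltj ltk; have /(congr1 (fun x => co x k)) := gD (e i) (e j).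
  rewrite !eD // co_mul8 coD !co_row_of // => E.
  rewrite /leibniz; apply/eqP; rewrite subr_eq0 subr_eq addrC; apply/eqP.
  have Ei l : (l < 8)%N -> co (row (inord l) D) =1 mc D l by move=> ltl m; rewrite co_row.
  have Ee l : (l < 8)%N -> forall m, (m < 8)%N -> co (e l) m = nth 0 (nseq l 0 ++ 1 :: nseq (7 - l) 0) m.
    by move=> *; rewrite co_row_of.
  have eqco (x y x' y' : nat -> K) : (forall l, (l < 8)%N -> x l = x' l) ->
      (forall l, (l < 8)%N -> y l = y' l) -> omul_coords x y = omul_coords x' y'.
    by move=> ex ey; rewrite /omul_coords !ex // !ey.
  move: E; rewrite (eqco _ _ _ _ (Ee i lti) (Ee j ltj)).
  rewrite (eqco _ _ _ _ (fun l _ => Ei i lti l) (Ee j ltj)).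
  rewrite (eqco _ _ _ _ (Ee i lti) (fun l _ => Ei j ltj l)) addrC.
  by move=> ->; rewrite addrC.
have XE i j : (i < 8)%N -> mc (gram K *m D) i j = gram_coords (mc D) i j.
  move: i; apply: forall_lt8; rewrite mc_mul8 !mc_mx_of // /gram_coords /=; ring.
have X8 (i j : 'I_8) : (gram K *m D) i j = gram_coords (mc D) i j by rewrite mcE XE.
move: (mc D) L0 X8 XE => {gD eD} f L0 X8 XE.
have s01 : gram_coords f 0 1 + gram_coords f 1 0 = 0 by lin L0 (0 + leibniz f 4 1 1).
have s02 : gram_coords f 0 2 + gram_coords f 2 0 = 0 by lin L0 (0 + leibniz f 5 2 2).
have s03 : gram_coords f 0 3 + gram_coords f 3 0 = 0 by lin L0 (0 + leibniz f 6 3 3).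
have s04 : gram_coords f 0 4 + gram_coords f 4 0 = 0 by lin L0 (0 - leibniz f 1 7 0).
have s05 : gram_coords f 0 5 + gram_coords f 5 0 = 0 by lin L0 (0 - leibniz f 2 7 0).
have s06 : gram_coords f 0 6 + gram_coords f 6 0 = 0 by lin L0 (0 - leibniz f 3 7 0).
have s07 : gram_coords f 0 7 + gram_coords f 7 0 = 0 by lin L0 (0 - leibniz f 0 0 0 - leibniz f 1 7 1).
have d0 : gram_coords f 0 0 = 0 by lin L0 (0 - leibniz f 0 7 0).
have s12 : gram_coords f 1 2 + gram_coords f 2 1 = 0 by lin L0 (0 + leibniz f 0 4 2 + leibniz f 0 5 1).
have s13 : gram_coords f 1 3 + gram_coords f 3 1 = 0 by lin L0 (0 + leibniz f 0 4 3 + leibniz f 0 6 1).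
have s14 : gram_coords f 1 4 + gram_coords f 4 1 = 0 by lin L0 (0 + leibniz f 1 2 6 + leibniz f 4 6 2).
have s15 : gram_coords f 1 5 + gram_coords f 5 1 = 0 by lin L0 (0 - leibniz f 2 3 5).
have s16 : gram_coords f 1 6 + gram_coords f 6 1 = 0 by lin L0 (0 - leibniz f 2 3 6).
have s17 : gram_coords f 1 7 + gram_coords f 7 1 = 0 by lin L0 (0 + leibniz f 1 4 1).
have d1 : gram_coords f 1 1 = 0 by lin L0 (0 + leibniz f 0 4 1).
have s23 : gram_coords f 2 3 + gram_coords f 3 2 = 0 by lin L0 (0 + leibniz f 0 5 3 + leibniz f 0 6 2).
have s24 : gram_coords f 2 4 + gram_coords f 4 2 = 0 by lin L0 (0 + leibniz f 1 3 4).
have s25 : gram_coords f 2 5 + gram_coords f 5 2 = 0 by lin L0 (0 + leibniz f 1 2 6 - leibniz f 5 6 1).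
have s26 : gram_coords f 2 6 + gram_coords f 6 2 = 0 by lin L0 (0 + leibniz f 1 3 6).
have s27 : gram_coords f 2 7 + gram_coords f 7 2 = 0 by lin L0 (0 + leibniz f 2 5 2).
have d2 : gram_coords f 2 2 = 0 by lin L0 (0 + leibniz f 0 5 2).
have s34 : gram_coords f 3 4 + gram_coords f 4 3 = 0 by lin L0 (0 - leibniz f 1 2 4).
have s35 : gram_coords f 3 5 + gram_coords f 5 3 = 0 by lin L0 (0 - leibniz f 1 2 5).
have s36 : gram_coords f 3 6 + gram_coords f 6 3 = 0 by lin L0 (0 - leibniz f 1 3 5 - leibniz f 5 6 1).
have s37 : gram_coords f 3 7 + gram_coords f 7 3 = 0 by lin L0 (0 + leibniz f 3 6 3).
have d3 : gram_coords f 3 3 = 0 by lin L0 (0 + leibniz f 0 6 3).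
have s45 : gram_coords f 4 5 + gram_coords f 5 4 = 0 by lin L0 (0 - leibniz f 0 1 5 - leibniz f 0 2 4).
have s46 : gram_coords f 4 6 + gram_coords f 6 4 = 0 by lin L0 (0 - leibniz f 0 1 6 - leibniz f 0 3 4).
have s47 : gram_coords f 4 7 + gram_coords f 7 4 = 0 by lin L0 (0 - leibniz f 0 1 7).
have d4 : gram_coords f 4 4 = 0 by lin L0 (0 - leibniz f 0 1 4).
have s56 : gram_coords f 5 6 + gram_coords f 6 5 = 0 by lin L0 (0 - leibniz f 0 2 6 - leibniz f 0 3 5).
have s57 : gram_coords f 5 7 + gram_coords f 7 5 = 0 by lin L0 (0 - leibniz f 0 2 7).
have d5 : gram_coords f 5 5 = 0 by lin L0 (0 - leibniz f 0 2 5).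
have s67 : gram_coords f 6 7 + gram_coords f 7 6 = 0 by lin L0 (0 - leibniz f 0 3 7).
have d6 : gram_coords f 6 6 = 0 by lin L0 (0 - leibniz f 0 3 6).
have d7 : gram_coords f 7 7 = 0 by lin L0 (0 + leibniz f 0 0 7).
have t0 : gram_coords f 0 0 + gram_coords f 7 0 = 0 by lin L0 (0 - leibniz f 0 0 0 - leibniz f 0 7 0).
have t1 : gram_coords f 0 1 + gram_coords f 7 1 = 0 by lin L0 (0 - leibniz f 0 7 1).
have t2 : gram_coords f 0 2 + gram_coords f 7 2 = 0 by lin L0 (0 - leibniz f 0 7 2).
have t3 : gram_coords f 0 3 + gram_coords f 7 3 = 0 by lin L0 (0 - leibniz f 0 7 3).
have t4 : gram_coords f 0 4 + gram_coords f 7 4 = 0 by lin L0 (0 - leibniz f 7 0 4).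
have t5 : gram_coords f 0 5 + gram_coords f 7 5 = 0 by lin L0 (0 - leibniz f 7 0 5).
have t6 : gram_coords f 0 6 + gram_coords f 7 6 = 0 by lin L0 (0 - leibniz f 7 0 6).
have t7 : gram_coords f 0 7 + gram_coords f 7 7 = 0 by lin L0 (0 + leibniz f 0 0 7 - leibniz f 1 7 1).
have r1 : gram_coords f 0 1 - gram_coords f 5 6 = 0 by lin L0 (0 + leibniz f 2 7 6).
have r2 : gram_coords f 0 2 - gram_coords f 6 4 = 0 by lin L0 (0 + leibniz f 3 7 4).
have r3 : gram_coords f 0 3 - gram_coords f 4 5 = 0 by lin L0 (0 + leibniz f 1 7 5).
have r4 : gram_coords f 0 4 - gram_coords f 2 3 = 0 by lin L0 (0 + leibniz f 5 2 4).
have r5 : gram_coords f 0 5 - gram_coords f 3 1 = 0 by lin L0 (0 + leibniz f 6 3 5).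
have r6 : gram_coords f 0 6 - gram_coords f 1 2 = 0 by lin L0 (0 + leibniz f 4 1 6).
have q : gram_coords f 1 4 + gram_coords f 2 5 + gram_coords f 3 6 = 0 by lin L0 (0 + leibniz f 1 4 0 + leibniz f 0 0 0 - leibniz f 5 6 1).
have skew : forall i, (i < 8)%N -> forall j, (j < 8)%N -> gram_coords f i j + gram_coords f j i = 0.
  by apply: forall_lt8; apply: forall_lt8; first [assumption
    | rewrite addrC; assumption | rewrite ?(d0, d1, d2, d3, d4, d5, d6, d7) addr0].
split=> [i j|i|j||]; rewrite ?X8 ?XE //.
- exact: skew.
- case: i => [] [|[|[|[|[|[|[|[|]]]]]]]] //.
- rewrite !inordK //; case: j => [] [|[|[|[|[|[|[|[|]]]]]]]] //.
Qed.

End Derivations.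

Section Congruence.

Variable A : comNzRingType.
Implicit Types X : 'M[A]_8.

(** The [a] are the coordinates on the six short roots. The [p] form the sl3 block: off the diagonal
    the six long roots, on it the torus coordinates, subject to [p14 + p25 + p36 = 0], which leaves
    dimension 14. *)
Definition g2_table (a1 a2 a3 a4 a5 a6 p14 p15 p16 p24 p25 p26 p34 p35 p36 : A) : seq (seq A) :=
  [:: [:: 0; a1; a2; a3; a4; a5; a6; 0];
      [:: - a1; 0; a6; - a5; p14; p15; p16; a1];
      [:: - a2; - a6; 0; a4; p24; p25; p26; a2];
      [:: - a3; a5; - a4; 0; p34; p35; p36; a3];
      [:: - a4; - p14; - p24; - p34; 0; a3; - a2; a4];
      [:: - a5; - p15; - p25; - p35; - a3; 0; a1; a5];
      [:: - a6; - p16; - p26; - p36; a2; - a1; 0; a6];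
      [:: 0; - a1; - a2; - a3; - a4; - a5; - a6; 0]].

Definition g2_coords a1 a2 a3 a4 a5 a6 p14 p15 p16 p24 p25 p26 p34 p35 p36 : 'M[A]_8 :=
  mx_of 8 8 (g2_table a1 a2 a3 a4 a5 a6 p14 p15 p16 p24 p25 p26 p34 p35 p36).

Lemma g2_form_coords X : g2_form X ->
  let x i j := mc X i j in
  mc X 1 4 + mc X 2 5 + mc X 3 6 = 0 /\
  X = g2_coords (x 0 1)%N (x 0 2)%N (x 0 3)%N (x 0 4)%N (x 0 5)%N (x 0 6)%N
    (x 1 4)%N (x 1 5)%N (x 1 6)%N (x 2 4)%N (x 2 5)%N (x 2 6)%N
    (x 3 4)%N (x 3 5)%N (x 3 6)%N.
Proof.
case=> skew diag tr [r1 r2 r3] [r4 r5 r6 q] x; split=> //.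
have {}skew i j : x i j = - x j i by apply/eqP; rewrite -addr_eq0 /x /mc skew.
have {}diag i : x i i = 0 by rewrite /x /mc diag.
have {tr} x7 j : x 7%N j = - x 0%N j.
  by apply/eqP; rewrite -addr_eq0 addrC /x /mc tr.
have x70 : x 7%N 0%N = 0 by rewrite x7 diag oppr0.
have xj7 j : x j 7%N = x 0%N j by rewrite skew x7 opprK.
have {}r1 : x 5%N 6%N = x 0%N 1%N by apply/esym/subr0_eq.
have {}r2 : x 6%N 4%N = x 0%N 2%N by apply/esym/subr0_eq.
have {}r3 : x 4%N 5%N = x 0%N 3%N by apply/esym/subr0_eq.
have {}r4 : x 2%N 3%N = x 0%N 4%N by apply/esym/subr0_eq.
have {}r5 : x 3%N 1%N = x 0%N 5%N by apply/esym/subr0_eq.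
have {}r6 : x 1%N 2%N = x 0%N 6%N by apply/esym/subr0_eq.
apply: mc_ext; apply: forall_lt8; apply: forall_lt8; rewrite mc_mx_of //= -/(x _ _);
  first [by [] | by rewrite ?(diag, xj7, x7, x70, r1, r2, r3, r4, r5, r6) ?oppr0 ?opprK
    | by rewrite skew ?(diag, xj7, x7, x70, r1, r2, r3, r4, r5, r6) ?oppr0 ?opprK].
Qed.

Definition congr_mx (g X : 'M[A]_8) : 'M[A]_8 := g^T *m X *m g.

Lemma congr_mxM g h X : congr_mx (g *m h) X = congr_mx h (congr_mx g X).
Proof. by rewrite /congr_mx trmx_mul !mulmxA. Qed.

Lemma congr_mx1 X : congr_mx 1%:M X = X.
Proof. by rewrite /congr_mx trmx1 mul1mx mulmx1. Qed.

(** Both multiplications by [g] are displayed as products of explicit rows by [g], the shape that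
    [mul_short], [mul_unipotent] and their analogues evaluate. *)
Lemma mc_congr g X i j : mc (congr_mx g X) i j = co (row_of 8 [::
  co (row_of 8 (mkseq (mc X 0) 8) *m g) j; co (row_of 8 (mkseq (mc X 1) 8) *m g) j;
  co (row_of 8 (mkseq (mc X 2) 8) *m g) j; co (row_of 8 (mkseq (mc X 3) 8) *m g) j;
  co (row_of 8 (mkseq (mc X 4) 8) *m g) j; co (row_of 8 (mkseq (mc X 5) 8) *m g) j;
  co (row_of 8 (mkseq (mc X 6) 8) *m g) j; co (row_of 8 (mkseq (mc X 7) 8) *m g) j]
  *m g) i.
Proof.
have rowX k : row_of 8 (mkseq (mc X k) 8) = row (inord k) X.
  by apply: co_ext; apply: forall_lt8; rewrite co_row_of // co_row.
have rowXg k : co (row_of 8 (mkseq (mc X k) 8) *m g) j = mc (X *m g) k j.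
  by rewrite rowX -row_mul co_row.
rewrite /congr_mx -mulmxA mc_mul8 !mc_tr co_mul8 !co_row_of // /nth !rowXg.
by rewrite ![mc g _ i * _]mulrC.
Qed.

Lemma congr_wedge g x y : congr_mx g (wedge x y) = wedge (x *m g) (y *m g).
Proof. by rewrite /congr_mx /wedge mulmxBr mulmxBl !trmx_mul !mulmxA. Qed.

End Congruence.

Section MapGenerators.

Variables (A B : comNzRingType) (f : {rmorphism A -> B}).

Lemma map_cycle : map_mx f (g2_cycle A) = g2_cycle B.
Proof. by rewrite map_mx_of /= !(rmorph0, rmorph1). Qed.

Lemma map_flip : map_mx f (g2_flip A) = g2_flip B.
Proof. by rewrite map_mx_of /= !(rmorph0, rmorphN, rmorph1). Qed.

Lemma map_unipotent p q r :
  map_mx f (g2_unipotent p q r) = g2_unipotent (f p) (f q) (f r).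
Proof.
by rewrite map_mx_of /= !(rmorph0, rmorph1, rmorphN, rmorphD, rmorphM).
Qed.

Lemma map_short p q r : map_mx f (g2_short p q r) = g2_short (f p) (f q) (f r).
Proof. by rewrite map_mx_of /= !(rmorph0, rmorph1, rmorphN, rmorphM). Qed.

End MapGenerators.

(** * The translates of a long root coordinate span all coordinates *)

Section Coverage.

Variables (K : fieldType) (A : comAlgType K).
Hypotheses (K2 : 2%:R != 0 :> K) (K3 : 3%:R != 0 :> K).
Variable J : set A.
Hypotheses (JD : forall x y, J x -> J y -> J (x + y)) (JZ : forall (k : K) x, J x -> J (k *: x)).

Lemma JN x : J x -> J (- x). Proof. by rewrite -scaleN1r; exact: JZ. Qed.

Lemma J_div (n : nat) x : n%:R != 0 :> K -> J (n%:R * x) -> J x.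
Proof.
move=> n0 /(JZ (n%:R)^-1); rewrite mulr_natl -scaler_nat scalerA mulVf ?scale1r //.
Qed.

Let Q X i j := forall g, G2 g -> J (mc (congr_mx (extend A g) X) i j).

Lemma Q_mul X h i j i' j' : G2 h ->
  (forall Y : 'M[A]_8, mc (congr_mx (extend A h) Y) i j = mc Y i' j') ->
  Q X i j -> Q X i' j'.
Proof.
move=> Gh hY QX g Gg; rewrite -hY -congr_mxM -extendM; apply: QX; exact: G2_mul.
Qed.

(** A form of the irreducibility of [g2]. The cycle and the flip carry the coordinate 1 5 to the
    other long roots, the unipotents reach the torus and the short exponentials the short roots.
    Since [J] is only a [K]-subspace of [A], the lemma serves both for 0 over a field and for the
    radical of an ideal over [A]. *)
Lemma coverage X : g2_form X -> Q X 1 5 -> forall i j, J (X i j).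
Proof.
move=> /g2_form_coords[q defX] Q15.
have cyc i j i' j' : (forall Y : 'M[A]_8, mc (congr_mx (g2_cycle A) Y) i j = mc Y i' j') ->
    Q X i j -> Q X i' j'.
  by move=> E; apply: Q_mul (G2_cycle K) _ => Y; rewrite /extend map_cycle.
have Q34 : Q X 3 4 by apply: (cyc 1%N 5%N) => // Y; rewrite mc_congr !mul_cycle !co_row_of.
have Q26 : Q X 2 6 by apply: (cyc 3%N 4%N) => // Y; rewrite mc_congr !mul_cycle !co_row_of.
have Q24 : Q X 2 4.
  apply: Q_mul (G2_flip K) _ Q15 => Y.
  by rewrite /extend map_flip mc_congr !mul_flip !co_row_of //= opprK.
have Q16 : Q X 1 6 by apply: (cyc 2%N 4%N) => // Y; rewrite mc_congr !mul_cycle !co_row_of.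
have Q35 : Q X 3 5 by apply: (cyc 1%N 6%N) => // Y; rewrite mc_congr !mul_cycle !co_row_of.
have Q1 i j : Q X i j -> J (mc X i j).
  by move/(_ _ (G2_1 K)); rewrite /extend map_mx1 congr_mx1.
have {Q16 Q35} [J16 J35] : J (mc X 1 6) /\ J (mc X 3 5) by split; apply: Q1.
have [J15 [J34 [J26 J24]]] : J (mc X 1 5) /\ J (mc X 3 4) /\ J (mc X 2 6) /\ J (mc X 2 4).
  by do ![split]; apply: Q1.
move: {cyc} J15 J34 J26 J24 J16 J35 q; set x14 := mc X 1 4; set x25 := mc X 2 5.
set x36 := mc X 3 6 => J15 J34 J26 J24 J16 J35 q.
have expand g i j : mc (congr_mx g X) i j = mc (congr_mx g (g2_coords
    (mc X 0 1) (mc X 0 2) (mc X 0 3) (mc X 0 4) (mc X 0 5) (mc X 0 6)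
    x14 (mc X 1 5) (mc X 1 6) (mc X 2 4) x25 (mc X 2 6) (mc X 3 4) (mc X 3 5) x36)) i j.
  by rewrite {1}defX.
have rows a1 a2 a3 a4 a5 a6 p14 p15 p16 p24 p25 p26 p34 p35 p36 k : (k < 8)%N ->
    mkseq (mc (g2_coords a1 a2 a3 a4 a5 a6 p14 p15 p16 p24 p25 p26 p34 p35 p36) k) 8 =
    nth [::] (g2_table a1 a2 a3 a4 a5 a6 p14 p15 p16 p24 p25 p26 p34 p35 p36) k.
  by move: k; apply: forall_lt8; rewrite /mkseq /= !mc_mx_of.
have Jlin c y : J y -> J (y + c) -> J c.
  by move=> Jy Jyc; rewrite -(addKr y c); apply: JD => //; apply: JN.
(* The unipotent with [p = 1] adds to the coordinate 2 4 the difference of two torus coordinates and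
   a long root coordinate already in [J]. *)
have J1425 : J (x14 - x25).
  apply: (Jlin _ (mc X 2 4 - mc X 1 5)); first by apply: JD => //; apply: JN.
  have := Q24 _ (G2_unipotent 1 0 0).
  rewrite /extend map_unipotent expand mc_congr !rows //= !mul_unipotent !co_row_of //=.
  rewrite !scale1r !scale0r; congr J; ring.
have J3625 : J (x36 - x25).
  apply: (Jlin _ (mc X 2 6 - mc X 3 5)); first by apply: JD => //; apply: JN.
  have := Q26 _ (G2_unipotent 0 0 1).
  rewrite /extend map_unipotent expand mc_congr !rows //= !mul_unipotent !co_row_of //=.
  rewrite !scale1r !scale0r; congr J; ring.
(* The relation [q] among the three torus coordinates turns their differences into [3 x25]. *)
have J25 : J x25.
  apply: (J_div K3); rewrite (_ : _ * _ = - (x14 - x25) - (x36 - x25)).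
    by apply: JD; apply: JN.
  by rewrite -[LHS]subr0 -q; ring.
have J14 : J x14 by rewrite -(subrK x25 x14); apply: JD.
have J36 : J x36 by rewrite -(subrK x25 x36); apply: JD.
have short c1 c2 c3 i j : Q X i j ->
    J (mc (congr_mx (g2_short (in_alg A c1) (in_alg A c2) (in_alg A c3)) X) i j).
  by move/(_ _ (G2_short c1 c2 c3)); rewrite /extend map_short.
(* A short exponential moves a long root coordinate along a root string long, short, short, long;
   [c] is its parameter. The values at 1 and -1 separate the even and odd parts and isolate [6 a]
   and [6 b]. *)
have J2 a b e f : J e -> J f ->
    (forall c : K, J (e - 3%:R * c%:A * b - 3%:R * c%:A ^+ 2 * a + c%:A ^+ 3 * f)) ->
    J a /\ J b.
  move=> Je Jf Jc; have := Jc 1; have := Jc (- 1); rewrite scale1r scaleN1r => Jm Jp.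
  split; apply: (J_div K3); apply: (J_div K2).
    rewrite (_ : _ * _ = 2%:R *: e - (e - 3%:R * 1 * b - 3%:R * 1 ^+ 2 * a + 1 ^+ 3 * f) -
      (e - 3%:R * -1 * b - 3%:R * (- 1) ^+ 2 * a + (- 1) ^+ 3 * f)).
      by apply: JD; [apply: JD; [exact: JZ | exact: JN] | exact: JN].
    by rewrite scaler_nat; ring.
  rewrite (_ : _ * _ = (e - 3%:R * -1 * b - 3%:R * (- 1) ^+ 2 * a + (- 1) ^+ 3 * f) -
    (e - 3%:R * 1 * b - 3%:R * 1 ^+ 2 * a + 1 ^+ 3 * f) + 2%:R *: f).
    by apply: JD; [apply: JD; [|exact: JN] | exact: JZ].
  by rewrite scaler_nat; ring.
have [J03 J05] : J (mc X 0 3) /\ J (mc X 0 5).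
  apply: (J2 _ _ _ _ J15 J34) => c; have := short c 0 0 _ _ Q15.
  rewrite expand mc_congr !rows //= !mul_short !co_row_of //= !scale0r; congr J; ring.
have [J01 J06] : J (mc X 0 1) /\ J (mc X 0 6).
  apply: (J2 _ _ _ _ J26 J15) => c; have := short 0 c 0 _ _ Q26.
  rewrite expand mc_congr !rows //= !mul_short !co_row_of //= !scale0r; congr J; ring.
have [J02 J04] : J (mc X 0 2) /\ J (mc X 0 4).
  apply: (J2 _ _ _ _ J34 J26) => c; have := short 0 0 c _ _ Q34.
  rewrite expand mc_congr !rows //= !mul_short !co_row_of //= !scale0r; congr J; ring.
have J0 : J 0 by rewrite -(scale0r (mc X 0 1)); apply: JZ.
move=> i j; rewrite mcE defX -!/x14 -!/x25 -!/x36 mc_mx_of //.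
move: (nat_of_ord i) (ltn_ord i) (nat_of_ord j) (ltn_ord j).
by apply: forall_lt8; apply: forall_lt8; rewrite /=; first [assumption | apply: JN; assumption].
Qed.

End Coverage.

(** * Equations for decomposable bivectors of null planes *)

Section Minimal.

Variable A : comNzRingType.
Implicit Types (x y : 'rV[A]_8) (X : 'M[A]_8).

(** With B the polar form of the norm, the skew endomorphism z -> B(z, x) y - B(z, y) x.
    Multiplication by [gram] identifies bivectors with skew endomorphisms. *)
Definition so_mx x y : 'M[A]_8 := gram A *m wedge x y.

Lemma wedgeZ a b x y : wedge (a *: x) (b *: y) = (a * b) *: wedge x y.
Proof. by apply/matrixP => i j; rewrite !(wedgeE, mxE); ring. Qed.

Lemma wedgeDl x x' y : wedge (x + x') y = wedge x y + wedge x' y.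
Proof. by apply/matrixP => i j; rewrite !(wedgeE, mxE); ring. Qed.

Lemma wedgeDr x y y' : wedge x (y + y') = wedge x y + wedge x y'.
Proof. by apply/matrixP => i j; rewrite !(wedgeE, mxE); ring. Qed.

Lemma wedge_comb a b c d x y :
  wedge (a *: x + b *: y) (c *: x + d *: y) = (a * d - b * c) *: wedge x y.
Proof. by apply/matrixP => i j; rewrite !(wedgeE, mxE); ring. Qed.

(** Equations of the cone over the adjoint variety, meaningful over any ring: the linear ones of
    [g2], the Plücker relations, which make [X] decomposable, and the vanishing of the products of
    the rows, which makes the plane spanned by the rows null. *)
Definition minimal X : Prop :=
  [/\ g2_form X,
      forall a b c d, X a b * X c d - X a c * X b d + X a d * X b c = 0
    & forall a b, omul (row a X) (row b X) = 0].

Lemma minimal_row X a : minimal X -> otrace (row a X) = 0.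
Proof.
case=> [[skew _ tr _ _] _ _]; rewrite /otrace /co !mxE.
have sk i j : X i j = - X j i by apply/eqP; rewrite -addr_eq0 skew.
by rewrite [X a _]sk [X a (inord 7)]sk -opprD tr oppr0.
Qed.

Lemma minimal_special X a b : minimal X -> special (row a X) (row b X).
Proof. by move=> mX; have [_ _ rX] := mX; split; rewrite ?minimal_row. Qed.

(** The Plücker relations recover [X] from two of its rows, up to the factor [X a b]. This is what
    inverts the passage from a plane to its line of bivectors. *)
Lemma minimal_wedge_rows X a b : minimal X -> wedge (row a X) (row b X) = X a b *: X.
Proof.
case=> [[skew _ _ _ _] pl _]; apply/matrixP => c d; rewrite wedgeE !mxE.
have sk i j : X i j = - X j i by apply/eqP; rewrite -addr_eq0 skew.
have := pl a b c d; rewrite [X b d]sk [X b c]sk => E.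
by apply: subr0_eq; rewrite -[RHS]oppr0 -E; ring.
Qed.

Lemma special_comb x y a b c d : special x y ->
  special (a *: x + b *: y) (c *: x + d *: y).
Proof.
case=> tx ty xx yy [xy yx].
have tr e f : otrace (e *: x + f *: y) = 0.
  rewrite /otrace !coD !coZ addrACA -!mulrDr -!/(otrace _).
  by rewrite tx ty !mulr0 addr0.
have mul e f e' f' : omul (e *: x + f *: y) (e' *: x + f' *: y) = 0.
  rewrite omulDl !omulDr !omulZl !omulZr xx yy xy yx !scaler0.
  by rewrite !addr0.
by split.
Qed.

Lemma g2_formZ c X : g2_form X -> g2_form (c *: X).
Proof.
case=> skew diag tr [r1 r2 r3] [r4 r5 r6 q].
by split=> [i j|i|j||]; [| | |split|split]; rewrite ?mxE ?mcZ ?(skew, diag) ?[in c * X _ _]mxE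
  -?mulrBr -?mulrDr ?(r1, r2, r3, r4, r5, r6, q, skew, diag, tr) ?mulr0.
Qed.

Lemma minimal_wedge c x y : special x y -> minimal (c *: wedge x y).
Proof.
move=> sxy; split; first exact/g2_formZ/special_form.
  by move=> i j k l; rewrite !mxE !big_ord1 !mxE; ring.
have rowW i : row i (c *: wedge x y) = (- (c * y 0 i)) *: x + (c * x 0 i) *: y.
  by apply/rowP => j; rewrite mxE [LHS]mxE wedgeE !mxE; ring.
by move=> i j; rewrite !rowW; have [] := special_comb (- (c * y 0 i)) (c * x 0 i)
  (- (c * y 0 j)) (c * x 0 j) sxy => _ _ _ _ [].
Qed.

End Minimal.

(** * The big cell and the orbit of null pairs *)

Section Cells.

Variable A : comNzRingType.
Implicit Types x y : 'rV[A]_8.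

Definition highest_x : 'rV[A]_8 := row_of 8 [:: 0; 1; 0; 0; 0; 0; 0; 0].

Definition highest_y : 'rV[A]_8 := row_of 8 [:: 0; 0; 0; 0; 0; 1; 0; 0].

Lemma special_highest : special highest_x highest_y.
Proof.
split; try split; rewrite /otrace /highest_x /highest_y ?co_row_of ?omul_row8 //=
  /omul_coords /= ?addr0 //; apply: co_ext; apply: forall_lt8;
  rewrite co_row_of // co0 /=; ring.
Qed.

(* Homogeneous parametrization, by the value d of the coordinate on the highest
   root, of the big cell of the adjoint variety. *)
Definition cell_x (d a b u2 u3 : A) : 'rV[A]_8 := row_of 8
  [:: a * d; d ^+ 2; u2 * d; u3 * d; - a ^+ 2 - u3 * b; 0; b * d; - (a * d)].

Definition cell_y (d a b u2 u3 w : A) : 'rV[A]_8 := row_of 8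
  [:: b * d; 0; a * w - b ^+ 2; - (a * d); - (a * b) - u2 * d - u3 * w; d ^+ 2;
      w * d; - (b * d)].

Lemma special_cell x y d : special x y ->
  co x 1 = d -> co x 5 = 0 -> co y 1 = 0 -> co y 5 = d ->
  let c := cell_x d (co x 0) (co y 0) (co x 2) (co x 3) in
  let c' := cell_y d (co x 0) (co y 0) (co x 2) (co x 3) (co y 6) in
  d *: c = d ^+ 2 *: x /\ d *: c' = d ^+ 2 *: y.
Proof.
elim/row8_ind: x => x0 x1 x2 x3 x4 x5 x6 x7.
elim/row8_ind: y => y0 y1 y2 y3 y4 y5 y6 y7.
case=> /otrace_eq0 tx /otrace_eq0 ty xx yy [xy _].
move: tx ty xx yy xy; rewrite !omul_row8 !co_row_of //= => -> ->.
move=> xx yy xy E1 E2 E3 E4; move: xx yy xy; rewrite E1 E2 E3 E4 /omul_coords /=.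
move=> /(congr1 (fun z => co z 0)) xx0 /(congr1 (fun z => co z 0)) yy0.
move=> xy; have xy0 := congr1 (fun z => co z 0) xy.
have xy1 := congr1 (fun z => co z 1) xy; have xy5 := congr1 (fun z => co z 5) xy.
move: xx0 yy0 xy0 xy1 xy5; rewrite !co_row_of // !co0 /= => xx0 yy0 xy0 xy1 xy5.
rewrite /cell_x /cell_y !row8Z.
have dx6 : d * x6 = d * y0 by apply: subr0_eq; rewrite -[RHS]xy1; ring.
have dy3 : d * y3 = - (d * x0) by apply: subr0_eq; rewrite -[RHS]oppr0 -xy5; ring.
have dx4 : d * (d * x4) = - (d * x0 ^+ 2) - x3 * (d * y0).
  by rewrite -dx6; apply: subr0_eq; rewrite -[RHS](mulr0 d) -xx0; ring.
have dy2 : d * (d * y2) = - (d * y0 ^+ 2) + d * x0 * y6.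
  rewrite -[d * x0]opprK -dy3; apply: subr0_eq; rewrite -[RHS](mulr0 d) -yy0; ring.
have dy4 : d * y4 = - (x0 * y0) - x2 * d - x3 * y6.
  by apply: subr0_eq; rewrite -[RHS]xy0; ring.
split; congr (row_of 8 [:: _; _; _; _; _; _; _; _]); rewrite ?mulr0 //; try ring.
- by rewrite expr2 -mulrA dx4; ring.
- by rewrite expr2 -mulrA dx6; ring.
- by rewrite expr2 -mulrA dy2; ring.
- by rewrite expr2 -mulrA dy3; ring.
- by rewrite expr2 -mulrA dy4; ring.
Qed.

End Cells.

Section Orbits.

Variable K : fieldType.
Hypotheses (K2 : 2%:R != 0 :> K) (K3 : 3%:R != 0 :> K).
Hypothesis K_infinite : forall s : seq K, exists x, x \notin s.

Implicit Types x y : 'rV[K]_8.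

Lemma cell_highest (d a b u2 u3 w : K) : d != 0 -> exists2 h, G2 h &
  cell_x d a b u2 u3 = d ^+ 2 *: (highest_x K *m h) /\
  cell_y d a b u2 u3 w = d ^+ 2 *: (highest_y K *m h).
Proof.
move=> d0; pose s := g2_swap K *m g2_short (a / d) 0 0 *m g2_swap K.
exists (g2_short 0 (b / d) 0 *m s *m
        g2_unipotent (u2 / d - a * b / d ^+ 2) (u3 / d) (- w / d)).
  (* One parameter for each affine coordinate of the cell. The two short factors already produce
     [a * b / d ^+ 2] in the coordinate 2, and the first parameter of the unipotent compensates for
     it. *)
  apply: G2_mul (G2_unipotent _ _ _); apply: G2_mul (G2_short _ _ _) _.
  by apply: G2_mul (G2_swap K); apply: G2_mul (G2_swap K) (G2_short _ _ _).
rewrite /highest_x /highest_y /s !mulmxA !mul_short !mul_swap !mul_short !mul_swap.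
rewrite !mul_unipotent !row8Z /cell_x /cell_y.
by split; congr (row_of 8 [:: _; _; _; _; _; _; _; _]); field.
Qed.

Lemma G2_gramV (g : 'M[K]_8) : G2 g -> gram K *m g^T = invmx g *m gram K.
Proof. by move=> Gg; rewrite -{2}(G2_gram Gg) !mulmxA mulVmx ?mul1mx // G2_unit. Qed.

Lemma so_mx_conj (g : 'M[K]_8) x y : G2 g ->
  so_mx (x *m g) (y *m g) = invmx g *m so_mx x y *m g.
Proof. by move=> Gg; rewrite /so_mx -congr_wedge /congr_mx !mulmxA G2_gramV. Qed.

Lemma special_G2 (g : 'M[K]_8) x y : G2 g -> special x y -> special (x *m g) (y *m g).
Proof.
move=> Gg [tx ty xx yy [xy yx]]; split; rewrite ?(G2_norm _ Gg).1 ?G2_omul //.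
- by rewrite xx mul0mx.
- by rewrite yy mul0mx.
- by rewrite xy yx mul0mx.
Qed.

Lemma extend_regular m n (M : 'M[K]_(m, n)) : extend K^o M = M.
Proof. by apply/matrixP => i j; rewrite mxE -[RHS]mulr1. Qed.

Lemma coverage_field (X : 'M[K]_8) : g2_form X -> X != 0 ->
  exists2 g, G2 g & mc (congr_mx g X) 1 5 != 0.
Proof.
move=> fX nzX; apply: contrapT => noG; case/eqP: nzX; apply/matrixP => i j; rewrite mxE.
apply: (@coverage K K^o K2 K3 [set 0] _ _ X fX) => [x y -> ->|k x ->|g Gg].
- by rewrite /= addr0.
- by rewrite /= scaler0.
apply/eqP/negPn/negP => nz; apply: noG; exists g => //.
by rewrite extend_regular in nz.
Qed.

Let D0 : 'M[K]_8 := so_mx (highest_x K) (highest_y K).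

(** A translate of a nonzero [wedge x y] has a nonzero coordinate 1 5. The translated plane then has
    a basis in the big cell, all of whose points are translates of the highest root line. *)
Lemma orbit_cone_special x y c : special x y -> orbit_cone D0 (mxvec (c *: so_mx x y)).
Proof.
move=> sxy; have [W0|nzW] := eqVneq (wedge x y) 0.
  exists 0, 1%:M; split; first exact: G2_1.
  by rewrite /so_mx W0 mulmx0 scaler0 scale0r.
have [g Gg] := coverage_field (special_form sxy) nzW.
rewrite congr_wedge mc_wedge; set x' := x *m g; set y' := y *m g; set d := _ - _ => d0.
have sxy' : special x' y' by apply: special_G2.
(* The change of basis is the adjugate of the matrix of coordinates 1 and 5 of [x'] and [y']: that
   matrix becomes [d] times the identity without any division. *)
pose xh := co y' 5 *: x' + (- co x' 5) *: y'.
pose yh := (- co y' 1) *: x' + co x' 1 *: y'.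
have Wh : wedge xh yh = d *: wedge x' y'.
  by rewrite /xh /yh wedge_comb; congr (_ *: _); rewrite /d; ring.
have sh : special xh yh by apply: special_comb.
have [||||Ex Ey] := special_cell (d := d) sh.
- by rewrite /xh coD !coZ /d; ring.
- by rewrite /xh coD !coZ; ring.
- by rewrite /yh coD !coZ; ring.
- by rewrite /yh coD !coZ /d; ring.
have [h Gh [Cx Cy]] := cell_highest (co xh 0) (co yh 0) (co xh 2) (co xh 3) (co yh 6) d0.
have Exh : xh = d *: (highest_x K *m h).
  apply: (scalerI (expf_neq0 2 d0)); rewrite -Ex Cx !scalerA; congr (_ *: _); ring.
have Eyh : yh = d *: (highest_y K *m h).
  apply: (scalerI (expf_neq0 2 d0)); rewrite -Ey Cy !scalerA; congr (_ *: _); ring.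
have W' : wedge x' y' = d *: wedge (highest_x K *m h) (highest_y K *m h).
  by apply: (scalerI d0); rewrite -Wh Exh Eyh wedgeZ scalerA.
exists (c * d), (h *m invmx g); split; first by apply: G2_mul (G2_inv Gg).
congr mxvec; rewrite -scalerA; congr (_ *: _).
have -> : so_mx x y = g *m so_mx x' y' *m invmx g.
  rewrite so_mx_conj // !mulmxA mulmxV ?G2_unit // mul1mx mulmxK // G2_unit //.
have -> : so_mx x' y' = d *: (invmx h *m D0 *m h).
  by rewrite -so_mx_conj // /so_mx W' -scalemxAr.
have -> : invmx (h *m invmx g) = g *m invmx h.
  have ug := G2_unit Gg; have uh := G2_unit Gh.
  apply: (can_inj (mulmxK (_ : h *m invmx g \in unitmx))).
    by rewrite unitmx_mul uh unitmx_inv.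
  rewrite mulVmx ?unitmx_mul ?uh ?unitmx_inv //.
  by rewrite !mulmxA mulmxKV // mulmxV.
by rewrite -scalemxAr -scalemxAl !mulmxA.
Qed.

Lemma orbit_coneP w : orbit_cone D0 w <->
  exists c x y, special x y /\ w = mxvec (c *: so_mx x y).
Proof.
split=> [[c [g [Gg ->]]]|[c [x [y [sxy ->]]]]]; last exact: orbit_cone_special.
exists c, (highest_x K *m g), (highest_y K *m g); rewrite so_mx_conj //.
by split=> //; apply: special_G2 => //; apply: special_highest.
Qed.

End Orbits.

(** * The closed orbit *)

Section ClosedOrbit.

Variable K : fieldType.

Lemma map_gram (A B : comNzRingType) (f : {rmorphism A -> B}) : map_mx f (gram A) = gram B.
Proof. by rewrite map_mx_of /= !(rmorph0, rmorph1, rmorphN). Qed.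

(** [minimal] is a conjunction of polynomial equations over [K]. Each belongs to the vanishing ideal
    of [C], hence holds at every [A]-valued vector on which that ideal vanishes. *)
Lemma minimal_of_vanishing (C : set 'rV[K]_(8 * 8)) :
  (forall w, C w -> minimal (gram K *m vec_mx w)) ->
  forall (A : comAlgType K) (l : 'rV[A]_(8 * 8)),
  (forall p, vanishing_ideal C p -> mmap (in_alg A) (l 0) p = 0) ->
  minimal (gram A *m vec_mx l).
Proof.
move=> Cmin A l l0.
pose X (B : comAlgType K) (v : 'I_(8 * 8) -> B) : 'M[B]_8 :=
  extend B (gram K) *m vec_mx (\row_i v i).
have XE (B : comAlgType K) (m : 'rV[B]_(8 * 8)) : gram B *m vec_mx m = X B (m 0).
  rewrite /X /extend map_gram; congr (_ *m vec_mx _).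
  by apply/rowP => i; rewrite mxE.
have XK (w : 'rV[K]_(8 * 8)) : X K^o (w 0) = gram K *m vec_mx w :> 'M[K]_8.
  by rewrite -(XE K^o w).
have pX : polymx X by apply: polymxM (polymx_const _ _) _; apply/polymx_vec_mx/polymx_rowval.
have vanish (F : forall B : comAlgType K, ('I_(8 * 8) -> B) -> B) :
    polyfun F -> (forall w, C w -> F K^o (w 0) = 0) -> F A (l 0) = 0.
  by move=> pF F0; have [p Cp ->] := vanishing_polyfun pF F0; apply: l0.
have pco a k : polyfun (fun B v => co (row a (X B v)) k).
  by have [p Fp] := pX a (inord k); exists p => B v; rewrite /co mxE Fp.
have pmc i j : polyfun (fun B v => mc (X B v) i j) by apply: pX.
have key w : C w -> minimal (X K^o (w 0)) by move=> Cw; have := Cmin w Cw; rewrite -XK.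
rewrite XE; split; [split; [| | |split|split]| |].
- move=> i j; apply: (vanish (fun B v => X B v i j + X B v j i)); first exact: polyfunD.
  by move=> w /key[[s _ _ _ _] _ _]; apply: s.
- move=> i; apply: (vanish (fun B v => X B v i i)) => //.
  by move=> w /key[[_ s _ _ _] _ _]; apply: s.
- move=> j; apply: (vanish (fun B v => X B v (inord 0) j + X B v (inord 7) j)); first exact: polyfunD.
  by move=> w /key[[_ _ s _ _] _ _]; apply: s.
- apply: (vanish (fun B v => mc (X B v) 0 1 - mc (X B v) 5 6)); first exact: polyfunB.
  by move=> w /key[[_ _ _ [] ]].
- apply: (vanish (fun B v => mc (X B v) 0 2 - mc (X B v) 6 4)); first exact: polyfunB.
  by move=> w /key[[_ _ _ [] ]].
- apply: (vanish (fun B v => mc (X B v) 0 3 - mc (X B v) 4 5)); first exact: polyfunB.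
  by move=> w /key[[_ _ _ [] ]].
- apply: (vanish (fun B v => mc (X B v) 0 4 - mc (X B v) 2 3)); first exact: polyfunB.
  by move=> w /key[[_ _ _ _ [] ]].
- apply: (vanish (fun B v => mc (X B v) 0 5 - mc (X B v) 3 1)); first exact: polyfunB.
  by move=> w /key[[_ _ _ _ [] ]].
- apply: (vanish (fun B v => mc (X B v) 0 6 - mc (X B v) 1 2)); first exact: polyfunB.
  by move=> w /key[[_ _ _ _ [] ]].
- apply: (vanish (fun B v => mc (X B v) 1 4 + mc (X B v) 2 5 + mc (X B v) 3 6)).
    by apply: polyfunD => //; apply: polyfunD.
  by move=> w /key[[_ _ _ _ [] ]].
- move=> a b c d.
  apply: (vanish (fun B v => X B v a b * X B v c d - X B v a c * X B v b d + X B v a d * X B v b c)).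
    by apply: polyfunD; [apply: polyfunB|]; apply: polyfunM.
  by move=> w /key[_ s _]; apply: s.
move=> a b; apply: co_ext => k ltk; rewrite co0 co_row_of //.
apply: (vanish (fun B v => nth 0 (omul_coords (co (row a (X B v))) (co (row b (X B v)))) k)).
  move: k ltk; apply: forall_lt8; rewrite /omul_coords /=;
  do ![apply: polyfunD | apply: polyfunN | apply: polyfunM | exact: pco].
by move=> w /key[_ _ /(_ a b)/omul_eq0]; apply.
Qed.

Hypotheses (K2 : 2%:R != 0 :> K) (K3 : 3%:R != 0 :> K).
Hypothesis K_infinite : forall s : seq K, exists x, x \notin s.

Let D0 : 'M[K]_8 := so_mx (highest_x K) (highest_y K).

Lemma so_mxK (x y : 'rV[K]_8) c :
  gram K *m vec_mx (mxvec (c *: so_mx x y)) = c *: wedge x y.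
Proof. by rewrite mxvecK -scalemxAr /so_mx mulmxA gramK mul1mx. Qed.

Lemma orbit_minimal w : orbit_cone D0 w -> minimal (gram K *m vec_mx w).
Proof.
move=> /(orbit_coneP K2 K3)[c [x [y [sxy ->]]]].
by rewrite so_mxK; apply: minimal_wedge.
Qed.

(** A nonzero entry [X a b] exhibits [X] as a multiple of the bivector of two of its rows, which
    form a null pair. The cone is thus exactly the zero set of the equations, which is why it is
    closed. *)
Lemma minimal_orbit w : minimal (gram K *m vec_mx w) -> orbit_cone D0 w.
Proof.
set X := gram K *m vec_mx w => mX; apply/(orbit_coneP K2 K3).
have defw : w = mxvec (gram K *m X) by rewrite mulmxA gramK mul1mx vec_mxK.
have [X0|] := eqVneq X 0.
  exists 0, (highest_x K), (highest_y K); split; first exact: special_highest.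
  by rewrite defw X0 mulmx0 scale0r.
case/matrix0Pn => a [b nz].
exists (X a b)^-1, (row a X), (row b X); split; first exact: minimal_special.
rewrite defw /so_mx minimal_wedge_rows // -scalemxAr scalerA mulVf // scale1r //.
Qed.

Lemma orbit_closed : zariski_closed (orbit_cone D0).
Proof.
move=> w w0; apply: minimal_orbit.
have := @minimal_of_vanishing _ orbit_minimal K^o w.
by apply=> p Cp; rewrite mmap_regular w0.
Qed.

Lemma torus_diag (t s : K) : g2_torus t s = diag_mx (row_of 8 [:: 1; s; t; 1; t; s; 1; 1]).
Proof.
apply: mc_ext; apply: forall_lt8; apply: forall_lt8;
  by rewrite mc_mx_of // /mc !mxE -(inj_eq val_inj) /= !inordK.
Qed.

Lemma orbit_cone_conj (D g : 'M[K]_8) c : G2 g ->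
  orbit_cone D (mxvec (c *: (invmx g *m D *m g))).
Proof. by move=> Gg; exists c, g. Qed.

Lemma highest_neq0 : D0 != 0.
Proof.
apply: contraTneq isT => /(congr1 (fun M => mc (gram K *m M) 1 5)).
rewrite /D0 /so_mx mulmxA gramK mul1mx mulmx0 mc_wedge !co_row_of //= /mc mxE.
by move/eqP; rewrite mulr1 mulr0 subr0 oner_eq0.
Qed.

(** After a translation making the coordinate 1 5 nonzero, a one-parameter subgroup of the torus
    contracts [D], up to scale, to a nonzero multiple of [D0]. A closed cone over the orbit of [D]
    contains this limit, so [D] is itself a multiple of a translate of [D0]. *)
Lemma closed_orbit_highest (D : 'M[K]_8) : g2 D -> D != 0 ->
  zariski_closed (orbit_cone D) -> orbit_cone D0 (mxvec D).
Proof.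
move=> gD nzD clD.
have nzX : gram K *m D != 0.
  by apply: contra_neq nzD => X0; rewrite -[D]mul1mx -gramK -mulmxA X0 mulmx0.
have [g Gg] := coverage_field K2 K3 (derivation_form gD) nzX.
set X := congr_mx g _; set d := mc X 1 5 => nzd.
(* The weights 0, -1, 1, 0, 1, -1, 0, 0 of [g2_torus t t^-1], raised by 1 so that the family extends
   to [t = 0]; the scalar [t ^+ 2] below accounts for the shift. Only the indices 1 and 5 have
   exponent 0, and the diagonal is zero, so that at [t = 0] just the entries 1 5 and 5 1 survive. *)
pose e (i : nat) : nat := nth 0%N [:: 1; 0; 2; 1; 2; 0; 1; 1] i.
pose Y (B : comAlgType K) (v : 'I_1 -> B) : 'M[B]_8 :=
  extend B (gram K) *m \matrix_(i, j) (v 0 ^+ (e i + e j) * in_alg B (X i j)).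
have pY : polymx Y.
  apply: polymxM (polymx_const _ _) _ => i j.
  have [p Fp] : polyfun (fun (B : comAlgType K) (v : 'I_1 -> B) => v 0 ^+ (e i + e j) * in_alg B (X i j)).
    by apply: polyfunM (polyfun_const _ _); apply/polyfunX/polyfun_coord.
  by exists p => B v; rewrite mxE Fp.
have Yorbit (v : 'I_1 -> K) : v 0 != 0 -> orbit_cone D (mxvec (Y K^o v)).
  set t := v 0 => t0; pose h := g *m g2_torus t t^-1.
  have Gh : G2 h by apply: G2_mul => //; apply: G2_torus; rewrite mulfV.
  suff -> : Y K^o v = t ^+ 2 *: (invmx h *m D *m h) by apply: orbit_cone_conj.
  rewrite /Y extend_regular.
  have -> : invmx h *m D *m h = gram K *m congr_mx h (gram K *m D).
    by rewrite /congr_mx !mulmxA G2_gramV // -[_ *m gram K *m gram K]mulmxA gramK mulmx1.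
  rewrite scalemxAr; congr (_ *m _).
  rewrite congr_mxM -/X torus_diag; set w := row_of 8 _.
  have we i : t * w 0 i = t ^+ e i.
    rewrite mxE; case: i => [] [|[|[|[|[|[|[|[|]]]]]]]] //= _;
    by rewrite /e /= ?expr0 ?expr1 ?mulr1 ?mulfV // expr2.
  rewrite {1}/congr_mx tr_diag_mx mul_diag_mx mul_mx_diag; apply/matrixP => i j.
  clearbody w; move: (X) => Z.
  rewrite !mxE exprD -/t -!we expr2 -[GRing.in_alg K^o _]/(Z i j * 1).
  ring.
have Y0 (u : 'I_1 -> K) : u 0 = 0 -> Y K^o u = d *: D0.
  move=> u0; rewrite /Y extend_regular /D0 /so_mx scalemxAr; congr (_ *m _).
  have skew i j : X i j = - X j i.
    have [sk _ _ _ _] := derivation_form gD.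
    have skD : (gram K *m D)^T = - (gram K *m D).
      by apply/matrixP => k l; rewrite [LHS]mxE [RHS]mxE; apply/eqP; rewrite -addr_eq0 sk.
    have : X^T = - X by rewrite /X /congr_mx trmx_mul [in LHS]trmx_mul trmxK skD mulNmx mulmxN mulmxA.
    by move/matrixP/(_ j i); rewrite [LHS]mxE [RHS]mxE.
  have diag i : X i i = 0.
    apply: (mulfI K2); rewrite mulr0 mulr_natl mulr2n {1}skew addNr //.
  apply: mc_ext; apply: forall_lt8; apply: forall_lt8;
  rewrite mcZ mc_wedge !co_row_of //= /mc mxE u0 !inordK //= ?expr0 ?mul1r ?expr0n /=
    ?(mul0r, mulr0, subr0, sub0r, mulr1) //.
  all: rewrite ?oppr0 ?mulr0 ?mulrN ?mulr1 //.
  - by rewrite diag scale0r.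
  - exact: mulr1.
  - by rewrite skew; apply: mulr1.
  by rewrite diag scale0r.
(* The limit point: a polynomial vanishing on the family for [t != 0] vanishes at [t = 0], and the
   cone is closed. *)
have : orbit_cone D (mxvec (d *: D0)).
  apply: clD => p Cp; rewrite -(Y0 (fun=> 0)) // -mmap_regular.
  have pF := polyfun_comp p (fun i => polymx_mxvec pY 0 i).
  have := polyfun_eq0 K_infinite (i0 := 0) pF _ (fun=> 0 : K^o); apply=> v v0.
  by rewrite mmap_regular; apply/Cp/Yorbit.
case=> c [h [Gh /(can_inj mxvecK) E]].
have c0 : c != 0.
  apply: contraNneq highest_neq0 => c0; move: E; rewrite c0 scale0r => /eqP.
  by rewrite scaler_eq0 (negPf nzd).
have uh := G2_unit Gh.
exists (c^-1 * d), (invmx h); split; first exact: G2_inv.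
have -> : D = c^-1 *: (h *m (d *: D0) *m invmx h).
  rewrite E -scalemxAr -scalemxAl scalerA mulVf // scale1r.
  by rewrite !mulmxA mulmxV // mul1mx mulmxK.
by rewrite invmxK -scalemxAr -scalemxAl scalerA.
Qed.

Lemma mul_highest x0 x1 x2 x3 x4 x5 x6 x7 :
  row_of 8 [:: x0; x1; x2; x3; x4; x5; x6; x7] *m D0 =
  row_of 8 [:: 0; x2; 0; 0; 0; - x4; 0; 0].
Proof.
rewrite /D0 /so_mx mulmxA mul_gram /wedge mulmxBr !mulmxA.
have mul_tr (x y z : 'rV[K]_8) : x *m y^T *m z = (\sum_(i < 8) co x i * co y i) *: z.
  apply/rowP => j; rewrite [LHS]mxE big_ord1 [RHS]mxE mxE; congr (_ * _).
  by apply: eq_bigr => i _; rewrite mxE !coE.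
rewrite !mul_tr !(sum8 (fun i => co _ i * co _ i)) !co_row_of //=.
by rewrite /highest_x /highest_y !row8Z row8N row8D; row8_ring.
Qed.

Lemma g2_highest : g2 D0.
Proof.
move=> x y; rewrite !octmulE; elim/row8_ind: x => *; elim/row8_ind: y => *.
rewrite !(omul_row8, mul_highest) /omul_coords /= ?(omul_row8, mul_highest, row8D) /omul_coords /=.
by rewrite ?(omul_row8, mul_highest, row8D) /=; row8_ring.
Qed.

Lemma g2_conj (D g : 'M[K]_8) c : g2 D -> G2 g -> g2 (c *: (invmx g *m D *m g)).
Proof.
move=> /g2P gD Gg x y; rewrite !octmulE -!scalemxAr !omulZl !omulZr -scalerDr; congr (_ *: _).
have Gg' := G2_inv Gg; rewrite !mulmxA -(G2_omul _ _ Gg') gD.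
by rewrite mulmxDl -!(G2_omul _ _ Gg) !mulmxKV // G2_unit.
Qed.

Lemma invmx_mul n (M N : 'M[K]_n) : M \in unitmx -> N \in unitmx ->
  invmx (M *m N) = invmx N *m invmx M.
Proof.
move=> uM uN; have uMN : M *m N \in unitmx by rewrite unitmx_mul uM.
apply: (can_inj (mulmxK uMN)).
by rewrite mulVmx // !mulmxA mulmxKV // mulVmx.
Qed.

Lemma orbit_cone_orbit (D g : 'M[K]_8) c : c != 0 -> G2 g ->
  orbit_cone (c *: (invmx g *m D *m g)) = orbit_cone D.
Proof.
move=> c0 Gg; have ug := G2_unit Gg.
apply/seteqP; split=> _ [b [h [Gh ->]]]; have uh := G2_unit Gh.
  exists (b * c), (g *m h); split; first exact: G2_mul.
  rewrite -scalemxAr -scalemxAl scalerA; congr (mxvec (_ *: _)).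
  by rewrite invmx_mul // !mulmxA.
exists (b / c), (invmx g *m h); split; first by apply: G2_mul => //; apply: G2_inv.
rewrite -scalemxAr -scalemxAl scalerA divfK //; congr (mxvec (_ *: _)).
by rewrite invmx_mul ?unitmx_inv // invmxK !mulmxA !mulmxK.
Qed.

Definition adjoint_cone : set 'rV[K]_(8 * 8) := [set w | exists D : 'M[K]_8,
  [/\ w = mxvec D, g2 D, D != 0 & zariski_closed (orbit_cone D)]].

Lemma adjoint_coneP w : adjoint_cone w <-> orbit_cone D0 w /\ w != 0.
Proof.
split=> [[D [-> gD nzD clD]]|[[c [g [Gg ->]]] nzw]].
  split; first exact: closed_orbit_highest.
  by rewrite mxvec_eq0.
have c0 : c != 0 by apply: contraNneq nzw => ->; rewrite scale0r linear0.
exists (c *: (invmx g *m D0 *m g)); split => //; first exact: g2_conj g2_highest Gg.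
  by apply: contraNneq nzw => ->; rewrite linear0.
by rewrite orbit_cone_orbit //; apply: orbit_closed.
Qed.

(** The cone of the definition omits the origin. A polynomial vanishing on a punctured line of the
    cone also vanishes at 0, [K] being infinite. *)
Lemma adjoint_vanishing p : vanishing_ideal adjoint_cone p ->
  vanishing_ideal (orbit_cone D0) p.
Proof.
move=> Cp w Ow; have [->|nzw] := eqVneq w 0; last first.
  by apply: Cp; apply/adjoint_coneP.
have pF := polyfun_comp p (fun i : 'I_(8 * 8) =>
  polyfunM (@polyfun_coord K 1 0) (@polyfun_const K 1 (mxvec D0 0 i))).
have := polyfun_eq0 K_infinite (i0 := 0) pF _ (fun=> 0 : K^o).
rewrite mmap_regular => E.
rewrite -[RHS]E => [|v v0].
  by apply: meval_eq => i; rewrite mxE mul0r.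
rewrite mmap_regular.
have := Cp (v 0 *: mxvec D0) => /= <-.
  by apply: meval_eq => i; rewrite mxE; congr (_ * _); apply: mulr1.
apply/adjoint_coneP; split; last first.
  by rewrite scaler_eq0 negb_or v0 mxvec_eq0 highest_neq0.
exists (v 0), 1%:M; split; first exact: G2_1.
by rewrite invmx1 mul1mx mulmx1 linearZ.
Qed.

End ClosedOrbit.

(** * Null planes and the adjoint variety *)

Section BivectorLines.

Variable A : comNzRingType.
Implicit Types (x y z : 'rV[A]_8) (U : set 'rV[A]_8) (L : set 'rV[A]_(8 * 8)).

Definition so_vec x y : 'rV[A]_(8 * 8) := mxvec (so_mx x y).

Lemma so_vecDl x x' y : so_vec (x + x') y = so_vec x y + so_vec x' y.
Proof. by rewrite /so_vec /so_mx wedgeDl mulmxDr linearD. Qed.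

Lemma so_vecDr x y y' : so_vec x (y + y') = so_vec x y + so_vec x y'.
Proof. by rewrite /so_vec /so_mx wedgeDr mulmxDr linearD. Qed.

Lemma so_vecZ a b x y : so_vec (a *: x) (b *: y) = (a * b) *: so_vec x y.
Proof. by rewrite /so_vec /so_mx wedgeZ -scalemxAr linearZ. Qed.

Lemma so_vecZl a x y : so_vec (a *: x) y = a *: so_vec x y.
Proof. by rewrite -{1}[y]scale1r so_vecZ mulr1. Qed.

Lemma so_vecZr a x y : so_vec x (a *: y) = a *: so_vec x y.
Proof. by rewrite -{1}[x]scale1r so_vecZ mul1r. Qed.

Lemma so_vec_comb a b c d x y :
  so_vec (a *: x + b *: y) (c *: x + d *: y) = (a * d - b * c) *: so_vec x y.
Proof. by rewrite /so_vec /so_mx wedge_comb -scalemxAr linearZ. Qed.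

Lemma so_vec0l y : so_vec 0 y = 0.
Proof. by have := so_vecZl 0 0 y; rewrite !scale0r. Qed.

Lemma so_vec0r x : so_vec x 0 = 0.
Proof. by have := so_vecZr 0 x 0; rewrite !scale0r. Qed.

Lemma so_vec_span (S : set 'rV[A]_8) (V : set 'rV[A]_(8 * 8)) : is_submodule V ->
  (forall x y, S x -> S y -> V (so_vec x y)) ->
  forall x y, lspan S x -> lspan S y -> V (so_vec x y).
Proof.
move=> sV VS x y Sx Sy.
have Vl z : S z -> V (so_vec x z).
  move=> Sz; suff : lspan S `<=` [set x | V (so_vec x z)] by apply.
  apply: span_min => [|u Su]; last exact: VS.
  split=> [|a u v /= Vu Vv]; first by rewrite /= so_vec0l; apply: (submod0 sV).
  by rewrite so_vecDl so_vecZl; apply: sV.2.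
suff : lspan S `<=` [set y | V (so_vec x y)] by apply.
apply: span_min => [|u Su]; last exact: Vl.
split=> [|a u v /= Vu Vv]; first by rewrite /= so_vec0r; apply: (submod0 sV).
by rewrite so_vecDr so_vecZr; apply: sV.2.
Qed.

(** The Plücker embedding, followed by the identification of bivectors with skew endomorphisms. *)
Definition plane_line U : set 'rV[A]_(8 * 8) :=
  lspan [set w | exists x y, [/\ U x, U y & w = so_vec x y]].

Definition bivector (l : 'rV[A]_(8 * 8)) : 'M[A]_8 := gram A *m vec_mx l.

(** The plane of a decomposable bivector is its row space. *)
Definition line_plane L : set 'rV[A]_8 :=
  lspan [set w | exists z l, L l /\ w = z *m bivector l].

Lemma bivector_so x y : bivector (so_vec x y) = wedge x y.
Proof. by rewrite /bivector mxvecK /so_mx mulmxA gramK mul1mx. Qed.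

Lemma bivectorK l : mxvec (gram A *m bivector l) = l.
Proof. by rewrite mulmxA gramK mul1mx vec_mxK. Qed.

Lemma bivectorZ a l : bivector (a *: l) = a *: bivector l.
Proof. by rewrite /bivector linearZ -scalemxAr. Qed.

Lemma bivectorD l l' : bivector (l + l') = bivector l + bivector l'.
Proof. by rewrite /bivector linearD mulmxDr. Qed.

Lemma bivector_entry l a b : bivector l a b = \sum_c gram A a c * l 0 (mxvec_index c b).
Proof. by rewrite [LHS]mxE; apply: eq_bigr => c _; congr (_ * _); rewrite mxE. Qed.

Lemma entry_bivector (l : 'rV[A]_(8 * 8)) (c b : 'I_8) : l 0 (mxvec_index c b) = \sum_a gram A c a * bivector l a b.
Proof. by rewrite -{1}[l]bivectorK mxvecE mxE. Qed.

Lemma rank2_span m n (M : 'M[A]_(m, n)) p q a b (u : 'rV[A]_n) : constant_rank 2 M ->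
  row_space M u -> minor2 M p q a b *: u =
  (u 0 a * M q b - u 0 b * M q a) *: row p M + (M p a * u 0 b - M p b * u 0 a) *: row q M.
Proof.
move=> rM /row_spaceP[c ->]; rewrite scaler_sumr.
under eq_bigr => i _ do rewrite scalerA mulrC -scalerA rank2_row // scalerDr !scalerA.
have ua d : (\sum_i c i *: row i M) 0 d = \sum_i c i * M i d.
  by rewrite summxE; apply: eq_bigr => i _; rewrite !mxE.
rewrite big_split /= -!scaler_suml !ua; congr (_ *: _ + _ *: _).
  by rewrite !mulr_suml -sumrB; apply: eq_bigr => i _; rewrite /minor2; ring.
by rewrite !mulr_sumr -sumrB; apply: eq_bigr => i _; rewrite /minor2; ring.
Qed.

Lemma rank1_span n (N : 'M[A]_(n, 8 * 8)) i e l : constant_rank 1 N ->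
  row_space N l -> N i e *: l = l 0 e *: row i N.
Proof.
move=> rN /row_spaceP[c ->]; rewrite scaler_sumr.
under eq_bigr => k _ do rewrite scalerA mulrC -scalerA rank1_row // scalerA.
rewrite -!scaler_suml summxE; congr (_ *: _).
by apply: eq_bigr => k _; rewrite !mxE.
Qed.

Lemma rank1_bivector n (N : 'M[A]_(n, 8 * 8)) k a b l : constant_rank 1 N ->
  row_space N l -> bivector (row k N) a b *: l = bivector l a b *: row k N.
Proof.
move=> rN Nl; rewrite !bivector_entry !scaler_suml; apply: eq_bigr => c _.
by rewrite -!scalerA; congr (_ *: _); rewrite -rank1_span // mxE.
Qed.

Lemma rank1_bivector_unit n (N : 'M[A]_(n, 8 * 8)) (J : set A) :
  constant_rank 1 N -> is_ideal J ->
  (forall k a b, exists e, J (bivector (row k N) a b ^+ e)) -> J 1.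
Proof.
move=> rN idJ JX; apply: (rank1_unit rN idJ) => i e.
case/mxvec_indexP: e => c b.
have := entry_bivector (row i N) c b; rewrite mxE => ->.
apply: (ideal_sum (radical_ideal idJ)) => a _.
exact: (idealMl (radical_ideal idJ)).
Qed.

Section PlaneToLine.

Variables (m : nat) (M : 'M[A]_(m, 8)).
Hypothesis rM : constant_rank 2 M.

Definition line_mx : 'M[A]_(#|{: 'I_m * 'I_m}|, 8 * 8) :=
  \matrix_k so_vec (row (enum_val k).1 M) (row (enum_val k).2 M).

Lemma plane_line_row_space : plane_line (row_space M) = row_space line_mx.
Proof.
apply: row_space_span => [k|_ [x [y [Mx My ->]]]].
  exists (row (enum_val k).1 M), (row (enum_val k).2 M).
  by split; try apply: row_space_row; rewrite rowK.
have MS z : row_space M z -> lspan [set row i M | i in setT] z.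
  move=> /row_spaceP[c ->]; apply: (submod_sum (span_submodule _)) => i _.
  apply: (submodZ (span_submodule _)).
  by apply: mem_span; exists i.
apply: (so_vec_span (row_space_submodule _)) (MS _ Mx) (MS _ My) => _ _ [i _ <-] [j _ <-].
have := row_space_row line_mx (enum_rank (i, j)).
by rewrite rowK enum_rankK.
Qed.

(* The 2 x 2 minors of M are the coordinates of the x /\ y, for x, y rows. *)
Lemma so_vec_minor p q a b x y : row_space M x -> row_space M y ->
  exists c, minor2 M p q a b ^+ 2 *: so_vec x y = c *: so_vec (row p M) (row q M).
Proof.
move=> Mx My; rewrite expr2 -so_vecZ !(rank2_span _ _ _ _ rM) // so_vec_comb.
by eexists.
Qed.

Lemma line_mx_rank : constant_rank 1 line_mx.
Proof.
apply: constant_rank1P => [k k' a b|J idJ JW].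
  pose J := [set t | t * minor2 line_mx k k' a b = 0].
  have idJ : is_ideal J.
    split=> [|t x y /= Jx Jy]; first by rewrite /J /= mul0r.
    by rewrite /J /= mulrDl -mulrA Jx Jy mulr0 addr0.
  suff : J 1 by rewrite /J /= mul1r.
  (* Each of the two rows of [line_mx] costs the square of a minor to become a multiple of the same
     bivector; two proportional rows have zero minors. *)
  apply: (rank2_unit rM idJ) => p q c d; exists 4%N; rewrite /J /=.
  have [e E] := so_vec_minor p q c d (row_space_row M (enum_val k).1)
    (row_space_row M (enum_val k).2).
  have [e' E'] := so_vec_minor p q c d (row_space_row M (enum_val k').1)
    (row_space_row M (enum_val k').2).
  have Wk h f : minor2 M p q c d ^+ 2 * line_mx h f =
      (minor2 M p q c d ^+ 2 *: so_vec (row (enum_val h).1 M) (row (enum_val h).2 M)) 0 f.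
    by rewrite [RHS]mxE; congr (_ * _); rewrite [LHS]mxE.
  rewrite /minor2 -/(minor2 M p q c d).
  transitivity ((minor2 M p q c d ^+ 2 * line_mx k a) * (minor2 M p q c d ^+ 2 * line_mx k' b) -
    (minor2 M p q c d ^+ 2 * line_mx k b) * (minor2 M p q c d ^+ 2 * line_mx k' a)).
    by ring.
  by rewrite !Wk E E' !mxE; ring.
apply: (rank2_unit rM idJ) => i j a b; exists 1%N; rewrite expr1.
have -> : minor2 M i j a b = bivector (so_vec (row i M) (row j M)) a b.
  by rewrite bivector_so wedgeE !mxE /minor2; ring.
rewrite bivector_entry; apply: (ideal_sum idJ) => c _; apply: (idealMl idJ).
have := JW (enum_rank (i, j)) (mxvec_index c b).
by rewrite !mxE enum_rankK.
Qed.

End PlaneToLine.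

Section LineToPlane.

Variables (n : nat) (N : 'M[A]_(n, 8 * 8)).
Hypotheses (rN : constant_rank 1 N)
           (minN : forall l, row_space N l -> minimal (bivector l)).

Definition plane_mx : 'M[A]_(#|{: 'I_n * 'I_8}|, 8) :=
  \matrix_k row (enum_val k).2 (bivector (row (enum_val k).1 N)).

Lemma line_plane_row_space : line_plane (row_space N) = row_space plane_mx.
Proof.
have sV := row_space_submodule plane_mx.
apply: row_space_span => [k|_ [z [l [Nl ->]]]].
  exists (delta_mx 0 (enum_val k).2), (row (enum_val k).1 N).
  by split; rewrite ?rowK -?rowE //; apply: row_space_row.
have /row_spaceP[c ->] := Nl.
have -> : bivector (\sum_i c i *: row i N) = \sum_i c i *: bivector (row i N).
  by rewrite /bivector linear_sum mulmx_sumr; apply: eq_bigr => i _; rewrite linearZ -scalemxAr.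
rewrite mulmx_sumr; apply: (submod_sum sV) => i _; rewrite -scalemxAr.
apply: (submodZ sV); rewrite mulmx_sum_row; apply: (submod_sum sV) => a _.
apply: (submodZ sV); have := row_space_row plane_mx (enum_rank (i, a)).
by rewrite rowK enum_rankK.
Qed.

Lemma mul_wedge z x y :
  z *m wedge x y = (z *m x^T) 0 0 *: y - (z *m y^T) 0 0 *: x.
Proof.
rewrite mulmxBr !mulmxA; congr (_ - _);
  by apply/rowP => j; rewrite [LHS]mxE big_ord1 [RHS]mxE.
Qed.

(** One factor [X a b] replaces [l] by a multiple of the row [k] of [N]; the other writes
    [X a b *: X] as the wedge of two rows of [X], whose image is spanned by these rows. *)
Lemma bivector_square k a b l z : row_space N l ->
  exists c d, bivector (row k N) a b ^+ 2 *: (z *m bivector l) =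
  c *: row a (bivector (row k N)) + d *: row b (bivector (row k N)).
Proof.
move=> Nl; set X := bivector (row k N).
have mX : minimal X by apply/minN/row_space_row.
exists (- (bivector l a b * (z *m (row b X)^T) 0 0)), (bivector l a b * (z *m (row a X)^T) 0 0).
have E1 : X a b *: (z *m bivector l) = bivector l a b *: (z *m X).
  by rewrite scalemxAr -bivectorZ rank1_bivector // bivectorZ -scalemxAr.
have E2 : X a b *: (z *m X) = (z *m (row a X)^T) 0 0 *: row b X
    - (z *m (row b X)^T) 0 0 *: row a X.
  by rewrite scalemxAr -(minimal_wedge_rows a b mX) mul_wedge.
transitivity (bivector l a b *: (X a b *: (z *m X))).
  by rewrite expr2 -scalerA E1 !scalerA mulrC.
rewrite E2.
by rewrite scalerBr !scalerA scaleNr addrC.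
Qed.

Lemma plane_mx_rank : constant_rank 2 plane_mx.
Proof.
apply: constant_rank2P => [i j k a b c|J idJ JV].
  set t := (X in X = 0); pose J := [set s | s * t = 0].
  have idJ : is_ideal J.
    split=> [|s x y /= Jx Jy]; first by rewrite /J /= mul0r.
    by rewrite /J /= mulrDl -mulrA Jx Jy mulr0 addr0.
  suff : J 1 by rewrite /J /= mul1r.
  (* Two factors for each of the three rows of the minor, which then all lie in the span of the same
     two vectors. *)
  apply: (rank1_bivector_unit rN idJ) => h p q; exists 6%N; rewrite /J /= /t.
  set e := bivector _ p q.
  have row_comb f : exists c d, forall g, e ^+ 2 * plane_mx f g =
      c * (bivector (row h N)) p g + d * (bivector (row h N)) q g.
    have [c' [d' E]] := bivector_square h p q (delta_mx 0 (enum_val f).2)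
      (row_space_row N (enum_val f).1).
    exists c', d' => g.
    transitivity ((e ^+ 2 *: ((delta_mx 0 (enum_val f).2 : 'rV_8) *m bivector (row (enum_val f).1 N))) 0 g).
      by rewrite -rowE [RHS]mxE; congr (_ * _); rewrite [LHS]mxE.
    by rewrite E [LHS]mxE; congr (_ + _); rewrite [LHS]mxE; congr (_ * _); rewrite [LHS]mxE.
  have [ci [di Ei]] := row_comb i; have [cj [dj Ej]] := row_comb j.
  have [ck [dk Ek]] := row_comb k.
  transitivity (let V f g := e ^+ 2 * plane_mx f g in
    V i a * (V j b * V k c - V j c * V k b) - V i b * (V j a * V k c - V j c * V k a)
    + V i c * (V j a * V k b - V j b * V k a)); first by rewrite /=; ring.
  by rewrite /= !Ei !Ej !Ek; ring.
apply: (rank1_bivector_unit rN idJ) => k a b; exists 2%N.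
have [[skew diag _ _ _] _ _] := minN (row_space_row N k).
have := JV (enum_rank (k, a)) (enum_rank (k, b)) a b.
have VE f g : plane_mx (enum_rank (k, f)) g = bivector (row k N) f g.
  by rewrite mxE enum_rankK mxE.
rewrite /minor2 !VE diag mul0r sub0r; congr J.
have -> : bivector (row k N) b a = - bivector (row k N) a b.
  by apply/eqP; rewrite -addr_eq0 skew.
by rewrite mulrN opprK expr2.
Qed.

End LineToPlane.

End BivectorLines.

(** * Null planes and the adjoint variety over an arbitrary algebra *)

Section AdjointVariety.

Variable K : fieldType.
Hypotheses (K2 : 2%:R != 0 :> K) (K3 : 3%:R != 0 :> K).
Hypothesis K_infinite : forall s : seq K, exists x, x \notin s.

Definition null_planes : points K 8 := fun A => [set U | grassmannian 2 U /\
  (forall u, U u -> otrace u = 0) /\ (forall u v, U u -> U v -> omul u v = 0)].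

Arguments null_planes : clear implicits.

Variable A : comAlgType K.

Lemma null_plane_special (U : set 'rV[A]_8) x y : null_planes A U -> U x -> U y -> special x y.
Proof. by move=> [_ [tU mU]] Ux Uy; split; rewrite ?tU ?mU. Qed.

Lemma G2_mod_P2_minimal (L : set 'rV[A]_(8 * 8)) l : G2_mod_P2 K A L -> L l ->
  minimal (bivector l).
Proof.
move=> [_ vanL] Ll; have Cmin w : adjoint_cone w -> minimal (gram K *m vec_mx w).
  by move/(adjoint_coneP K2 K3 K_infinite)=> [/(orbit_minimal K2 K3)].
by apply: (minimal_of_vanishing Cmin) => p Cp; apply: vanL.
Qed.

Lemma line_plane_null (L : set 'rV[A]_(8 * 8)) : G2_mod_P2 K A L -> null_planes A (line_plane L).
Proof.
move=> gL; have minL l := G2_mod_P2_minimal (l := l) gL.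
have [[n [N [rN defL]]] _] := gL; rewrite defL in minL *.
split; first by exists _, (plane_mx N); rewrite line_plane_row_space; split=> //; apply: plane_mx_rank.
have trS : is_submodule [set x : 'rV[A]_8 | otrace x = 0].
  split=> [|a x y /= tx ty]; first by rewrite /= /otrace !co0 addr0.
  by rewrite /otrace !coD !coZ addrACA -mulrDr -!/(otrace _) tx ty mulr0 addr0.
split.
  apply: (span_min trS) => _ [z [l [Nl ->]]] /=; rewrite mulmx_sum_row.
  by apply: (submod_sum trS) => a _; apply: (submodZ trS); apply/minimal_row/minL.
have annl y : is_submodule [set x : 'rV[A]_8 | omul x y = 0].
  split=> [|a x x' /= xy x'y]; first exact: omul0l.
  by rewrite omulDl omulZl xy x'y scaler0 addr0.
have annr x : is_submodule [set y : 'rV[A]_8 | omul x y = 0].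
  split=> [|a y y' /= xy xy']; first exact: omul0r.
  by rewrite omulDr omulZr xy xy' scaler0 addr0.
move=> u v Uu Uv; move: u Uu.
suff : line_plane (row_space N) `<=` [set x | omul x v = 0] by apply.
apply: (span_min (annl v)) => _ [z [l [Nl ->]]] /=; move: v Uv.
suff : line_plane (row_space N) `<=` [set y | omul (z *m bivector l) y = 0] by apply.
apply: (span_min (annr _)) => _ [z' [l' [Nl' ->]]] /=.
pose J := [set t | t *: omul (z *m bivector l) (z' *m bivector l') = 0].
have idJ : is_ideal J by apply: (conductor_ideal (zero_submodule _)).
suff : J 1 by rewrite /J /= scale1r.
apply: (rank1_bivector_unit rN idJ) => k a b; exists 4%N; rewrite /J /=.
have [c [d E]] := bivector_square rN minL k a b z Nl.
have [c' [d' E']] := bivector_square rN minL k a b z' Nl'.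
have -> : bivector (row k N) a b ^+ 4 = bivector (row k N) a b ^+ 2 * bivector (row k N) a b ^+ 2.
  by rewrite -exprD.
rewrite -scalerA -omulZr E' -omulZl E.
have sXX := minimal_special a b (minL _ (row_space_row N k)).
by have [_ _ _ _ []] := special_comb c d c' d' sXX.
Qed.

Lemma plane_lineK (U : set 'rV[A]_8) : null_planes A U -> line_plane (plane_line U) = U.
Proof.
move=> nU; have [[m [M [rM defU]]] _] := nU.
have sU : is_submodule U by rewrite defU; apply: row_space_submodule.
have sV := @span_submodule A 'rV[A]_8.
apply/seteqP; split.
  apply: (span_min sU) => _ [z [l [Ul ->]]].
  move: l Ul; suff : plane_line U `<=` [set l | U (z *m bivector l)] by apply.
  apply: span_min => [|_ [x [y [Ux Uy ->]]] /=].
    split=> [|a u v /= Vu Vv]; first by rewrite /= -(scale0r (0 : 'rV_(8 * 8))) bivectorZ scale0r mulmx0; apply: (submod0 sU).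
    by rewrite bivectorD bivectorZ mulmxDr -scalemxAr; apply: sU.2.
  by rewrite bivector_so mul_wedge; apply: (submodB sU); apply: (submodZ sU).
move=> u Uu; pose J := [set t | line_plane (plane_line U) (t *: u)].
have idJ : is_ideal J by apply: conductor_ideal; apply: sV.
suff : J 1 by rewrite /J /= scale1r.
apply: (rank2_unit rM idJ) => p q a b; exists 2%N; rewrite /J /=.
set x := row p M; set y := row q M.
have Ux : U x by rewrite defU; apply: row_space_row.
have Uy : U y by rewrite defU; apply: row_space_row.
(* Contractions of the bivector with basis vectors. The two with indices [a] and [b] give the minor
   times [x] and times [y]; expressing [u] by [x] and [y] costs a second minor. *)
have Vc c : line_plane (plane_line U) (x 0 c *: y - y 0 c *: x).
  apply: mem_span; exists (delta_mx 0 c), (so_vec x y); split.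
    by apply: mem_span; exists x, y.
  rewrite bivector_so mul_wedge; congr (_ *: _ - _ *: _);
    by rewrite -rowE [RHS]mxE [RHS]mxE.
have Vy : line_plane (plane_line U) (minor2 M p q a b *: y).
  have -> : minor2 M p q a b *: y = y 0 b *: (x 0 a *: y - y 0 a *: x) - y 0 a *: (x 0 b *: y - y 0 b *: x).
    by apply/rowP => j; rewrite /x /y !mxE /minor2; ring.
  by apply: (submodB (sV _)); apply: (submodZ (sV _)); apply: Vc.
have Vx : line_plane (plane_line U) (minor2 M p q a b *: x).
  have -> : minor2 M p q a b *: x = x 0 b *: (x 0 a *: y - y 0 a *: x) - x 0 a *: (x 0 b *: y - y 0 b *: x).
    by apply/rowP => j; rewrite /x /y !mxE /minor2; ring.
  by apply: (submodB (sV _)); apply: (submodZ (sV _)); apply: Vc.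
have Mu : row_space M u by rewrite -defU.
rewrite expr2 -scalerA (rank2_span p q a b rM Mu) scalerDr !scalerA.
by apply: (submodD (sV _)); rewrite mulrC -scalerA; apply: (submodZ (sV _)).
Qed.

Lemma line_planeK (L : set 'rV[A]_(8 * 8)) : G2_mod_P2 K A L -> plane_line (line_plane L) = L.
Proof.
move=> gL; have minL l := G2_mod_P2_minimal (l := l) gL.
have [[n [N [rN defL]]] _] := gL; rewrite defL in minL *.
have sL := row_space_submodule N.
have sV := @span_submodule A 'rV[A]_(8 * 8).
apply/seteqP; split.
  apply: (span_min sL) => _ [x [y [Lx Ly ->]]].
  move: x y Lx Ly; apply: (so_vec_span sL) => _ _ [z [l [Nl ->]]] [z' [l' [Nl' ->]]].
  pose J := [set t | row_space N (t *: so_vec (z *m bivector l) (z' *m bivector l'))].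
  have idJ : is_ideal J by apply: conductor_ideal.
  suff : J 1 by rewrite /J /= scale1r.
  apply: (rank1_bivector_unit rN idJ) => k a b; exists 4%N; rewrite /J /=.
  have [c [d E]] := bivector_square rN minL k a b z Nl.
  have [c' [d' E']] := bivector_square rN minL k a b z' Nl'.
  have -> : bivector (row k N) a b ^+ 4 = bivector (row k N) a b ^+ 2 * bivector (row k N) a b ^+ 2.
    by rewrite -exprD.
  rewrite -so_vecZ E E' so_vec_comb; apply: (submodZ sL).
  rewrite /so_vec /so_mx minimal_wedge_rows; last by apply/minL/row_space_row.
  by rewrite -scalemxAr linearZ /= bivectorK; apply: (submodZ sL); apply: row_space_row.
move=> l Nl; pose J := [set t | plane_line (line_plane (row_space N)) (t *: l)].
have idJ : is_ideal J by apply: conductor_ideal; apply: sV.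
suff : J 1 by rewrite /J /= scale1r.
apply: (rank1_bivector_unit rN idJ) => k a b; exists 2%N; rewrite /J /=.
set X := bivector (row k N).
have mX : minimal X by apply/minL/row_space_row.
rewrite expr2 -scalerA (rank1_bivector k a b rN Nl) scalerA mulrC -scalerA.
apply: (submodZ (sV _)).
have -> : X a b *: row k N = so_vec (row a X) (row b X).
  by rewrite /so_vec /so_mx minimal_wedge_rows // -scalemxAr linearZ /= bivectorK.
apply: mem_span; exists (row a X), (row b X); split=> //; apply: mem_span.
  by exists (delta_mx 0 a), (row k N); split; [exact: row_space_row | rewrite -rowE].
by exists (delta_mx 0 b), (row k N); split; [exact: row_space_row | rewrite -rowE].
Qed.

Lemma special_extend (g : 'M[K]_8) (x y : 'rV[A]_8) : G2 g -> special x y ->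
  special (x *m extend A g) (y *m extend A g).
Proof.
move=> Gg [tx ty xx yy [xy yx]].
by split; rewrite ?extend_otrace ?extend_omul // ?(xx, yy, xy, yx) mul0mx.
Qed.

Lemma polymx_so_vec n (x y : forall B : comAlgType K, ('I_n -> B) -> 'rV[B]_8) :
  polymx x -> polymx y -> polymx (fun B v => so_vec (x B v) (y B v)).
Proof.
move=> px py; suff pE : polymx (fun B v => mxvec (extend B (gram K) *m
    ((x B v)^T *m y B v - (y B v)^T *m x B v))).
  by move=> i j; have [p Fp] := pE i j; exists p => B v; rewrite -Fp /extend map_gram.
apply: polymx_mxvec; apply: polymxM (polymx_const _ _) _.
by apply: polymxB; apply: polymxM => //; apply: polymx_tr.
Qed.

Lemma polymx_row8 n (F0 F1 F2 F3 F4 F5 F6 F7 : forall B : comAlgType K, ('I_n -> B) -> B) :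
  polyfun F0 -> polyfun F1 -> polyfun F2 -> polyfun F3 -> polyfun F4 -> polyfun F5 -> polyfun F6 -> polyfun F7 ->
  polymx (fun B v => row_of 8 [:: F0 B v; F1 B v; F2 B v; F3 B v; F4 B v; F5 B v; F6 B v; F7 B v]).
Proof.
move=> p0 p1 p2 p3 p4 p5 p6 p7 i j.
suff pj : polyfun (nth F0 [:: F0; F1; F2; F3; F4; F5; F6; F7] j).
  have [p Fp] := pj; exists p => B v; rewrite mxE -Fp.
  by case: j {pj Fp} => [] [|[|[|[|[|[|[|[|]]]]]]]].
by case: j => [] [|[|[|[|[|[|[|[|]]]]]]]].
Qed.

(* On the translate of the big cell by g, where the coordinate e is invertible. *)
Lemma vanishing_cell (p : {mpoly K[8 * 8]}) (g : 'M[K]_8) (x y : 'rV[A]_8) :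
  vanishing_ideal (@adjoint_cone K) p -> G2 g -> special x y ->
  let e := mc (congr_mx (extend A g) (wedge x y)) 1 5 in
  forall t, mmap (in_alg A) (((t * e ^+ 5) *: so_vec x y) 0) p = 0.
Proof.
move=> Cp Gg sxy e t; set g' := invmx g.
have Gg' : G2 g' by apply: G2_inv.
have {}Cp := adjoint_vanishing K2 K3 K_infinite Cp.
pose F (B : comAlgType K) (v : 'I_7 -> B) : 'rV[B]_(8 * 8) := v 0 *: so_vec
  (cell_x (v 1) (v 2) (v 3) (v 4) (v 5) *m extend B g')
  (cell_y (v 1) (v 2) (v 3) (v 4) (v 5) (v 6) *m extend B g').
have pF : polymx F.
  have pc := @polyfun_coord K 7.
  suff pS : polymx (fun B (v : 'I_7 -> B) => so_vec
    (cell_x (v 1) (v 2) (v 3) (v 4) (v 5) *m extend B g')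
    (cell_y (v 1) (v 2) (v 3) (v 4) (v 5) (v 6) *m extend B g')).
    move=> i j; have [q Fq] := polyfunM (pc 0) (pS i j).
    by exists q => B v; rewrite mxE Fq.
  apply: polymx_so_vec; apply: polymxM (polymx_const _ _); apply: polymx_row8;
  by do ![exact: polyfun0 | apply: polyfunD | apply: polyfunN | apply: polyfunM
    | apply: polyfunX | exact: pc].
have F0 (B : comAlgType K) (v : 'I_7 -> B) : mmap (in_alg B) (F B v 0) p = 0.
  (* It suffices to test at [K]-points with nonzero cell coordinate [v 1]; there the vector is a
     multiple of the bivector of a translated highest pair. *)
  move: B v; apply: (polyfun_eq0 K_infinite (i0 := 1) (polyfun_comp p (fun k => pF 0 k))) => v v0.
  rewrite mmap_regular; apply: Cp.
  have [h Gh [Ex Ey]] := cell_highest (v 2) (v 3) (v 4) (v 5) (v 6) v0.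
  rewrite /F Ex Ey extend_regular -!scalemxAl.
  rewrite so_vecZ scalerA.
  pose c := v 0 * (v 1 ^+ 2 * v 1 ^+ 2).
  have := @orbit_cone_special K K2 K3 (highest_x K *m h *m g') (highest_y K *m h *m g') c.
  rewrite linearZ; apply; apply: special_G2 => //; apply: special_G2 => //.
  exact: special_highest.
set x' := x *m extend A g; set y' := y *m extend A g.
have g'K (z : 'rV[A]_8) : z *m extend A g *m extend A g' = z.
  by rewrite -mulmxA -extendM mulmxV ?G2_unit // /extend map_mx1 mulmx1.
pose xh := co y' 5 *: x' + (- co x' 5) *: y'.
pose yh := (- co y' 1) *: x' + co x' 1 *: y'.
have eE : e = co x' 1 * co y' 5 - co y' 1 * co x' 5 by rewrite /e congr_wedge mc_wedge.
have sh : special xh yh by apply/special_comb/special_extend.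
have [||||Ex Ey] := special_cell (d := e) sh.
- by rewrite /xh coD !coZ eE; ring.
- by rewrite /xh coD !coZ; ring.
- by rewrite /yh coD !coZ; ring.
- by rewrite /yh coD !coZ eE; ring.
(* The scale [t * e ^+ 2] gives each cell vector the factor [e] that [special_cell] asks for. This
   returns [e ^+ 4], and the adjugate change of basis contributes the fifth power. *)
pose v (k : 'I_7) : A := nth 0 [:: t * e ^+ 2; e; co xh 0; co yh 0; co xh 2; co xh 3; co yh 6] k.
rewrite -[RHS](F0 A v); congr (mmap _ _ p); congr (fun_of_matrix _ 0).
rewrite /F /v /= -[RHS]scalerA [in RHS]expr2 -[(e * e) *: _]so_vecZ !scalemxAl Ex Ey -!scalemxAl [so_vec (_ *: _) _]so_vecZ.
have -> : so_vec (xh *m extend A g') (yh *m extend A g') = e *: so_vec x y.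
  rewrite /xh /yh !mulmxDl -!scalemxAl !g'K so_vec_comb eE; congr (_ *: _); ring.
rewrite !scalerA; congr (_ *: _); ring.
Qed.

(** A multiplier cannot be pulled out of an inhomogeneous polynomial, so [p] is restricted to the
    line through [l]. If it vanishes on all multiples of [s *: l], then [s ^+ d] kills the
    coefficient of degree [d]; the ideal argument applies to each coefficient separately. *)
Lemma plane_line_G2 (U : set 'rV[A]_8) : null_planes A U -> G2_mod_P2 K A (plane_line U).
Proof.
move=> nU; have [[m [M [rM defU]]] _] := nU.
have ELU : plane_line U = row_space (line_mx M) by rewrite defU plane_line_row_space.
split; first by exists _, (line_mx M); split=> //; apply: line_mx_rank.
move=> p l Cp Ul; have [P defP] := mmap_scale (l 0) p.
have -> : mmap (in_alg A) (l 0) p = P.[1].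
  by rewrite -defP; congr (mmap _ _ p); apply: funext => i; rewrite mul1r.
suff -> : P = 0 by rewrite horner0.
apply/polyP => d; rewrite coef0; pose J := [set t | t * P`_d = 0].
have idJ : is_ideal J.
  split=> [|t x y /= Jx Jy]; first by rewrite /J /= mul0r.
  by rewrite /J /= mulrDl -mulrA Jx Jy mulr0 addr0.
suff : J 1 by rewrite /J /= mul1r.
apply: (rank2_unit rM idJ) => i j a b.
set e := minor2 M i j a b ^+ 2.
have [c Ec] : exists c, e *: l = c *: so_vec (row i M) (row j M).
  have sV : is_submodule [set l : 'rV[A]_(8 * 8) | exists c, e *: l = c *: so_vec (row i M) (row j M)].
    split=> [|r v w /= [c Ec] [c' Ec']]; first by exists 0; rewrite scaler0 scale0r.
    by exists (r * c + c'); rewrite scalerDr scalerDl -Ec' -[(r * c) *: _]scalerA -Ec !scalerA mulrC.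
  suff : plane_line U `<=` [set l | exists c, e *: l = c *: so_vec (row i M) (row j M)] by apply.
  by apply: (span_min sV) => _ [x [y [Ux Uy ->]]] /=; apply: so_vec_minor; rewrite -?defU.
have Ur k : U (row k M) by rewrite defU; apply: row_space_row.
pose X := wedge (row i M) (row j M).
have sX : special (row i M) (row j M) by apply: (null_plane_special nU).
(* The factor [e ^+ d] makes [l] a multiple of the bivector of two rows; it remains to cover that
   bivector by translates of the cell. *)
pose I := [set r | r * (e ^+ d * P`_d) = 0].
have idI : is_ideal I.
  split=> [|r u v /= Iu Iv]; first by rewrite /I /= mul0r.
  by rewrite /I /= mulrDl -mulrA Iu Iv mulr0 addr0.
have rI := radical_ideal idI.
have Icover g : G2 g -> radical I (mc (congr_mx (extend A g) X) 1 5).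
  move=> Gg; set f := mc _ _ _; exists (5 * d)%N; rewrite /I /= exprM mulrA -exprMn.
  (* Here [e] turns [l] into [c] times the bivector of the rows, and [f ^+ 5] is the power for which
     vanishing on the translated cell is known, at every scale. *)
  have P0 t : P.[f ^+ 5 * e * t] = 0.
    rewrite -defP.
    have -> : (fun k => f ^+ 5 * e * t * l 0 k) = ((t * c * f ^+ 5) *: so_vec (row i M) (row j M)) 0.
      apply: funext => k; have := congr1 (fun w : 'rV[A]_(8 * 8) => w 0 k) Ec.
      rewrite mxE [RHS]mxE => Eck.
      rewrite [RHS]mxE; transitivity (f ^+ 5 * t * (e * l 0 k)); first by ring.
      by rewrite Eck; ring.
    exact: vanishing_cell.
  pose Q := \poly_(k < size P) ((f ^+ 5 * e) ^+ k * P`_k).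
  have Q0 : Q = 0.
    apply: (@horner_eq0 K K_infinite A _ [::]) => k _; rewrite -(P0 k%:A) horner_poly horner_coef.
    by apply: eq_bigr => h _; rewrite [(_ * k%:A) ^+ h]exprMn [RHS]mulrCA mulrA.
  have : Q`_d = 0 by rewrite Q0 coef0.
  by rewrite coef_poly; case: ltnP => // lePd _; rewrite nth_default ?mulr0.
have JD u v : radical I u -> radical I v -> radical I (u + v).
  exact: (idealD rI).
have JZ (k : K) u : radical I u -> radical I (k *: u).
  by move=> Iu; rewrite -mulr_algl; apply: (idealMl rI).
(* The entry [a b] of [X] is the minor itself: a power of it lies in [I], and [2 * d] further
   factors supply [e ^+ d]. *)
have [h] := coverage K2 K3 JD JZ (special_form sX) Icover a b.
have -> : X a b = minor2 M i j a b by rewrite wedgeE !mxE /minor2; ring.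
by exists (h + 2 * d)%N; rewrite /J /= exprD -mulrA [_ ^+ (2 * d)]exprM.
Qed.

End AdjointVariety.

Section Isomorphism.

Variable K : fieldType.
Hypotheses (K2 : 2%:R != 0 :> K) (K3 : 3%:R != 0 :> K).
Hypothesis K_infinite : forall s : seq K, exists x, x \notin s.

Lemma map_so_vec (A B : comNzRingType) (f : {rmorphism A -> B}) (x y : 'rV[A]_8) :
  map_mx f (so_vec x y) = so_vec (map_mx f x) (map_mx f y).
Proof.
rewrite /so_vec /so_mx /wedge !map_trmx -!map_mxM -map_mxB -(map_gram f) -map_mxM.
exact: map_mxvec.
Qed.

Lemma plane_line_base_change (A B : comNzRingType) (f : {rmorphism A -> B}) (U : set 'rV[A]_8) :
  plane_line (base_change f U) = base_change f (plane_line U).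
Proof.
have sV := @span_submodule B 'rV[B]_(8 * 8).
rewrite !base_changeE; apply/seteqP; split.
  apply: (span_min (sV _)) => _ [x [y [Ux Uy ->]]].
  apply: (so_vec_span (sV _) _ Ux Uy) => _ _ [u Uu <-] [v Uv <-].
  rewrite -map_so_vec; apply: mem_span; exists (so_vec u v) => //.
  by apply: mem_span; exists u, v.
apply: (span_min (sV _)) => _ [_ [k [c [w [Uw ->]]]] <-].
rewrite map_mx_sum; apply: (submod_sum (sV _)) => i _; rewrite map_mxZ.
apply: (submodZ (sV _)); have [x [y [Ux Uy ->]]] := Uw i; rewrite map_so_vec.
by apply: mem_span; exists (map_mx f x), (map_mx f y); split=> //; apply: mem_span;
  [exists x | exists y].
Qed.

Lemma null_planes_iso : isomorphic (@null_planes K) (G2_mod_P2 K).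
Proof.
exists (fun A => @plane_line A); split=> [A|A B f U _]; last exact: plane_line_base_change.
split=> [U nU|U V|L gL]; first exact: plane_line_G2.
  rewrite !inE => nU nV E.
  by rewrite -(plane_lineK nU) E (plane_lineK nV).
by exists (line_plane L); [apply: line_plane_null | apply: (line_planeK K2 K3)].
Qed.

End Isomorphism.

(** * Spinors *)

(** Five booleans in place of a subset of the indices: identities between spinors become 32 closed
    cases for [ring]. *)
Definition bset (b0 b1 b2 b3 b4 : bool) : {set 'I_5} :=
  [set i : 'I_5 | nth false [:: b0; b1; b2; b3; b4] i].

Lemma bset_ind (P : {set 'I_5} -> Prop) :
  (forall b0 b1 b2 b3 b4, P (bset b0 b1 b2 b3 b4)) -> forall S, P S.
Proof.
move=> PS S; pose b k := inord k \in S.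
suff -> : S = bset (b 0%N) (b 1%N) (b 2%N) (b 3%N) (b 4%N) by apply: PS.
apply/setP => i; rewrite inE -{1}(inord_val i) -/(b i).
by case: i => [] [|[|[|[|[|]]]]].
Qed.

Section BitSpinors.

Variable A : comNzRingType.

Definition bspinor : Type := bool -> bool -> bool -> bool -> bool -> A.

Definition bits (d : spinor A) : bspinor := fun b0 b1 b2 b3 b4 => d (bset b0 b1 b2 b3 b4).

Definition sgn (b : bool) (x : A) : A := if b then - x else x.

(** The nesting yields the signs: an index present in the set negates all later terms, which is the
    parity counted by [wedge_sign]. *)
Definition bclifford (v : nat -> A) (D : bspinor) : bspinor := fun b0 b1 b2 b3 b4 =>
  (if b0 then v 0%N else v 5%N) * D (~~ b0) b1 b2 b3 b4 + sgn b0 (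
  (if b1 then v 1%N else v 6%N) * D b0 (~~ b1) b2 b3 b4 + sgn b1 (
  (if b2 then v 2%N else v 7%N) * D b0 b1 (~~ b2) b3 b4 + sgn b2 (
  (if b3 then v 3%N else v 8%N) * D b0 b1 b2 (~~ b3) b4 + sgn b3 (
  (if b4 then v 4%N else v 9%N) * D b0 b1 b2 b3 (~~ b4))))).

Lemma spinorP (d d' : spinor A) :
  (forall b0 b1 b2 b3 b4, bits d b0 b1 b2 b3 b4 = bits d' b0 b1 b2 b3 b4) -> d = d'.
Proof. by move=> dd'; apply/ffunP; apply: bset_ind => *; apply: dd'. Qed.

Lemma bits_clifford v d b0 b1 b2 b3 b4 :
  bits (clifford v d) b0 b1 b2 b3 b4 = bclifford (co v) (bits d) b0 b1 b2 b3 b4.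
Proof.
rewrite /bits ffunE big_mkcond [X in _ + X]big_mkcond -big_split /=.
set S := bset _ _ _ _ _; pose b i := nth false [:: b0; b1; b2; b3; b4] i.
pose fl i := bset (b 0%N (+) (i == 0%N)) (b 1%N (+) (i == 1%N)) (b 2%N (+) (i == 2%N))
  (b 3%N (+) (i == 3%N)) (b 4%N (+) (i == 4%N)).
pose s i := (\sum_(j < 5) (b j && (j < i)) : nat)%N.
have term (i : 'I_5) : (if i \in S then wedge_sign A i S * lsubmx v 0 i * d (S :\ i) else 0) +
    (if i \in ~: S then wedge_sign A i S * rsubmx v 0 i * d (i |: S) else 0) =
    (-1) ^+ s i * ((if b i then co v i else co v (5 + i)) * d (fl i)).
  have -> : wedge_sign A i S = (-1) ^+ s i.
    rewrite /wedge_sign; congr (_ ^+ _); rewrite -sum1_card big_mkcond /=.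
    by apply: eq_bigr => j _; rewrite !inE -/(b j); case: (_ && _).
  rewrite !inE -/(b i); have -> : lsubmx v 0 i = co v i.
    by rewrite mxE (@co_val _ 9 _ _ i).
  have -> : rsubmx v 0 i = co v (5 + i) by rewrite mxE (@co_val _ 9 _ _ (5 + i)%N).
  case: ifP => bi; rewrite /= ?addr0 ?add0r -mulrA; congr (_ * (_ * d _)).
    apply/setP => j; rewrite !inE -/(b j) -[j == i](inj_eq val_inj) /= eq_sym.
    by move: bi; case: i j => [] [|[|[|[|[|]]]]] // ? [] [|[|[|[|[|]]]]] // ?; rewrite /b /= => ebi; rewrite ?ebi ?addbF ?addbT ?andbT ?orbF ?ebi.
  apply/setP => j; rewrite !inE -/(b j) -[j == i](inj_eq val_inj) /= eq_sym.
  by move: bi; case: i j => [] [|[|[|[|[|]]]]] // ? [] [|[|[|[|[|]]]]] // ?; rewrite /b /= => ebi; rewrite ?ebi ?addbF ?addbT ?andbT ?orbF ?ebi.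
rewrite (eq_bigr _ (fun i _ => term i)) !big_ord_recl big_ord0 addr0 /bclifford /fl /s.
rewrite !big_ord_recl !big_ord0 /b /bump /=.
by case: b0 {b fl s S term}; case: b1; case: b2; case: b3; case: b4; rewrite /sgn /bits /=; ring.
Qed.

Implicit Types (v w u : 'rV[A]_10) (d e : spinor A).

Definition polar (v w : 'rV[A]_10) : A :=
  co v 0 * co w 5 + co v 5 * co w 0 + (co v 1 * co w 6 + co v 6 * co w 1 +
  (co v 2 * co w 7 + co v 7 * co w 2 + (co v 3 * co w 8 + co v 8 * co w 3 +
  (co v 4 * co w 9 + co v 9 * co w 4)))).

Definition quad (v : 'rV[A]_10) : A := co v 0 * co v 5 + (co v 1 * co v 6 +
  (co v 2 * co v 7 + (co v 3 * co v 8 + co v 4 * co v 9))).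

Lemma quad_formE v : quad_form v = quad v.
Proof.
rewrite /quad_form /quad.
have E (i : 'I_5) : lsubmx (v : 'rV_(5 + 5)) 0 i * rsubmx (v : 'rV_(5 + 5)) 0 i = co v i * co v (5 + i).
  by rewrite !mxE; congr (_ * _); apply: co_val.
by rewrite (eq_bigr _ (fun i _ => E i)) !big_ord_recl big_ord0 addr0.
Qed.

Definition scale_spinor (a : A) (d : spinor A) : spinor A := [ffun S => a * d S].

Lemma bits_scale a d b0 b1 b2 b3 b4 :
  bits (scale_spinor a d) b0 b1 b2 b3 b4 = a * bits d b0 b1 b2 b3 b4.
Proof. by rewrite /bits ffunE. Qed.

Lemma bits_add (d d' : spinor A) b0 b1 b2 b3 b4 :
  bits (d + d') b0 b1 b2 b3 b4 = bits d b0 b1 b2 b3 b4 + bits d' b0 b1 b2 b3 b4.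
Proof. by rewrite /bits ffunE. Qed.

Lemma bcliffordE v d : bits (clifford v d) = bclifford (co v) (bits d).
Proof. by do 5!apply: funext => ?; apply: bits_clifford. Qed.

Ltac bits5 := case; case; case; case; case; rewrite /sgn /=; ring.

Lemma cliffordDl v w d : clifford (v + w) d = clifford v d + clifford w d.
Proof.
apply: spinorP => b0 b1 b2 b3 b4; rewrite bits_add !bits_clifford /bclifford.
rewrite !coD; move: (co v) (co w) (bits d) => v' w' D.
by move: b0 b1 b2 b3 b4; bits5.
Qed.

Lemma cliffordZl a v d : clifford (a *: v) d = scale_spinor a (clifford v d).
Proof.
apply: spinorP => b0 b1 b2 b3 b4; rewrite bits_scale !bits_clifford /bclifford.
rewrite !coZ; move: (co v) (bits d) => v' D.
by move: b0 b1 b2 b3 b4; bits5.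
Qed.

Lemma cliffordDr v d d' : clifford v (d + d') = clifford v d + clifford v d'.
Proof.
apply: spinorP => b0 b1 b2 b3 b4; rewrite bits_add !bits_clifford /bclifford.
rewrite !bits_add; move: (co v) (bits d) (bits d') => v' D D'.
by move: b0 b1 b2 b3 b4; bits5.
Qed.

Lemma cliffordZr a v d : clifford v (scale_spinor a d) = scale_spinor a (clifford v d).
Proof.
apply: spinorP => b0 b1 b2 b3 b4; rewrite bits_scale !bits_clifford /bclifford.
rewrite !bits_scale; move: (co v) (bits d) => v' D.
by move: b0 b1 b2 b3 b4; bits5.
Qed.

Lemma clifford_square v d : clifford v (clifford v d) = scale_spinor (quad v) d.
Proof.
apply: spinorP => b0 b1 b2 b3 b4; rewrite bits_scale bits_clifford bcliffordE /quad.
move: (co v) (bits d) => v' D.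
by move: b0 b1 b2 b3 b4; rewrite /bclifford; bits5.
Qed.

Lemma clifford_polar v w d :
  clifford v (clifford w d) + clifford w (clifford v d) = scale_spinor (polar v w) d.
Proof.
apply: spinorP => b0 b1 b2 b3 b4; rewrite bits_add bits_scale !bits_clifford !bcliffordE /polar.
move: (co v) (co w) (bits d) => v' w' D.
by move: b0 b1 b2 b3 b4; rewrite /bclifford; bits5.
Qed.

Lemma half_spinP b d : half_spin b d <-> forall b0 b1 b2 b3 b4,
  b0 (+) b1 (+) b2 (+) b3 (+) b4 != b -> bits d b0 b1 b2 b3 b4 = 0.
Proof.
have oddS b0 b1 b2 b3 b4 : odd #|bset b0 b1 b2 b3 b4| = b0 (+) b1 (+) b2 (+) b3 (+) b4.
  rewrite -sum1_card big_mkcond !big_ord_recl big_ord0 /= !inE /=.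
  by case: b0; case: b1; case: b2; case: b3; case: b4.
split=> [hd b0 b1 b2 b3 b4|hd]; first by rewrite -oddS; apply: hd.
by apply: bset_ind => b0 b1 b2 b3 b4; rewrite oddS; apply: hd.
Qed.

Lemma half_spin_clifford b v d : half_spin b d -> half_spin (~~ b) (clifford v d).
Proof.
move/half_spinP=> hd; apply/half_spinP => b0 b1 b2 b3 b4 par.
rewrite bits_clifford /bclifford !hd; first by rewrite !mulr0 /sgn; case: b0 {par}; case: b1;
  case: b2; case: b3; rewrite ?(oppr0, addr0).
all: move: par; clear; by case: b0; case: b1; case: b2; case: b3; case: b4; case: b.
Qed.

(** The spin-invariant pairing of the two half-spin representations, for which Clifford
    multiplication is self-adjoint. Complementary subsets are paired, with the parity of the number
    of elements among 1 and 3 as sign. *)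
Definition pairing (D E : bspinor) : A :=
  \sum_(b <- [seq (x, y) | x <- [seq (x, y) | x <- [:: true; false], y <- [:: true; false]],
                           y <- [seq (x, y) | x <- [:: true; false], y <- [:: true; false]]])
   \sum_(b4 <- [:: true; false])
    sgn (b.1.2 (+) b.2.2) (D b.1.1 b.1.2 b.2.1 b.2.2 b4
      * E (~~ b.1.1) (~~ b.1.2) (~~ b.2.1) (~~ b.2.2) (~~ b4)).

Lemma pairing_clifford (v : nat -> A) (D E : bspinor) : pairing (bclifford v D) E = pairing D (bclifford v E).
Proof.
rewrite /pairing /= !(big_cons, big_nil) /= /sgn /bclifford /sgn /=.
by ring.
Qed.

End BitSpinors.

(** * The image of Clifford multiplication by an isotropic plane *)

Section CliffordImage.

Variable A : comNzRingType.
Implicit Types (u v w x y : 'rV[A]_10) (d e : spinor A) (U : set 'rV[A]_10).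

Lemma scale_spinorA a b d : scale_spinor a (scale_spinor b d) = scale_spinor (a * b) d.
Proof. by apply/ffunP => S; rewrite !ffunE mulrA. Qed.

Lemma scale_spinor0 a : scale_spinor a (0 : spinor A) = 0.
Proof. by apply/ffunP => S; rewrite !ffunE mulr0. Qed.

Lemma scale0_spinor d : scale_spinor 0 d = 0.
Proof. by apply/ffunP => S; rewrite !ffunE mul0r. Qed.

Lemma scale1_spinor d : scale_spinor 1 d = d.
Proof. by apply/ffunP => S; rewrite !ffunE mul1r. Qed.

Lemma scale_spinorDr a d e : scale_spinor a (d + e) = scale_spinor a d + scale_spinor a e.
Proof. by apply/ffunP => S; rewrite !ffunE mulrDr. Qed.

Lemma scale_spinorDl a b d : scale_spinor (a + b) d = scale_spinor a d + scale_spinor b d.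
Proof. by apply/ffunP => S; rewrite !ffunE mulrDl. Qed.

Lemma scale_spinorN a d : scale_spinor (- a) d = - scale_spinor a d.
Proof. by apply/ffunP => S; rewrite !ffunE mulNr. Qed.

Lemma clifford0r v : clifford v 0 = 0.
Proof. by rewrite -(scale0_spinor 0) cliffordZr !scale0_spinor. Qed.

Lemma cliffordN v d : clifford v (- d) = - clifford v d.
Proof. by rewrite -{1}[d]scale1_spinor -scale_spinorN cliffordZr scale_spinorN scale1_spinor. Qed.

Lemma half_spin_scale b a d : half_spin b d -> half_spin b (scale_spinor a d).
Proof. by move=> hd S odd_S; rewrite ffunE hd ?mulr0. Qed.

Lemma clifford_image_mem U b u e : U u -> half_spin (~~ b) e -> clifford_image U b (clifford u e).
Proof.
move=> Uu he; exists 1%N, (fun=> u), (fun=> e); split=> //.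
by rewrite big_ord1.
Qed.

Lemma clifford_imageD U b d e : clifford_image U b d -> clifford_image U b e ->
  clifford_image U b (d + e).
Proof.
move=> [k [u [f [Uu hf ->]]]] [l [v [g [Uv hg ->]]]].
exists (k + l)%N, (fun i => match fintype.split i with inl i => u i | inr i => v i end),
  (fun i => match fintype.split i with inl i => f i | inr i => g i end); split=> [i|i|].
- by case: (fintype.split i).
- by case: (fintype.split i).
rewrite big_split_ord /=; congr (_ + _); apply: eq_bigr => i _.
  by rewrite (unsplitK (inl i)).
by rewrite (unsplitK (inr i)).
Qed.

Lemma clifford_imageZ U b a d : clifford_image U b d -> clifford_image U b (scale_spinor a d).
Proof.
move=> [k [u [f [Uu hf ->]]]]; exists k, u, (fun i => scale_spinor a (f i)).
split=> // [i|]; first exact: half_spin_scale.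
rewrite (big_morph _ (scale_spinorDr a) (scale_spinor0 a)).
by apply: eq_bigr => i _; rewrite cliffordZr.
Qed.

Lemma clifford_imageN U b d : clifford_image U b d -> clifford_image U b (- d).
Proof. by move=> Ud; rewrite -[d]scale1_spinor -scale_spinorN; apply: clifford_imageZ. Qed.

Lemma clifford_image_ideal U b d : is_ideal [set t | clifford_image U b (scale_spinor t d)].
Proof.
split=> [|a s t /= Us Ut].
  by exists 0%N, (fun=> 0), (fun=> 0); split=> [[]|[]|] //; rewrite big_ord0 scale0_spinor.
by rewrite scale_spinorDl -scale_spinorA; apply: clifford_imageD => //; apply: clifford_imageZ.
Qed.

Lemma quadD u v : quad (u + v) = quad u + quad v + polar u v.
Proof. by rewrite /quad /polar !coD; ring. Qed.

Lemma cliffordC v w d : polar v w = 0 -> clifford v (clifford w d) = - clifford w (clifford v d).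
Proof.
by move=> vw; apply/eqP; rewrite -addr_eq0 clifford_polar vw scale0_spinor.
Qed.

Lemma clifford_swap v w d :
  clifford v (clifford w d) = scale_spinor (polar v w) d - clifford w (clifford v d).
Proof. by rewrite -clifford_polar addrK. Qed.

Section Plane.

Variables (m : nat) (M : 'M[A]_(m, 10)).
Hypotheses (rM : constant_rank 2 M) (qM : forall u, row_space M u -> quad u = 0).

Lemma plane_polar u v : row_space M u -> row_space M v -> polar u v = 0.
Proof.
move=> Mu Mv; have := qM (submodD (row_space_submodule M) Mu Mv).
by rewrite quadD !qM // !add0r.
Qed.

Lemma clifford_null u d : row_space M u -> clifford u (clifford u d) = 0.
Proof. by move=> Mu; rewrite clifford_square qM // scale0_spinor. Qed.

Lemma clifford_comb (a b c f : A) x y d : row_space M x -> row_space M y ->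
  clifford (a *: x + b *: y) (clifford (c *: x + f *: y) d) =
  scale_spinor (a * f - b * c) (clifford x (clifford y d)).
Proof.
move=> Mx My; rewrite !cliffordDl !cliffordZl !cliffordDr !cliffordZr.
rewrite !clifford_null // !scale_spinor0 add0r addr0.
rewrite (cliffordC _ (plane_polar My Mx)) scale_spinorDl scale_spinorN -!scale_spinorA.
by apply/ffunP => S; rewrite !ffunE; ring.
Qed.

(** Vectors of an isotropic plane generate an exterior algebra in the Clifford algebra, and the
    third exterior power of a plane is zero. One minor per vector reduces to two generators. *)
Lemma clifford3 u v w d : row_space M u -> row_space M v -> row_space M w ->
  clifford u (clifford v (clifford w d)) = 0.
Proof.
move=> Mu Mv Mw; set t := (X in X = 0).
pose J := [set s | scale_spinor s t = 0].
have idJ : is_ideal J.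
  split=> [|a r s /= Jr Js]; first exact: scale0_spinor.
  by rewrite /J /= scale_spinorDl -scale_spinorA Jr Js scale_spinor0 addr0.
suff : J 1 by rewrite /J /= scale1_spinor.
apply: (rank2_unit rM idJ) => p q a b; exists 3%N; rewrite /J /= /t.
have Mp := row_space_row M p; have Mq := row_space_row M q.
set f := minor2 M p q a b.
transitivity (clifford (f *: u) (clifford (f *: v) (clifford (f *: w) d))).
  by rewrite !cliffordZl !cliffordZr !scale_spinorA; congr scale_spinor; ring.
rewrite !(rank2_span p q a b rM) // clifford_comb // cliffordDl !cliffordZl.
rewrite !cliffordDr !cliffordZr (clifford_null _ Mq) clifford0r.
rewrite (cliffordC _ (plane_polar Mq Mp)) cliffordN (clifford_null _ Mp).
by rewrite oppr0 !scale_spinor0 addr0 scale_spinor0.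
Qed.

Lemma clifford_image_annihilated b d : clifford_image (row_space M) b d ->
  forall u v, row_space M u -> row_space M v -> clifford u (clifford v d) = 0.
Proof.
move=> [k [w [e [Mw _ ->]]]] u v Mu Mv.
rewrite (big_morph _ (cliffordDr v) (clifford0r v)).
rewrite (big_morph _ (cliffordDr u) (clifford0r u)) big1 // => i _.
exact: clifford3.
Qed.

(* Koszul exactness: multiplying u v d = 0 by the vectors dual to the columns
   a and b exhibits (minor a b) d in the image. *)
Lemma annihilated_clifford_image d : half_spin false d ->
  (forall u v, row_space M u -> row_space M v -> clifford u (clifford v d) = 0) ->
  clifford_image (row_space M) false d.
Proof.
move=> hd d0; rewrite -[d]scale1_spinor.
apply: (rank2_unit rM (clifford_image_ideal _ _ _)) => p q a b; exists 1%N.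
rewrite /= expr1; have Mp := row_space_row M p; have Mq := row_space_row M q.
set x := row p M in Mp *; set y := row q M in Mq *.
have [dual dualP] : exists dual : 'I_10 -> 'rV[A]_10, forall c u, polar (dual c) u = u 0 c.
  exists (fun c => row_of 10 (mkseq (fun j => (j == (c + 5) %% 10)%N%:R) 10)) => c u.
  rewrite coE /polar !co_row_of //=.
  by case: c => [] [|[|[|[|[|[|[|[|[|[|]]]]]]]]]] //= _; ring.
set f := dual a; set g := dual b.
(* This is [g f x y d = 0] after the dual vectors have been moved to the right past [x] and [y].
   Every term left over begins with [x] or [y], hence lies in the image. *)
have E : scale_spinor (minor2 M p q a b) d =
  scale_spinor (x 0 a) (clifford y (clifford g d)) - scale_spinor (y 0 a) (clifford x (clifford g d))
  - scale_spinor (x 0 b) (clifford y (clifford f d)) + clifford x (clifford g (clifford y (clifford f d))).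
  have E1 : clifford g (clifford f (clifford x (clifford y d))) = 0 by rewrite d0 // !clifford0r.
  have E2 : clifford g (scale_spinor (x 0 a) (clifford y d)) -
      clifford g (clifford x (scale_spinor (y 0 a) d)) +
      clifford g (clifford x (clifford y (clifford f d))) = 0.
    rewrite -E1 (clifford_swap f x) (clifford_swap f y) !dualP.
    by rewrite !(cliffordDr, cliffordN) !cliffordZr; apply/ffunP => S; rewrite !ffunE; ring.
  move: E2; rewrite !cliffordZr (clifford_swap g x (clifford y _)) (clifford_swap g y d).
  rewrite (clifford_swap g x d) !dualP => /ffunP E2; apply/ffunP => S; have := E2 S.
  rewrite !ffunE /minor2 !mxE => {}E2; apply: subr0_eq; rewrite -[RHS]E2; ring.
rewrite E; have hf := half_spin_clifford f hd; have hg := half_spin_clifford g hd.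
do !apply: clifford_imageD; try apply: clifford_imageN; try apply: clifford_imageZ;
  apply: clifford_image_mem => //.
by apply: (half_spin_clifford (b := false)); apply: (half_spin_clifford (b := true)).
Qed.

End Plane.

End CliffordImage.

(** * Octonion multiplication inside the standard pair *)

Section NormalForm.

Variable A : comNzRingType.
Implicit Types (u v w : 'rV[A]_10) (x y : 'rV[A]_8).

Lemma forall_lt10 (P : nat -> Prop) : P 0%N -> P 1%N -> P 2%N -> P 3%N -> P 4%N ->
  P 5%N -> P 6%N -> P 7%N -> P 8%N -> P 9%N -> forall k, (k < 10)%N -> P k.
Proof. by do 10![move=> ?]; do 10![case=> //]. Qed.

(** On the subspace [u_4 = u_9 = 0], [u_5 = - u_0] this is an isomorphism onto the traceless
    octonions. The signs on the coordinates 6 to 8 carry [quad] to the norm [a b - u . v]. *)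
Definition to_oct : 'M[A]_(10, 8) := mx_of 10 8
  [:: [:: 1; 0; 0; 0; 0; 0; 0; -1];
      [:: 0; 1; 0; 0; 0; 0; 0; 0];
      [:: 0; 0; 1; 0; 0; 0; 0; 0];
      [:: 0; 0; 0; 1; 0; 0; 0; 0];
      [:: 0; 0; 0; 0; 0; 0; 0; 0];
      [:: 0; 0; 0; 0; 0; 0; 0; 0];
      [:: 0; 0; 0; 0; -1; 0; 0; 0];
      [:: 0; 0; 0; 0; 0; -1; 0; 0];
      [:: 0; 0; 0; 0; 0; 0; -1; 0];
      [:: 0; 0; 0; 0; 0; 0; 0; 0]].

Definition of_oct : 'M[A]_(8, 10) := mx_of 8 10
  [:: [:: 1; 0; 0; 0; 0; -1; 0; 0; 0; 0];
      [:: 0; 1; 0; 0; 0; 0; 0; 0; 0; 0];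
      [:: 0; 0; 1; 0; 0; 0; 0; 0; 0; 0];
      [:: 0; 0; 0; 1; 0; 0; 0; 0; 0; 0];
      [:: 0; 0; 0; 0; 0; 0; -1; 0; 0; 0];
      [:: 0; 0; 0; 0; 0; 0; 0; -1; 0; 0];
      [:: 0; 0; 0; 0; 0; 0; 0; 0; -1; 0];
      [:: 0; 0; 0; 0; 0; 0; 0; 0; 0; 0]].

Lemma mul_to_oct u : u *m to_oct = row_of 8 [:: co u 0; co u 1; co u 2; co u 3;
  - co u 6; - co u 7; - co u 8; - co u 0].
Proof.
apply: co_ext; apply: forall_lt8; rewrite co_mul10 !mc_mx_of // co_row_of //=;
  move: (co u) => f; ring.
Qed.

Lemma mul_of_oct x : x *m of_oct = row_of 10 [:: co x 0; co x 1; co x 2; co x 3; 0;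
  - co x 0; - co x 4; - co x 5; - co x 6; 0].
Proof.
apply: co_ext; apply: forall_lt10; rewrite co_mul8 !mc_mx_of // co_row_of //=;
  move: (co x) => f; ring.
Qed.

(* Coordinates of the standard sections 1 + e_0123 and e_04 + e_1234. *)
Definition std_bits (k : 'I_2) : bspinor A := fun b0 b1 b2 b3 b4 =>
  (if k == 0 then [&& ~~ b4, b0 == b1, b1 == b2 & b2 == b3]
   else [&& b4, b0 != b1, b1 == b2 & b2 == b3])%:R.

Lemma std_pairing u :
  pairing (std_bits 0) (bclifford (co u) (std_bits 0)) = 2%:R * co u 4 /\
  pairing (std_bits 1) (bclifford (co u) (std_bits 1)) = - (2%:R * co u 9) /\
  pairing (std_bits 0) (bclifford (co u) (std_bits 1)) = co u 0 + co u 5.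
Proof.
rewrite /pairing /= !(big_cons, big_nil) /= /sgn /bclifford /sgn /std_bits /=.
by move: (co u) => f; split; [|split]; ring.
Qed.

(** The eight even subsets of {0, 1, 2, 3} index the components of [u v (1 + e_0123)]; up to sign
    these are the eight coordinates of the octonion product. *)
Lemma std_omul u v : co u 5 = - co u 0 -> co v 5 = - co v 0 -> co u 4 = 0 -> co u 9 = 0 ->
  co v 4 = 0 -> co v 9 = 0 ->
  let D k := bclifford (co u) (bclifford (co v) (std_bits k)) in
  let z := omul (u *m to_oct) (v *m to_oct) in
  (D 0 true true true true false = - co z 0 /\ D 0 false false false false false = - co z 7) /\
  (D 0 true true false false false = co z 1 /\ D 0 true false true false false = co z 2) /\
  [/\ D 0 true false false true false = co z 3, D 0 false false true true false = co z 4,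
      D 0 false true false true false = - co z 5 & D 0 false true true false false = co z 6].
Proof.
move=> u5 v5 u4 u9 v4 v9 D z.
rewrite /D /z !mul_to_oct omul_row8 /omul_coords !co_row_of //= /bclifford /sgn /std_bits /= u5 v5 ?(u4, u9, v4, v9).
move: (co u) (co v) => f g.
by do ![split]; ring.
Qed.

(** Every component, for either spinor, is identically zero or a single coordinate of the product up
    to sign: the second spinor imposes no further quadratic equation. *)
Lemma std_annihilated u v : co u 5 = - co u 0 -> co v 5 = - co v 0 -> co u 4 = 0 ->
  co u 9 = 0 -> co v 4 = 0 -> co v 9 = 0 -> omul (u *m to_oct) (v *m to_oct) = 0 ->
  forall k b0 b1 b2 b3 b4,
  bclifford (co u) (bclifford (co v) (std_bits k)) b0 b1 b2 b3 b4 = 0.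
Proof.
move=> u5 v5 u4 u9 v4 v9 /omul_eq0 z.
have := (z 0%N isT, z 1%N isT, z 2%N isT, z 3%N isT, z 4%N isT, z 5%N isT, z 6%N isT, z 7%N isT).
rewrite /omul_coords !mul_to_oct !co_row_of //= => -[[[[[[[z0 z1] z2] z3] z4] z5] z6] z7].
move=> k b0 b1 b2 b3 b4; rewrite /bclifford /sgn u5 v5 u4 u9 v4 v9 /std_bits.
case: (k == 0); move: (co u) (co v) z0 z1 z2 z3 z4 z5 z6 z7 => f g z0 z1 z2 z3 z4 z5 z6 z7;
  case: b0; case: b1; case: b2; case: b3; case: b4; rewrite /=; first [ring
  | rewrite -[RHS]z0; ring | rewrite -[RHS]z1; ring | rewrite -[RHS]z2; ring
  | rewrite -[RHS]z3; ring | rewrite -[RHS]z4; ring | rewrite -[RHS]z5; ring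
  | rewrite -[RHS]z6; ring | rewrite -[RHS]z7; ring
  | rewrite -[RHS]oppr0 -[in RHS]z0; ring | rewrite -[RHS]oppr0 -[in RHS]z5; ring
  | rewrite -[RHS]oppr0 -[in RHS]z7; ring | rewrite -[RHS]oppr0 -[in RHS]z1; ring
  | rewrite -[RHS]oppr0 -[in RHS]z2; ring | rewrite -[RHS]oppr0 -[in RHS]z3; ring
  | rewrite -[RHS]oppr0 -[in RHS]z4; ring | rewrite -[RHS]oppr0 -[in RHS]z6; ring].
Qed.

End NormalForm.

Lemma map_to_oct (A B : comNzRingType) (f : {rmorphism A -> B}) : map_mx f (to_oct A) = to_oct B.
Proof. by rewrite map_mx_of /= !(rmorph0, rmorph1, rmorphN). Qed.

Lemma map_of_oct (A B : comNzRingType) (f : {rmorphism A -> B}) : map_mx f (of_oct A) = of_oct B.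
Proof. by rewrite map_mx_of /= !(rmorph0, rmorph1, rmorphN). Qed.

(** * The zero locus of the standard section *)

Section StandardZeroLocus.

Variable K : fieldType.
Hypothesis K2 : 2%:R != 0 :> K.

Definition std_section (k : 'I_2) : spinor K := [ffun S : {set 'I_5} =>
  let b i := inord i \in S in std_bits K k (b 0%N) (b 1%N) (b 2%N) (b 3%N) (b 4%N)].

Lemma in_bset b0 b1 b2 b3 b4 i : (i < 5)%N ->
  (inord i \in bset b0 b1 b2 b3 b4) = nth false [:: b0; b1; b2; b3; b4] i.
Proof. by move=> lti; rewrite inE inordK. Qed.

Lemma bits_std k : bits (std_section k) = std_bits K k.
Proof. by do 5!apply: funext => ?; rewrite /bits ffunE /= !in_bset. Qed.

Lemma std_even : global_section std_section.
Proof.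
move=> k; apply/half_spinP => b0 b1 b2 b3 b4; rewrite bits_std /std_bits.
by case: (k == 0); case: b0; case: b1; case: b2; case: b3; case: b4.
Qed.

Section Points.

Variable A : comAlgType K.

Lemma half_mulr (x : A) : 2%:R * x = 0 -> x = 0.
Proof.
move/(congr1 (fun y => (2%:R)^-1 *: y)); rewrite scaler0 mulr_natl -scaler_nat scalerA.
by rewrite mulVf // scale1r.
Qed.

Definition section_at (psi : 'I_2 -> spinor K) (k : 'I_2) : spinor A :=
  [ffun S => (psi k S)%:A].

Lemma bits_section_at k : bits (section_at std_section k) = std_bits A k.
Proof.
do 5!apply: funext => ?; rewrite /bits ffunE -/(bits _ _ _ _ _ _) bits_std /std_bits.
by rewrite scaler_nat.
Qed.

Lemma zero_locus_null (U : set 'rV[A]_10) : zero_locus std_section U ->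
  @null_planes K A (push (extend A (to_oct K)) U) /\
  forall u, U u -> u *m extend A (to_oct K) *m extend A (of_oct K) = u.
Proof.
move=> [[grU qU] imU]; have [m [M [rM defU]]] := grU.
have qM u : row_space M u -> quad u = 0 by rewrite -defU -quad_formE; apply: qU.
have ann k u v : U u -> U v -> clifford u (clifford v (section_at std_section k)) = 0.
  move=> Uu Uv; have := imU k; rewrite defU => /(clifford_image_annihilated rM qM); apply;
  by rewrite -defU.
(* The spinor [k] is a sum of [w_i e_i] with [w_i] in [U]. Self-adjointness moves [w_i] onto [u]
   times the spinor [l], which it annihilates. *)
have pair0 k l u : U u -> pairing (std_bits A k) (bclifford (co u) (std_bits A l)) = 0.
  move=> Uu; have [h [w [e [Uw _ E]]]] := imU k.
  rewrite -(bits_section_at k) -(bits_section_at l) [section_at std_section k]E.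
  have pairD d d' F : pairing (bits (d + d')) F = pairing (bits d) F + pairing (bits d') F :> A.
    rewrite (_ : bits (d + d') = fun b0 b1 b2 b3 b4 => bits d b0 b1 b2 b3 b4 + bits d' b0 b1 b2 b3 b4).
      by rewrite /pairing /= !(big_cons, big_nil) /= /sgn /=; ring.
    by do 5!apply: funext => ?; apply: bits_add.
  have pair00 F : pairing (bits 0) F = 0 :> A.
    by rewrite -[LHS]addr0 -[X in _ + X = _](subrr (pairing (bits 0) F)) addrA -pairD addr0 subrr.
  rewrite (big_morph _ (fun d d' => pairD d d' _) (pair00 _)) big1 // => i _.
  rewrite bcliffordE pairing_clifford -bcliffordE -bcliffordE ann //.
  by rewrite /pairing /= !(big_cons, big_nil) /bits !ffunE /sgn /= !mulr0 !oppr0 !addr0.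
have U4 u : U u -> co u 4 = 0.
  by move=> Uu; apply: half_mulr; have [<- _] := std_pairing u; apply: pair0.
have U9 u : U u -> co u 9 = 0.
  move=> Uu; apply: half_mulr; have [_ [E _]] := std_pairing u.
  by rewrite -[LHS]opprK -E pair0 ?oppr0.
have U5 u : U u -> co u 5 = - co u 0.
  move=> Uu; have [_ [_ E]] := std_pairing u.
  by apply/eqP; rewrite -addr_eq0 addrC -E pair0.
have PQ u : U u -> u *m extend A (to_oct K) *m extend A (of_oct K) = u.
  move=> Uu; rewrite /extend map_to_oct map_of_oct mul_to_oct mul_of_oct.
  apply: co_ext; apply: forall_lt10; rewrite !co_row_of //= ?opprK ?U4 ?U9 ?U5 //.
split=> //; split; first exact: grassmannian_push PQ grU.
rewrite /extend map_to_oct; split=> [_ [u Uu <-]|_ _ [u Uu <-] [v Uv <-]].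
  by rewrite mul_to_oct /otrace !co_row_of //= subrr.
have [[z0 z7] [[z1 z2] [z3 z4 z5 z6]]] :=
  std_omul (U5 u Uu) (U5 v Uv) (U4 u Uu) (U9 u Uu) (U4 v Uv) (U9 v Uv).
have b0 k b0 b1 b2 b3 b4 :
    bclifford (co u) (bclifford (co v) (std_bits A k)) b0 b1 b2 b3 b4 = 0.
  rewrite -(bits_section_at k) -bcliffordE -bits_clifford ann //.
  by rewrite /bits ffunE.
apply: co_ext; apply: forall_lt8; rewrite co0.
- by rewrite -[LHS]opprK -z0 b0 oppr0.
- by rewrite -z1 b0.
- by rewrite -z2 b0.
- by rewrite -z3 b0.
- by rewrite -z4 b0.
- by rewrite -[LHS]opprK -z5 b0 oppr0.
- by rewrite -z6 b0.
- by rewrite -[LHS]opprK -z7 b0 oppr0.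
Qed.

Lemma null_zero_locus (W : set 'rV[A]_8) : @null_planes K A W ->
  zero_locus std_section (push (extend A (of_oct K)) W) /\
  forall w, W w -> w *m extend A (of_oct K) *m extend A (to_oct K) = w.
Proof.
move=> [grW [tW mW]].
have QP w : W w -> w *m extend A (of_oct K) *m extend A (to_oct K) = w.
  move=> Ww; rewrite /extend map_to_oct map_of_oct mul_of_oct mul_to_oct.
  have /otrace_eq0 w7 := tW w Ww.
  by apply: co_ext; apply: forall_lt8; rewrite !co_row_of //= ?opprK ?w7.
split=> //; have grU := grassmannian_push QP grW; have [m [M [rM defU]]] := grU.
have qU u : push (extend A (of_oct K)) W u -> quad u = 0.
  case=> w Ww <-; rewrite /extend map_of_oct mul_of_oct /quad !co_row_of //=.
  have := omul_eq0 (mW w w Ww Ww) (isT : (0 < 8)%N); rewrite /omul_coords /= => E.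
  by rewrite -[RHS]oppr0 -[in RHS]E; ring.
split; first by split=> // u Uu; rewrite quad_formE qU.
move=> k; have qM u : row_space M u -> quad u = 0 by rewrite -defU; apply: qU.
suff : clifford_image (push (extend A (of_oct K)) W) false (section_at std_section k) by [].
rewrite defU; apply: (annihilated_clifford_image rM) => [|u v].
  by move=> S par; rewrite [LHS]ffunE (@std_even k S par) scale0r.
rewrite -defU => -[w Ww <-] [w' Ww' <-]; apply: spinorP => b0 b1 b2 b3 b4.
rewrite bits_clifford bcliffordE bits_section_at [RHS]ffunE.
have QP' z : W z -> z *m extend A (of_oct K) *m to_oct A = z.
  by move/QP; rewrite {2}/extend map_to_oct.
by rewrite std_annihilated ?QP' ?mW // /extend map_of_oct mul_of_oct !co_row_of.
Qed.

End Points.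

Lemma std_zero_locus_iso : isomorphic (zero_locus std_section) (@null_planes K).
Proof. exact: linear_isomorphic zero_locus_null null_zero_locus. Qed.

End StandardZeroLocus.

(** * Reduction of a general section to the standard one *)

Section Eichler.

Variable A : comNzRingType.
Implicit Types (u v w n m : 'rV[A]_10) (d e : spinor A) (r : A).

Definition dual_col m : 'cV[A]_10 := (row_of 10 [:: co m 5; co m 6; co m 7; co m 8; co m 9;
  co m 0; co m 1; co m 2; co m 3; co m 4])^T.

Lemma mul_dual_col u m : u *m dual_col m = (polar m u)%:M.
Proof.
apply/matrixP => i j; rewrite !ord1 [RHS]mxE mulr1n mxE.
under eq_bigr => k _ do rewrite coE mxE coE.
rewrite (sum10 (fun k => co u k * co (row_of 10 _) k)) !co_row_of // /polar /=; ring.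
Qed.

(* The action on vectors of the element 1 + n m of the Clifford group, for n
   isotropic; r is the inverse of 1 + polar n m. *)
Definition eichler n m r : 'M[A]_10 :=
  1%:M + dual_col m *m n - r *: (dual_col n *m (m + quad m *: n)).

Lemma mul_eichler u n m r : u *m eichler n m r =
  u + (polar m u - r * polar n u * quad m) *: n + (- (r * polar n u)) *: m.
Proof.
rewrite mulmxBr mulmxDr mulmx1 mulmxA mul_dual_col mul_scalar_mx -scalemxAr mulmxA.
rewrite mul_dual_col mul_scalar_mx.
by apply/rowP => j; rewrite !mxE; ring.
Qed.

Lemma polarDr u v w : polar u (v + w) = polar u v + polar u w.
Proof. by rewrite /polar !coD; ring. Qed.

Lemma polarZr a u v : polar u (a *: v) = a * polar u v.
Proof. by rewrite /polar !coZ; ring. Qed.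

Lemma polarZl a u v : polar (a *: u) v = a * polar u v.
Proof. by rewrite /polar !coZ; ring. Qed.

Lemma polarC u v : polar u v = polar v u.
Proof. by rewrite /polar; ring. Qed.

Lemma polarxx u : polar u u = 2%:R * quad u.
Proof. by rewrite /polar /quad; ring. Qed.

Lemma quadZ a u : quad (a *: u) = a ^+ 2 * quad u.
Proof. by rewrite /quad !coZ; ring. Qed.

Definition shift n m d : spinor A := d + clifford n (clifford m d).

Section Transform.

Variables (n m : 'rV[A]_10) (r : A).
Hypotheses (qn : quad n = 0) (rc : r * (1 + polar n m) = 1).

Lemma quad_eichler u : quad (u *m eichler n m r) = quad u.
Proof.
rewrite mul_eichler !quadD !quadZ !polarZr qn [polar (_ + _) m]polarC polarDr polarZr.
rewrite [polar u n]polarC [polar m n]polarC.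
set c := polar n m; set q := quad m; set a := polar m u; set b := polar n u.
transitivity (quad u + b * (1 - r * (1 + c)) * a + q * r * b ^+ 2 * (r * (1 + c) - 1)); first by ring.
by rewrite rc subrr mulr0 mul0r mulr0 !addr0.
Qed.

Lemma clifford_eichler u d :
  clifford (u *m eichler n m r) (shift n m d) = shift n m (clifford u d).
Proof.
have nn e : clifford n (clifford n e) = 0 by rewrite clifford_square qn scale0_spinor.
rewrite mul_eichler /shift !cliffordDl !cliffordZl !cliffordDr nn.
rewrite (clifford_swap m n (clifford m d)) clifford_square cliffordZr.
rewrite [clifford m (clifford u d)]clifford_swap cliffordDr cliffordN cliffordZr.
rewrite [clifford n (clifford u (clifford m d))]clifford_swap [polar m n]polarC.
set c := polar n m; set q := quad m; set a := polar m u; set b := polar n u.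
move: (clifford u d) (clifford n d) (clifford m d) (clifford u (clifford n (clifford m d))).
move=> t y x z; apply/ffunP => S; rewrite !ffunE.
transitivity (t S + z S + a * y S - b * x S * (r * (1 + c))); first by ring.
by rewrite rc; ring.
Qed.

(** As [n n = 0], the square of [n m] is [polar n m] times [n m], so the inverse of [1 + n m] is
    [1 - r n m]. *)
Lemma shiftK d : shift (- r *: n) m (shift n m d) = d.
Proof.
have nn e : clifford n (clifford n e) = 0 by rewrite clifford_square qn scale0_spinor.
rewrite /shift cliffordZl !cliffordDr (clifford_swap m n (clifford m d)) clifford_square.
rewrite cliffordDr cliffordN !cliffordZr nn [polar m n]polarC.
move: (clifford n (clifford m d)) (scale_spinor (quad m) (clifford n d)) => t y.
apply/ffunP => S; rewrite !ffunE; set c := polar n m.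
transitivity (d S + t S - t S * (r * (1 + c))); first by ring.
by rewrite rc mulr1 addrK.
Qed.

(** The inverse element [1 - r n m] satisfies [1 + polar (- r *: n) m = r], whence [1 + polar n m]
    as its third parameter. *)
Lemma eichlerK u : u *m eichler n m r *m eichler (- r *: n) m (1 + polar n m) = u.
Proof.
rewrite !mul_eichler !polarDr !polarZr !polarZl polarxx polarxx qn [polar m n]polarC.
set c := polar n m; set q := quad m; set a := polar m u; set b := polar n u.
apply/rowP => j; rewrite !mxE.
set x := u 0 j; set y := n 0 j; set z := m 0 j.
pose e := r * (1 + c) - 1; transitivity (x + e * ((b * (r - 1 - e)) * z +
  (- a + b * q * r * (2%:R - r + e)) * y)); first by rewrite /e; ring.
by rewrite /e rc subrr mul0r addr0.
Qed.

End Transform.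

End Eichler.

Section ExtendShift.

Variables (K : fieldType) (A : comAlgType K).
Implicit Types (n m v : 'rV[K]_10).

Lemma co_extend v k : co (extend A v) k = (co v k)%:A.
Proof. by rewrite /co mxE. Qed.

Lemma extend_polar v w : polar (extend A v) (extend A w) = (polar v w)%:A.
Proof. by rewrite /polar !co_extend -!/(in_alg A _) !(rmorphD, rmorphM). Qed.

Lemma extend_quad v : quad (extend A v) = (quad v)%:A.
Proof. by rewrite /quad !co_extend -!/(in_alg A _) !(rmorphD, rmorphM). Qed.

Lemma extend_eichler n m r :
  extend A (eichler n m r) = eichler (extend A n) (extend A m) r%:A.
Proof.
have dual x : extend A (dual_col x) = dual_col (extend A x).
  apply/matrixP => i j; rewrite !mxE; case: i.
  by do 10![case=> [lti|]; first by rewrite /= co_extend] => i.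
rewrite /eichler {1}/extend map_mxB map_mxD map_mx1 map_mxZ !map_mxM map_mxD map_mxZ.
by rewrite -!/(extend A _) !dual extend_quad.
Qed.

Lemma section_at_clifford psi v k :
  section_at A (fun k => clifford v (psi k)) k = clifford (extend A v) (section_at A psi k).
Proof.
apply/ffunP => S; rewrite !ffunE -/(in_alg A _) rmorphD !rmorph_sum.
congr (_ + _); apply: eq_bigr => i _; rewrite !rmorphM /wedge_sign rmorphXn rmorphN1 !ffunE;
  by congr (_ * _ * _); rewrite /extend !mxE.
Qed.

Lemma section_at_shift psi n m k :
  section_at A (fun k => shift n m (psi k)) k =
  shift (extend A n) (extend A m) (section_at A psi k).
Proof.
rewrite /shift -!section_at_clifford.
by apply/ffunP => S; rewrite !ffunE scalerDl.
Qed.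

End ExtendShift.

Section ShiftIso.

Variables (K : fieldType).
Implicit Types (n m : 'rV[K]_10) (psi : 'I_2 -> spinor K).

Lemma zero_locus_shift_sub n m r psi (A : comAlgType K) U :
  quad n = 0 -> r * (1 + polar n m) = 1 -> zero_locus psi U ->
  zero_locus (fun k => shift n m (psi k)) (push (extend A (eichler n m r)) U) /\
  forall u, U u -> u *m extend A (eichler n m r)
    *m extend A (eichler (- r *: n) m (1 + polar n m)) = u.
Proof.
move=> qn rc [[grU qU] imU].
have qnA : quad (extend A n) = 0 by rewrite extend_quad qn scale0r.
have rcA : r%:A * (1 + polar (extend A n) (extend A m)) = 1.
  by rewrite extend_polar -!/(in_alg A _) -[X in X + _](rmorph1 (in_alg A)) -rmorphD -rmorphM rc rmorph1.
have PQ (u : 'rV_10) : u *m extend A (eichler n m r)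
    *m extend A (eichler (- r *: n) m (1 + polar n m)) = u.
  have E : extend A (- r *: n) = - r%:A *: extend A n.
    by rewrite [LHS]map_mxZ -/(in_alg A r) -rmorphN.
  rewrite !extend_eichler E.
  have -> : (1 + polar n m)%:A = 1 + polar (extend A n) (extend A m) :> A.
    by rewrite extend_polar scalerDl scale1r.
  exact: eichlerK.
split=> //; split; first split; first exact: grassmannian_push grU.
  by move=> _ [u Uu <-]; rewrite quad_formE extend_eichler quad_eichler // -quad_formE qU.
move=> k; have [h [w [e [Uw he E]]]] := imU k.
have -> : [ffun S => (shift n m (psi k) S)%:A] = section_at A (fun k => shift n m (psi k)) k by [].
rewrite section_at_shift [section_at A psi k]E.
exists h, (fun i => w i *m extend A (eichler n m r)), (fun i => shift (extend A n) (extend A m) (e i)).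
split=> [i|i|]; first by exists (w i).
  have he2 := half_spin_clifford (extend A n) (half_spin_clifford (extend A m) (he i)).
  by move=> S par; rewrite ffunE (he i) // he2 // addr0.
rewrite extend_eichler; rewrite (eq_bigr _ (fun i _ => clifford_eichler qnA rcA (w i) (e i))).
rewrite {1}/shift (big_morph _ (cliffordDr _) (clifford0r _)).
rewrite (big_morph _ (cliffordDr _) (clifford0r _)) -big_split.
by apply: eq_bigr.
Qed.

Lemma zero_locus_shift n m psi : quad n = 0 -> 1 + polar n m != 0 ->
  isomorphic (zero_locus psi) (zero_locus (fun k => shift n m (psi k))).
Proof.
move=> qn c0; set r := (1 + polar n m)^-1; have rc : r * (1 + polar n m) = 1 by rewrite mulVf.
apply: (linear_isomorphic (P := eichler n m r) (Q := eichler (- r *: n) m (1 + polar n m))) => A U.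
  exact: zero_locus_shift_sub.
set n' := - r *: n; have qn' : quad n' = 0 by rewrite quadZ qn mulr0.
have p' : 1 + polar n' m = r.
  by rewrite polarZl -[1]rc; ring.
have rc' : (1 + polar n m) * (1 + polar n' m) = 1 by rewrite p' mulrC.
move=> /(zero_locus_shift_sub qn' rc'); rewrite p'.
have -> : - (1 + polar n m) *: n' = n.
  by rewrite /n' scalerA mulrN mulNr opprK mulrC rc scale1r.
have -> : (fun k => shift n' m (shift n m (psi k))) = psi.
  by apply: funext => k; apply: shiftK.
by [].
Qed.

End ShiftIso.

(** * Rational functions and open conditions at a base section *)

Section Generic.

Variables (K : fieldType) (base : 'I_2 -> spinor K).
Hypothesis base_even : global_section base.

Local Notation evalp p psi := (p.@[section_coord psi]).
Implicit Types (p q : {mpoly K[#|{: 'I_2 * {set 'I_5}}|]}) (psi : 'I_2 -> spinor K).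
Implicit Types (f g : ('I_2 -> spinor K) -> K) (Q : ('I_2 -> spinor K) -> Prop).

(** Membership in the local ring at [base], as a total function that agrees with a fraction wherever
    the chosen denominator is nonzero. *)
Definition regular_at_base f : Prop := exists p q, evalp q base != 0 /\
  forall psi, evalp q psi != 0 -> f psi = evalp p psi / evalp q psi.

Lemma regular_const c : regular_at_base (fun=> c).
Proof.
exists c%:MP, 1; rewrite rmorph1 oner_eq0; split=> // psi _.
by rewrite rmorph1 mevalC divr1.
Qed.

Lemma regular_coord k S : regular_at_base (fun psi => psi k S).
Proof.
exists 'X_(enum_rank (k, S)), 1; rewrite rmorph1 oner_eq0; split=> // psi _.
by rewrite rmorph1 mevalXU divr1 /section_coord enum_rankK.
Qed.

Lemma regularD f g : regular_at_base f -> regular_at_base g ->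
  regular_at_base (fun psi => f psi + g psi).
Proof.
move=> [p [q [q0 fE]]] [r [s [s0 gE]]].
exists (p * s + r * q), (q * s); rewrite rmorphM mulf_neq0 //; split=> // psi.
rewrite rmorphM mulf_eq0 negb_or => /andP[qn sn].
by rewrite fE // gE // rmorphD !rmorphM addf_div.
Qed.

Lemma regularM f g : regular_at_base f -> regular_at_base g ->
  regular_at_base (fun psi => f psi * g psi).
Proof.
move=> [p [q [q0 fE]]] [r [s [s0 gE]]].
exists (p * r), (q * s); rewrite rmorphM mulf_neq0 //; split=> // psi.
rewrite rmorphM mulf_eq0 negb_or => /andP[qn sn].
by rewrite fE // gE // rmorphM mulf_div.
Qed.

Lemma regularN f : regular_at_base f -> regular_at_base (fun psi => - f psi).
Proof.
move=> [p [q [q0 fE]]]; exists (- p), q; split=> // psi qn.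
by rewrite fE // rmorphN mulNr.
Qed.

Lemma regularV f : f base != 0 -> regular_at_base f -> regular_at_base (fun psi => (f psi)^-1).
Proof.
(* The inverse [q / p] is written over [p * q], because [f] is known to be [p / q] only where [q]
   does not vanish. *)
move=> f0 [p [q [q0 fE]]]; exists (q ^+ 2), (p * q).
have p0 : evalp p base != 0 by apply: contra_neq f0 => p0; rewrite fE // p0 mul0r.
rewrite rmorphM mulf_neq0 //; split=> // psi.
rewrite rmorphM mulf_eq0 negb_or => /andP[pn qn].
by rewrite fE // invf_div rmorphXn expr2 -mulf_div mulfV // mulr1.
Qed.

Lemma regular_sum (I : finType) (P : pred I) (F : I -> ('I_2 -> spinor K) -> K) :
  (forall i, regular_at_base (F i)) -> regular_at_base (fun psi => \sum_(i | P i) F i psi).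
Proof.
move=> rF; elim: (index_enum I) => [|i r IHr].
  have -> : (fun psi => \sum_(i <- [::] | P i) F i psi) = fun=> 0.
    by apply: funext => psi; rewrite big_nil.
  exact: regular_const.
have -> : (fun psi => \sum_(i <- i :: r | P i) F i psi) =
    fun psi => (if P i then 1 else 0) * F i psi + \sum_(i <- r | P i) F i psi.
  by apply: funext => psi; rewrite big_cons; case: (P i); rewrite ?mul1r ?mul0r ?add0r.
by apply: regularD => //; apply: regularM => //; apply: regular_const.
Qed.

(** The open set is required to contain [base], so finite intersections stay nonempty without an
    appeal to irreducibility. *)
Definition generic Q : Prop := exists q, evalp q base != 0 /\
  forall psi, global_section psi -> evalp q psi != 0 -> Q psi.

Lemma generic_imp Q Q' : (forall psi, Q psi -> Q' psi) -> generic Q -> generic Q'.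
Proof. by move=> QQ' [q [q0 Qq]]; exists q; split=> // psi hpsi /(Qq psi hpsi)/QQ'. Qed.

Lemma generic_and Q Q' : generic Q -> generic Q' -> generic (fun psi => Q psi /\ Q' psi).
Proof.
move=> [q [q0 Qq]] [r [r0 Qr]]; exists (q * r); rewrite rmorphM mulf_neq0 //; split=> // psi hpsi.
rewrite rmorphM mulf_eq0 negb_or => /andP[qn rn].
by split; [apply: Qq | apply: Qr].
Qed.

Lemma generic_neq0 f : regular_at_base f -> f base != 0 -> generic (fun psi => f psi != 0).
Proof.
move=> [p [q [q0 fE]]] f0; exists (p * q).
have p0 : evalp p base != 0 by apply: contra_neq f0 => p0; rewrite fE // p0 mul0r.
rewrite rmorphM mulf_neq0 //; split=> // psi _.
rewrite rmorphM mulf_eq0 negb_or => /andP[pn qn].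
by rewrite fE // mulf_neq0 ?invr_eq0.
Qed.

Lemma generic_all Q : (forall psi, global_section psi -> Q psi) -> generic Q.
Proof. by move=> hQ; exists 1; rewrite rmorph1 oner_neq0; split=> // psi hpsi _; apply: hQ. Qed.

Lemma general_of_generic Q : generic Q -> general_section Q.
Proof. by move=> [q [q0 Qq]]; exists q; split=> //; exists base. Qed.

(* A rational family of changes of coordinates on the sections, defined and
   trivial at the base section. *)
Definition reduction (Psi : ('I_2 -> spinor K) -> 'I_2 -> spinor K) : Prop :=
  [/\ forall k S, regular_at_base (fun psi => Psi psi k S), Psi base = base,
      forall psi, global_section psi -> global_section (Psi psi) &
      forall psi, isomorphic (zero_locus psi) (zero_locus (Psi psi))].

Lemma isomorphic_refl n (X : points K n) : isomorphic X X.
Proof.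
by exists (fun A U => U); split=> // A; split=> // U XU; exists U.
Qed.

Lemma reduction_id : reduction id.
Proof.
split=> // [k S | psi]; first exact: regular_coord.
exact: isomorphic_refl.
Qed.

Lemma shift0 (n : 'rV[K]_10) d : shift n 0 d = d.
Proof.
rewrite /shift -(scale0r (0 : 'rV[K]_10)) cliffordZl scale0_spinor.
by rewrite clifford0r addr0.
Qed.

Lemma regular_clifford (v : ('I_2 -> spinor K) -> 'rV[K]_10) (d : ('I_2 -> spinor K) -> spinor K) :
  (forall i, (i < 10)%N -> regular_at_base (fun psi => co (v psi) i)) ->
  (forall S, regular_at_base (fun psi => d psi S)) ->
  forall S, regular_at_base (fun psi => clifford (v psi) (d psi) S).
Proof.
move=> rv rd S; have coo (j : 'I_10) : regular_at_base (fun psi => v psi 0 j).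
  have -> : (fun psi => v psi 0 j) = fun psi => co (v psi) j by apply: funext => psi; rewrite coE.
  exact: rv.
have -> : (fun psi => clifford (v psi) (d psi) S) = fun psi =>
    (\sum_(i in S) (wedge_sign K i S * v psi 0 (lshift 5 i)) * d psi (S :\ i) +
    \sum_(i in ~: S) (wedge_sign K i S * v psi 0 (rshift 5 i)) * d psi (i |: S)).
  apply: funext => psi; rewrite ffunE.
  by congr (_ + _); apply: eq_bigr => i _; rewrite !mxE.
apply: regularD; apply: regular_sum => i; apply: regularM => //; apply: regularM => //;
  exact: regular_const.
Qed.

(** Orthogonality gives [1 + polar n m = 1]. The step is then an isomorphism for every section, even
    where a denominator in [m] is zero and the inverse takes its default value. *)
Lemma reduction_shift n m Psi : reduction Psi -> quad n = 0 ->
  (forall i, (i < 10)%N -> regular_at_base (fun psi => co (m psi) i)) ->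
  (forall psi, polar n (m psi) = 0) -> m base = 0 ->
  reduction (fun psi k => shift n (m psi) (Psi psi k)).
Proof.
move=> [rPsi Psi0 ePsi iPsi] qn rm nm m0; split=> [k S||psi hpsi k|psi].
- have -> : (fun psi => shift n (m psi) (Psi psi k) S) =
      fun psi => Psi psi k S + clifford n (clifford (m psi) (Psi psi k)) S.
    by apply: funext => psi; rewrite ffunE.
  apply: regularD => //; apply: (regular_clifford (v := fun=> n)) => [i _|].
    exact: regular_const.
  exact: regular_clifford.
- by apply: funext => k; rewrite m0 shift0 Psi0.
- move=> S par; have h := ePsi psi hpsi k.
  have h2 := half_spin_clifford n (half_spin_clifford (m psi) h).
  by rewrite ffunE h // h2 // addr0.
apply: isomorphic_trans (iPsi psi) _; apply: zero_locus_shift => //.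
by rewrite nm addr0 oner_neq0.
Qed.

End Generic.

Lemma zero_locus_scale (K : fieldType) (psi : 'I_2 -> spinor K) (c : 'I_2 -> K) :
  (forall k, c k != 0) ->
  zero_locus (fun k => scale_spinor (c k) (psi k)) = zero_locus psi.
Proof.
have sub (phi : 'I_2 -> spinor K) (e : 'I_2 -> K) (A : comAlgType K) U :
    @zero_locus K phi A U -> @zero_locus K (fun k => scale_spinor (e k) (phi k)) A U.
  move=> [hU imU]; split=> // k.
  suff -> : [ffun S => (scale_spinor (e k) (phi k) S)%:A] =
     scale_spinor (e k)%:A [ffun S => (phi k S)%:A] :> spinor A by apply: clifford_imageZ.
  by apply/ffunP => S; rewrite !ffunE -!/(in_alg A _) rmorphM.
move=> c0; apply: functional_extensionality_dep => A; apply/seteqP; split=> U; last exact: sub.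
move/(sub _ (fun k => (c k)^-1)).
have -> : (fun k => scale_spinor (c k)^-1 (scale_spinor (c k) (psi k))) = psi => //.
by apply: funext => k; rewrite scale_spinorA mulVf // scale1_spinor.
Qed.

(** * Elimination of the coefficients of the two spinors *)

Section Step.

Variable K : fieldType.
Implicit Types (D E : bspinor K) (s l : seq K) (S : bool -> bool -> bool -> bool -> bool -> bool).

Local Notation reduction := (reduction (std_section K)).
Local Notation regular := (regular_at_base (std_section K)).
Local Notation generic := (generic (std_section K)).

Definition truncate S D : bspinor K := fun b0 b1 b2 b3 b4 =>
  if S b0 b1 b2 b3 b4 then D b0 b1 b2 b3 b4 else 0.

Definition supported S D : Prop := forall b0 b1 b2 b3 b4, ~~ S b0 b1 b2 b3 b4 ->
  D b0 b1 b2 b3 b4 = 0.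

Lemma supportedE S D : supported S D -> D = truncate S D.
Proof.
move=> hD; do 5!apply: funext => ?; rewrite /truncate.
by case: ifPn => // /hD.
Qed.

Lemma bclifford_row s D : bclifford (co (row_of 10 s)) D = bclifford (nth 0 s) D.
Proof. by rewrite /bclifford !co_row_of. Qed.

(** [c] times the action of [1 + n m] with [n = s] and [m = s' / c]; with the denominator cleared,
    the vanishing of a coefficient is a matter for [ring]. *)
Definition bshift c s s' D : bspinor K := fun b0 b1 b2 b3 b4 =>
  c * D b0 b1 b2 b3 b4 + bclifford (nth 0 s) (bclifford (nth 0 s') D) b0 b1 b2 b3 b4.

Lemma bits_shift c s s' (d : spinor K) b0 b1 b2 b3 b4 : c != 0 ->
  bits (shift (row_of 10 s) (c^-1 *: row_of 10 s') d) b0 b1 b2 b3 b4 =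
  c^-1 * bshift c s s' (bits d) b0 b1 b2 b3 b4.
Proof.
move=> c0; rewrite /shift bits_add cliffordZl cliffordZr bits_scale bits_clifford.
by rewrite bcliffordE !bclifford_row /bshift [in RHS]mulrDr (mulKf c0).
Qed.

Lemma supported_shift S c s s' (d : spinor K) : c != 0 -> supported S (bshift c s s' (bits d)) ->
  supported S (bits (shift (row_of 10 s) (c^-1 *: row_of 10 s') d)).
Proof. by move=> c0 hS b0 b1 b2 b3 b4 /hS E; rewrite bits_shift // E mulr0. Qed.

Definition reducible S T : Prop := exists Psi, reduction Psi /\
  generic (fun psi => supported S (bits (Psi psi 0)) /\ supported T (bits (Psi psi 1))).

Definition even5 : bool -> bool -> bool -> bool -> bool -> bool := fun b0 b1 b2 b3 b4 =>
  ~~ (b0 (+) b1 (+) b2 (+) b3 (+) b4).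

Lemma reducible_even5 : reducible even5 even5.
Proof.
exists id; split; first exact: reduction_id.
apply: generic_all => psi hpsi; have supp k : supported even5 (bits (psi k)).
  have [h _] := half_spinP false (psi k).
  by move=> b0 b1 b2 b3 b4 par; apply: h => //; move: par; rewrite /even5; case: (_ (+) b4).
by split; apply: supp.
Qed.

(** [f] is the common denominator and [h] lists the numerators of [m]. At the standard pair [f] is 1
    and [h] is 0, so the change of coordinates is regular and trivial there. *)
Lemma reducible_step S T S' T' s (f : bspinor K -> bspinor K -> K)
    (h : bspinor K -> bspinor K -> seq K) :
  reducible S T -> quad (row_of 10 s) = 0 ->
  f (std_bits K 0) (std_bits K 1) = 1 ->
  (forall i, (i < 10)%N -> nth 0 (h (std_bits K 0) (std_bits K 1)) i = 0) ->
  (forall D E, polar (row_of 10 s) (row_of 10 (h D E)) = 0) ->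
  (forall D E : ('I_2 -> spinor K) -> bspinor K,
    (forall b0 b1 b2 b3 b4, regular (fun psi => D psi b0 b1 b2 b3 b4)) ->
    (forall b0 b1 b2 b3 b4, regular (fun psi => E psi b0 b1 b2 b3 b4)) ->
    regular (fun psi => f (D psi) (E psi)) /\
    (forall i, (i < 10)%N -> regular (fun psi => nth 0 (h (D psi) (E psi)) i))) ->
  (forall D E, supported S D -> supported T E ->
    supported S' (bshift (f D E) s (h D E) D) /\ supported T' (bshift (f D E) s (h D E) E)) ->
  reducible S' T'.
Proof.
move=> [Psi [rPsi gPsi]] qs f1 h0 sh rfh ST.
have [cPsi Psi0 ePsi iPsi] := rPsi.
have cb k b0 b1 b2 b3 b4 : regular (fun psi => bits (Psi psi k) b0 b1 b2 b3 b4) by apply: cPsi.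
have [rf rh] := rfh _ _ (cb 0) (cb 1).
have fb : f (bits (Psi (std_section K) 0)) (bits (Psi (std_section K) 1)) = 1.
  by rewrite Psi0 !bits_std.
pose fP psi := f (bits (Psi psi 0)) (bits (Psi psi 1)).
pose hP psi := row_of 10 (h (bits (Psi psi 0)) (bits (Psi psi 1))).
exists (fun psi k => shift (row_of 10 s) ((fP psi)^-1 *: hP psi) (Psi psi k)); split.
  apply: reduction_shift => // [i lti | psi |].
  - have -> : (fun psi => co ((fP psi)^-1 *: hP psi) i) =
        fun psi => (fP psi)^-1 * nth 0 (h (bits (Psi psi 0)) (bits (Psi psi 1))) i.
      by apply: funext => psi; rewrite coZ co_row_of.
    apply: regularM; last exact: rh.
    by apply: regularV => //; rewrite /fP fb oner_neq0.
  - by rewrite polarZr sh mulr0.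
  rewrite (_ : hP _ = 0) ?scaler0 //; apply: co_ext => i lti.
  by rewrite co_row_of // Psi0 !bits_std h0 // co0.
have f0 : generic (fun psi => fP psi != 0) by apply: generic_neq0 => //; rewrite /fP fb oner_neq0.
apply: generic_imp (generic_and f0 gPsi) => psi [f0psi [hD hE]].
by have [hD' hE'] := ST _ _ hD hE; split; apply: supported_shift.
Qed.

End Step.

Section Reduction.

Variable K : fieldType.
Implicit Types (D E : bspinor K).

Fixpoint exactly_one (s : seq bool) : bool :=
  if s is b :: s' then if b then ~~ has id s' else exactly_one s' else false.

(* The even subsets of {0, ..., 4}, except the {i < j} for i < k. *)
Definition no_pairs k : bool -> bool -> bool -> bool -> bool -> bool := fun b0 b1 b2 b3 b4 =>
  even5 b0 b1 b2 b3 b4 && ~~ [|| (0 < k)%N && b0 && exactly_one [:: b1; b2; b3; b4],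
    (1 < k)%N && ~~ b0 && b1 && exactly_one [:: b2; b3; b4],
    (2 < k)%N && ~~ b0 && ~~ b1 && b2 && exactly_one [:: b3; b4] |
    (3 < k)%N && ~~ b0 && ~~ b1 && ~~ b2 && b3 && b4].

(* The supports in the later normal forms: ends4 is {}, 0123; with4 the even
   sets containing 4; one_or_three is 04, 1234 and the 0ij4; ends5 is 04, 1234. *)
Definition ends4 : bool -> bool -> bool -> bool -> bool -> bool := fun b0 b1 b2 b3 b4 =>
  [&& ~~ b4, b0 == b1, b1 == b2 & b2 == b3].

Definition with4 : bool -> bool -> bool -> bool -> bool -> bool := fun b0 b1 b2 b3 b4 =>
  b4 && even5 b0 b1 b2 b3 b4.

Definition one_or_three : bool -> bool -> bool -> bool -> bool -> bool := fun b0 b1 b2 b3 b4 =>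
  [&& b4, even5 b0 b1 b2 b3 b4 & b0 || [&& b1, b2 & b3]].

Definition ends5 : bool -> bool -> bool -> bool -> bool -> bool := fun b0 b1 b2 b3 b4 =>
  [&& b4, b0 != b1, b1 == b2 & b2 == b3].

Ltac regular rD rE := rewrite /=; repeat first
  [ match goal with
    | |- regular_at_base _ (fun psi => @?f psi + @?g psi) => apply: regularD
    | |- regular_at_base _ (fun psi => @?f psi * @?g psi) => apply: regularM
    | |- regular_at_base _ (fun psi => - @?f psi) => apply: regularN
    end | exact: rD | exact: rE | exact: regular_const].

Ltac std_values := rewrite /std_bits /= ?(mulr0, mul0r, oppr0, addr0, mulr1).

Ltac step l f h H := apply: (reducible_step (s := l) (f := f) (h := h) H);
  [ by rewrite /quad !co_row_of //= ?(mulr0, mul0r, addr0)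
  | by std_values
  | by apply: forall_lt10; std_values
  | by move=> ? ?; rewrite /polar !co_row_of //= ?(mulr0, mul0r, addr0)
  | let rD := fresh in let rE := fresh in
    move=> ? ? rD rE; split; [regular rD rE | apply: forall_lt10; regular rD rE]
  | let hD := fresh in let hE := fresh in
    move=> ? ? hD hE; split; [rewrite (supportedE hD) | rewrite (supportedE hE)]; clear;
    do 5!case; (let h := fresh in move=> h; compute in h; first [discriminate h | clear h]);
    rewrite /bshift /bclifford /sgn /=; rewrite /truncate /=; ring ].

(** With [n = e_0] and [m] in the span of [e_1], ..., [e_4], the wedge of [n] and [m] with the
    constant term cancels the coefficients of all [e_0j]. The next lemmas do the same with [e_1],
    [e_2], [e_3]. *)
Lemma reducible_no_pairs1 : reducible K (no_pairs 1) even5.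
Proof.
have H := reducible_even5 K.
step [:: 1 : K] (fun D E : bspinor K => D false false false false false)
  (fun D E : bspinor K => [:: 0; - D true true false false false; - D true false true false false;
    - D true false false true false; - D true false false false true; 0; 0; 0; 0; 0]) H.
Qed.

Lemma reducible_no_pairs2 : reducible K (no_pairs 2) even5.
Proof.
have H := reducible_no_pairs1.
step [:: 0; 1 : K] (fun D E : bspinor K => D false false false false false)
  (fun D E : bspinor K => [:: 0; 0; - D false true true false false;
    - D false true false true false; - D false true false false true; 0; 0; 0; 0; 0]) H.
Qed.

Lemma reducible_no_pairs3 : reducible K (no_pairs 3) even5.
Proof.
have H := reducible_no_pairs2.
step [:: 0; 0; 1 : K] (fun D E : bspinor K => D false false false false false)
  (fun D E : bspinor K => [:: 0; 0; 0;
    - D false false true true false; - D false false true false true; 0; 0; 0; 0; 0]) H.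
Qed.

Lemma reducible_no_pairs4 : reducible K (no_pairs 4) even5.
Proof.
have H := reducible_no_pairs3.
step [:: 0; 0; 0; 1 : K] (fun D E : bspinor K => D false false false false false)
  (fun D E : bspinor K => [:: 0; 0; 0; 0;
    - D false false false true true; 0; 0; 0; 0; 0]) H.
Qed.

(** Now [m] lies in [F]: it kills the constant term and contracts [e_0123] to triples, which the
    wedge with [e_4] turns into the remaining 4-subsets. *)
Lemma reducible_ends4 : reducible K ends4 even5.
Proof.
have H := reducible_no_pairs4.
step [:: 0; 0; 0; 0; 1 : K] (fun D E : bspinor K => D true true true true false)
  (fun D E : bspinor K => [:: 0; 0; 0; 0; 0; D false true true true true;
    - D true false true true true; D true true false true true; - D true true true false true; 0]) H.
Qed.

(* The part of the second section without e_4 lies in the half-spin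
   representation of Spin_8, where Clifford multiplication by a spinor of
   nonzero norm x_0 y_0 - x_1 y_1 + x_2 y_2 - x_3 y_3 is bijective on the
   vectors. *)
Lemma reducible_with4 : reducible K ends4 with4.
Proof.
have H := reducible_ends4.
step [:: 0; 0; 0; 0; 0; 0; 0; 0; 0; 1 : K]
  (fun D E : bspinor K =>
    let x0 := E true false false false true in let x1 := E false true false false true in
    let x2 := E false false true false true in let x3 := E false false false true true in
    let y0 := E false true true true true in let y1 := E true false true true true in
    let y2 := E true true false true true in let y3 := E true true true false true in
    x0 * y0 - x1 * y1 + x2 * y2 - x3 * y3)
  (fun D E : bspinor K =>
    let x0 := E true false false false true in let x1 := E false true false false true in
    let x2 := E false false true false true in let x3 := E false false false true true in
    let y0 := E false true true true true in let y1 := E true false true true true in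
    let y2 := E true true false true true in let y3 := E true true true false true in
    let a := E false false false false false in let a01 := E true true false false false in
    let a02 := E true false true false false in let a03 := E true false false true false in
    let a12 := E false true true false false in let a13 := E false true false true false in
    let a23 := E false false true true false in let a4 := E true true true true false in [::
    - a4 * x0 + a01 * y1 - a02 * y2 + a03 * y3;
    - a4 * x1 + a01 * y0 - a12 * y2 + a13 * y3;
    - a4 * x2 + a02 * y0 - a12 * y1 + a23 * y3;
    - a4 * x3 + a03 * y0 - a13 * y1 + a23 * y2; 0;
    - a * y0 + a12 * x3 - a13 * x2 + a23 * x1;
    a * y1 - a02 * x3 + a03 * x2 - a23 * x0;
    - a * y2 + a01 * x3 - a03 * x1 + a13 * x0;
    a * y3 - a01 * x2 + a02 * x1 - a12 * x0; 0]) H.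
Qed.

(** Contraction by the dual of [e_0] after a wedge with [e_1], [e_2], [e_3] sends both 1 and
    [e_0123] to zero, so the first spinor keeps its form, while [e_04] yields the [e_j4] to be
    cancelled. *)
Lemma reducible_one_or_three : reducible K ends4 one_or_three.
Proof.
have H := reducible_with4.
step [:: 0; 0; 0; 0; 0; 1 : K] (fun D E : bspinor K => E true false false false true)
  (fun D E : bspinor K => [:: 0; E false true false false true; E false false true false true;
    E false false false true true; 0; 0; 0; 0; 0; 0]) H.
Qed.

(** The wedge with [e_0] after contractions by the duals of [e_1], [e_2], [e_3] again sends 1 and
    [e_0123] to zero, while [e_1234] yields the terms with indices 0, i, j, 4. *)
Lemma reducible_ends5 : reducible K ends4 ends5.
Proof.
have H := reducible_one_or_three.
step [:: 1 : K] (fun D E : bspinor K => E false true true true true)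
  (fun D E : bspinor K => [:: 0; 0; 0; 0; 0; 0; - E true false true true true;
     E true true false true true; - E true true true false true; 0]) H.
Qed.

End Reduction.

(** * Normalization by the torus and by rescaling *)

Section Torus.

Variable K : fieldType.

Definition torus i (t : K) : spinor K -> spinor K :=
  shift (row_of 10 (ncons i 0 [:: t - 1])) (row_of 10 (ncons (5 + i) 0 [:: 1])).

Lemma zero_locus_torus i t psi : (i < 5)%N -> t != 0 ->
  isomorphic (zero_locus psi) (zero_locus (fun k => torus i t (psi k))).
Proof.
move=> lti t0; apply: zero_locus_shift; rewrite /polar /quad !co_row_of //.
  by case: i lti => [|[|[|[|[|]]]]] //= _; rewrite ?(mulr0, mul0r, addr0).
by case: i lti => [|[|[|[|[|]]]]] //= _; rewrite !(mulr0, mul0r, addr0, add0r, mulr1) addrC subrK.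
Qed.

Lemma bits_torus i t d b0 b1 b2 b3 b4 : (i < 5)%N ->
  bits (torus i t d) b0 b1 b2 b3 b4 =
  (if nth false [:: b0; b1; b2; b3; b4] i then t else 1) * bits d b0 b1 b2 b3 b4.
Proof.
rewrite bits_add bits_clifford bcliffordE !bclifford_row; move: (bits d) => D.
by case: i => [|[|[|[|[|]]]]] // _; move: b0 b1 b2 b3 b4; do 5!case;
  rewrite /bclifford /sgn /=; ring.
Qed.

Lemma normal_form_iso (psi : 'I_2 -> spinor K) :
  (forall x : K, exists y, y ^+ 2 = x) ->
  supported ends4 (bits (psi 0)) -> supported ends5 (bits (psi 1)) ->
  bits (psi 0) false false false false false != 0 ->
  bits (psi 0) true true true true false != 0 ->
  bits (psi 1) true false false false true != 0 ->
  bits (psi 1) false true true true true != 0 ->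
  isomorphic (zero_locus psi) (zero_locus (std_section K)).
Proof.
move=> sqr /supportedE hD /supportedE hE.
set a := bits _ false false false false false; set c := bits _ true true true true false.
set x := bits _ true false false false true; set y := bits _ false true true true true.
(* Torus elements of parameters [t] at index 0 and [u] at index 1 turn the pairs (a, c) and (x, y)
   into (a, c t u) and (x t, y u). Equal entries in each pair mean [u = x t / y] and
   [t ^+ 2 = a y / (c x)], which calls for a square root; rescaling each spinor does the rest. *)
move=> a0 c0 x0 y0; have [t t2] := sqr (a * y / (c * x)).
have t0 : t != 0.
  have : t ^+ 2 != 0 by rewrite t2 !mulf_neq0 ?invr_eq0 ?mulf_neq0.
  by rewrite expf_eq0.
have u0 : x * t / y != 0 by rewrite !mulf_neq0 ?invr_eq0.
apply: isomorphic_trans (zero_locus_torus psi (isT : (0 < 5)%N) t0) _.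
apply: isomorphic_trans (zero_locus_torus _ (isT : (1 < 5)%N) u0) _.
set s := fun k : 'I_2 => if k == 0 then a else x * t.
have s0 k : s k != 0 by rewrite /s; case: ifP => // _; rewrite mulf_neq0.
rewrite -(zero_locus_scale (std_section K) s0).
suff -> : (fun k => torus 1 (x * t / y) (torus 0 t (psi k))) =
    fun k => scale_spinor (s k) (std_section K k) by apply: isomorphic_refl.
have E : c * (t * (x * t / y)) = a.
  have -> : c * (t * (x * t / y)) = c * x / y * t ^+ 2 by rewrite expr2; ring.
  by rewrite t2; field; rewrite c0 x0 y0.
apply: funext => k; apply: spinorP => b0 b1 b2 b3 b4.
rewrite !bits_torus // bits_scale bits_std /std_bits /s.
have [-> | -> ] : k = 0 \/ k = 1 by case: k => [] [|[|]] // lt; [left | right]; apply: val_inj.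
  rewrite hD /truncate /ends4 /=; case: b0; case: b1; case: b2; case: b3; case: b4 => /=;
    rewrite -?/a -?/c ?mulr0 ?mulr1 ?mul1r //.
  by rewrite -[RHS]E; ring.
rewrite hE /truncate /ends5 /=; case: b0; case: b1; case: b2; case: b3; case: b4 => /=;
  rewrite -?/x -?/y ?mulr0 ?mulr1 ?mul1r //; first by rewrite mulrC.
by rewrite divfK.
Qed.

Lemma generic_std_iso : (forall x : K, exists y, y ^+ 2 = x) ->
  general_section (fun psi : 'I_2 -> spinor K =>
    isomorphic (zero_locus psi) (zero_locus (std_section K))).
Proof.
move=> sqr; have [Psi [[cPsi Psi0 ePsi iPsi] gPsi]] := reducible_ends5 K.
have nz k b0 b1 b2 b3 b4 : std_bits K k b0 b1 b2 b3 b4 = 1 ->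
    generic (std_section K) (fun psi => bits (Psi psi k) b0 b1 b2 b3 b4 != 0).
  move=> v1; apply: generic_neq0; first exact: cPsi.
  by rewrite Psi0 bits_std v1 oner_neq0.
apply: (general_of_generic (base := std_section K) (@std_even K)).
have := generic_and gPsi (generic_and (generic_and (nz 0 false false false false false erefl)
  (nz 0 true true true true false erefl)) (generic_and (nz 1 true false false false true erefl)
  (nz 1 false true true true true erefl))).
apply: generic_imp => psi [[hD hE] [[a0 c0] [x0 y0]]].
by apply: isomorphic_trans (iPsi psi) _; apply: normal_form_iso.
Qed.

End Torus.

Import Num.Theory.

Local Open Scope complex_scope.

Lemma num_infinite (F : numFieldType) (s : seq F) : exists x, x \notin s.
Proof.
pose c (i : 'I_(size s).+1) : F := i%:R.
have [/existsP [i si]|] := boolP [exists i, c i \notin s]; first by exists (c i).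
rewrite negb_exists => /forallP sc; suff : (size (codom c) <= size s)%N.
  by rewrite size_codom card_ord ltnn.
apply: uniq_leq_size => [|_ /codomP [i ->]]; last by have := sc i; rewrite negbK.
by apply/injectiveP => i j /eqP; rewrite /c eqr_nat => /eqP/val_inj.
Qed.

(** [R[i]], for [R] a model of the real numbers, is the field of complex numbers. What enters is
    that it has square roots, that 2 and 3 are nonzero in it, and that it is infinite. *)
Theorem proposition15 (R : realType) :
  general_section (fun psi : 'I_2 -> spinor R[i] =>
    isomorphic (zero_locus psi) (G2_mod_P2 R[i])).
Proof.
have [p [p0 hp]] := @generic_std_iso R[i] (fun x => ex_intro _ (sqrtC x) (sqrtCK x)).
exists p; split=> // psi hpsi ppsi; apply: isomorphic_trans (hp psi hpsi ppsi) _.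
apply: isomorphic_trans; first by apply: std_zero_locus_iso; rewrite pnatr_eq0.
by apply: null_planes_iso; rewrite ?pnatr_eq0 //; apply: num_infinite.
Qed.
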